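(* Let $F(\mathbf z)=G(\mathbf z)/H(\mathbf z)=\sum_{\mathbf r\in\mathbb N^d}a_{\mathbf r}\mathbf z^{\mathbf r}$ with $a_{\mathbf r}\ge 0$ for all $\mathbf r$, where $G,H$ are analytic on an open neighborhood of the closure of the domain of convergence $\mathcal D$ of the series, $H(\mathbf 0)\ne0$, $G,H$ relatively prime, and $H$ vanishes somewhere. Assume the logarithmic domain of convergence $\log\mathcal D$ is strictly convex. Then for every direction $\overline{\mathbf r}$ in the interior of $\boldsymbol\Xi$ there is a minimal point $\mathbf z\in\mathcal V=\{H=0\}$ which lies in the positive orthant of $\mathbb R^d$ and satisfies $\overline{\mathbf r}\in\mathbf K(\mathbf z)$.
   Context: $\log\mathcal D=\{\mathbf x\in\mathbb R^d:(e^{x_1},\dots,e^{x_d})\in\mathcal D\}$ is convex; strictly convex means its boundary contains no line segment. $\overline{\mathcal O}$ is the positive orthant of $\mathbb{RP}^{d-1}$ (projective classes of nonzero vectors with nonnegative coordinates). $\boldsymbol\Xi\subseteq\overline{\mathcal O}$ is the set of directions of (outward) normals to support hyperplanes of $\log\mathcal D$. A point $\mathbf z\in\mathcal V$ is minimal if all its coordinates are nonzero and no $\mathbf z'\in\mathcal V$ has $|z'_i|<|z_i|$ for all $i$. A point $\mathbf w$ is a smooth point of $\mathcal V$ if $\mathcal V$ is a manifold near $\mathbf w$; for a smooth point $\mathbf w\in\mathcal V\cap\partial\mathcal D$ (with $H$ square-free), $\mathrm{dir}(\mathbf w)$ is the projective class of $\left(w_1\frac{\partial H}{\partial w_1}(\mathbf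 w),\dots,w_d\frac{\partial H}{\partial w_d}(\mathbf w)\right)$, which lies in $\overline{\mathcal O}$. For a minimal point $\mathbf z$, $\mathbf K(\mathbf z)$ is the convex hull (in $\overline{\mathcal O}$, i.e. the cone generated) of the set of limit points of $\mathrm{dir}(\mathbf w)$ as $\mathbf w\to\mathbf z$ through smooth points of $\mathcal V$. *)

(* Defs.v *)
From HB Require Import structures.
From mathcomp Require Import all_boot all_order all_algebra finmap.
From mathcomp Require Import complex.
From mathcomp Require Import all_classical all_reals all_analysis.
From mathcomp Require summability.
Set Implicit Arguments.
Unset Strict Implicit.
Unset Printing Implicit Defensive.
Import Order.TTheory GRing.Theory Num.Theory numFieldNormedType.Exports.
Local Open Scope classical_set_scope.
Local Open Scope ring_scope.

(* The constant [C R] (rather than the type [R[i]]) is what makes the inference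
   of the topology and of the normed structure of C and of C^d succeed.       *)
Definition C (R : realType) : numClosedFieldType := R[i]%C.

Definition toC (R : realType) (x : R) : C R := (x%:C)%C.

Section Analytic.
Context {R : realType} {d : nat}.
Implicit Types (z w : 'rV[C R]_d) (f g h : 'rV[C R]_d -> C R).
Implicit Types (U V : set 'rV[C R]_d).

Definition mindex : choiceType := {ffun 'I_d -> nat}.

Definition monomial z (r : mindex) : C R := \prod_(i < d) z 0 i ^+ r i.

Definition abs_summable (x : mindex -> C R) : Prop :=
  summable [set: mindex] (fun r => (ComplexField.Normc.normc (x r))%:E).

(* Absolute convergence of a multiple series to [s]; the finite partial sums
   are taken along the directed set of all finite sets of multi-indices.      *)
Definition has_abs_sum (x : mindex -> C R) (s : C R) : Prop :=
  abs_summable x /\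
  summability.partial_sum x A @[A --> summability.totally] --> s.

Definition analytic_at f w : Prop :=
  exists c : mindex -> C R,
    \forall z \near w, has_abs_sum (fun r => c r * monomial (z - w) r) (f z).

Definition analytic_on U f : Prop := forall w, U w -> analytic_at f w.

Definition partial f (i : 'I_d) w : C R := 'D_(delta_mx 0 i) f w.

(* Divisibility, coprimality and square-freeness in the ring of germs of
   analytic functions at [w], whose units are the germs not vanishing at [w]. *)
Definition germ_divides w h f : Prop :=
  exists2 q, analytic_at q w & \forall z \near w, f z = q z * h z.

Definition germ_coprime w f g : Prop :=
  forall h, analytic_at h w -> germ_divides w h f -> germ_divides w h g ->
    h w != 0.

Definition germ_squarefree w f : Prop :=
  forall h, analytic_at h w -> germ_divides w (fun z => h z ^+ 2) f -> h w != 0.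

(* [V] is near [w] a complex submanifold of codimension one, i.e. the zero set
   of an analytic function with nonvanishing differential.                    *)
Definition smooth_point V w : Prop :=
  V w /\ exists h, [/\ analytic_at h w, exists i, partial h i w != 0 &
                       \forall z \near w, V z <-> h z = 0].

Definition zero_set U f : set 'rV[C R]_d := [set z | U z /\ f z = 0].

Definition minimal_point V z : Prop :=
  [/\ V z, forall i, z 0 i != 0 &
      ~ exists2 z', V z' & forall i, `|z' 0 i| < `|z 0 i|].

Definition series_term (a : mindex -> R) z (r : mindex) : C R :=
  toC (a r) * monomial z r.

Definition convergence_domain (a : mindex -> R) : set 'rV[C R]_d :=
  [set z | abs_summable (series_term a z)]°.

Definition log_domain (D : set 'rV[C R]_d) : set 'rV[R]_d :=
  [set x | D (\row_i toC (expR (x 0 i)))].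

End Analytic.

Arguments mindex : clear implicits.

Definition boundary {T : topologicalType} (A : set T) : set T :=
  closure A `\` A°.

(* To be used for sets that are known to be convex, such as logarithmic domains
   of convergence.                                                            *)
Definition strictly_convex {R : realType} {d : nat} (A : set 'rV[R]_d) : Prop :=
  ~ exists x y, x != y /\
      forall t : R, 0 <= t <= 1 -> boundary A (t *: x + (1 - t) *: y).

Section Projective.
Context {R : realType} {d : nat}.

Definition nonzero : topologicalType := [set v : 'rV[R]_d | v != 0].

Definition collinear (u v : nonzero) : bool :=
  `[< exists2 t : R, t != 0 & set_val v = t *: set_val u >].

Lemma collinear_refl : reflexive collinear.
Proof. by move=> u; apply/asboolP; exists 1; rewrite ?oner_neq0 ?scale1r. Qed.

Lemma collinear_sym : symmetric collinear.
Proof.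
move=> u v; apply/asbool_equiv_eq; split=> -[t t0 ->]; exists t^-1;
  by rewrite ?invr_eq0 // scalerA mulVf // scale1r.
Qed.

Lemma collinear_trans : transitive collinear.
Proof.
move=> v u w /asboolP[s s0 vE] /asboolP[t t0 wE]; apply/asboolP.
by exists (t * s); rewrite ?mulf_neq0 // wE vE scalerA.
Qed.

Canonical collinear_equiv :=
  EquivRel collinear collinear_refl collinear_sym collinear_trans.

(* The real projective space RP^(d-1), with its quotient topology. *)
Definition RP : topologicalType :=
  quotient_topology {eq_quot collinear_equiv}%qT.

(* [v] is a vector of homogeneous coordinates of [p]. *)
Definition homog (v : 'rV[R]_d) (p : RP) : Prop :=
  exists2 u : nonzero, set_val u = v & (\pi_RP u)%qT = p.

Definition nonneg (v : 'rV[R]_d) : Prop := forall i, 0 <= v 0 i.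

(* Convex hull inside the positive orthant of RP^(d-1): directions of the cone
   generated by the nonnegative representatives of the members of [S].        *)
Definition orthant_hull (S : set RP) : set RP :=
  [set p | exists v, homog v p /\
    exists n (u : 'I_n -> 'rV[R]_d) (c : 'I_n -> R),
      [/\ forall k, nonneg (u k) /\ exists2 q, S q & homog (u k) q,
          forall k, 0 <= c k &
          v = \sum_(k < n) c k *: u k]].

Definition dot (u v : 'rV[R]_d) : R := \sum_(i < d) u 0 i * v 0 i.

(* Directions of outward normals to support hyperplanes, a support hyperplane
   being one that meets the boundary.                                         *)
Definition normal_directions (A : set 'rV[R]_d) : set RP :=
  [set p | exists v, homog v p /\
    exists2 y, boundary A y & forall x, A x -> dot v x <= dot v y].

(* [p] is the projective class of the complex vector (w_i dH/dw_i (w))_i; it is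
   a real class when that vector is a complex multiple of a real one.  If [H]
   is not square-free the vector may vanish at smooth points of {H = 0}, and
   there is then no such [p].                                                 *)
Definition dir_class (H : 'rV[C R]_d -> C R) (w : 'rV[C R]_d) (p : RP) : Prop :=
  exists v, homog v p /\
    exists2 c : C R, c != 0 &
      forall i, toC (v 0 i) = c * (w 0 i * partial H i w).

(* Limit points of dir(w) as w --> z through the smooth points of [V] lying on
   the boundary of [D], where dir(w) is defined; w = z is allowed, as needed
   when d = 1 and [V] is discrete.                                            *)
Definition limit_dirs (H : 'rV[C R]_d -> C R) (V D : set 'rV[C R]_d)
    (z : 'rV[C R]_d) : set RP :=
  [set p | forall (W : set 'rV[C R]_d) (P : set RP), nbhs z W -> nbhs p P ->
    exists w q, [/\ W w, smooth_point V w, boundary D w, dir_class H w q & P q]].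

Definition Kcone (H : 'rV[C R]_d -> C R) (V D : set 'rV[C R]_d)
    (z : 'rV[C R]_d) : set RP :=
  orthant_hull (limit_dirs H V D z).

End Projective.

Arguments nonzero : clear implicits.
Arguments RP : clear implicits.

(* Main.v *)
(* By the identity theorem F H = G on D, so coprimality forces H to be nonzero on
   D, and every zero of H over the boundary of D is minimal. Since the
   coefficients are nonnegative, Pringsheim's argument gives H = 0 on all of
   exp (boundary (log D)). Where H has a nonzero gradient, the vector
   (w_i dH/dw_i) at w = exp y is a complex multiple of the unique normal to the
   convex lower set log D at y. Such points are dense in the boundary of log D:
   otherwise some derivative h of H would vanish on the boundary together with H,
   have a nonzero gradient, and every function vanishing on the boundary to order
   two, in particular H, would be divisible by h^2 (Weierstrass division by a
   series of order one), although H is square-free. Finally, normals to a convex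
   set are monotone: if v is a normal at y, then for each u the normals at smooth
   points near y + t u have limits q, as t -> 0, with <q, u> >= <v, u>. Hence v is
   in the convex hull of the limits of normals at smooth points tending to y. *)

Require Import Defs.
From HB Require Import structures.
From mathcomp Require Import all_boot all_order all_algebra finmap.
From mathcomp Require Import complex.
From mathcomp Require Import all_classical all_reals all_analysis.
From mathcomp Require Import ring lra zify.
Set Implicit Arguments.
Unset Strict Implicit.
Unset Printing Implicit Defensive.
Import Order.TTheory GRing.Theory Num.Theory numFieldNormedType.Exports.
Local Open Scope classical_set_scope.
Local Open Scope ring_scope.

(** * Unordered sums *)

Section ComplexModulus.
Context {R : realType}.
Implicit Types (x y : C R) (a b : R).

(** Nothing is known beforehand about the regularity of the boundary of log D, but a nonempty proper
    open lower set has as boundary the graph, in the direction (1, ..., 1), of a function that is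
    1-Lipschitz for the max norm. Boundary points near y are therefore y + t u + s (1, ..., 1) with
    s = O(t), and the Taylor expansion of a function vanishing on the boundary gives a linear
    relation between t and s up to O(t^2). As t and s are real, this relation both identifies the
    normal and shows that the complex gradient is a multiple of a real vector. Normals are scaled to
    coordinate sum 1: they then stay in a compact set, and the unknown shift s cancels when two of
    them are compared. Analytic functions are handled as absolutely summable families of
    coefficients with explicit bounds, without Cauchy integrals: products, changes of centre and
    Pringsheim's argument are rearrangements of such families, and division is a fixed point
    equation for coefficients. *)

Definition nrm x : R := ComplexField.Normc.normc x.

HB.instance Definition _ := GRing.RMorphism.copy (@toC R) (@real_complex R).

(** The norm of [C R] has values in [C R]; [nrm] is the same modulus as a real number, in which the
    estimates are made. *)
Lemma normCE x : `|x| = toC (nrm x).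
Proof. by []. Qed.

Lemma toC_le a b : (toC a <= toC b) = (a <= b).
Proof. exact: lecR. Qed.

Lemma toC_lt a b : (toC a < toC b) = (a < b).
Proof. exact: ltcR. Qed.

Lemma toC_inj : injective (@toC R).
Proof. exact: fmorph_inj. Qed.

Lemma nrm_ge0 x : 0 <= nrm x.
Proof. by rewrite -toC_le -normCE normr_ge0. Qed.

Lemma nrmM x y : nrm (x * y) = nrm x * nrm y.
Proof. by apply: toC_inj; rewrite rmorphM -!normCE normrM. Qed.

Lemma nrm_toC a : nrm (toC a) = `|a|.
Proof. by rewrite /nrm /= expr0n /= addr0 sqrtr_sqr. Qed.

Lemma toC0 : toC 0 = 0 :> C R.
Proof. exact: rmorph0. Qed.

Lemma toC1 : toC 1 = 1 :> C R.
Proof. exact: rmorph1. Qed.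

Lemma toCB a b : toC (a - b) = toC a - toC b.
Proof. exact: rmorphB. Qed.

Lemma toCD a b : toC (a + b) = toC a + toC b.
Proof. exact: rmorphD. Qed.

Lemma toCM a b : toC (a * b) = toC a * toC b.
Proof. exact: rmorphM. Qed.

Lemma toC_sum I (s : seq I) (P : pred I) (F : I -> R) :
  toC (\sum_(i <- s | P i) F i) = \sum_(i <- s | P i) toC (F i).
Proof. exact: rmorph_sum. Qed.

Lemma toC_prod I (s : seq I) (P : pred I) (F : I -> R) :
  toC (\prod_(i <- s | P i) F i) = \prod_(i <- s | P i) toC (F i).
Proof. exact: rmorph_prod. Qed.

Lemma nrm0 : nrm 0 = 0.
Proof. by rewrite -(rmorph0 (@toC R)) nrm_toC normr0. Qed.

Lemma nrm1 : nrm 1 = 1.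
Proof. by rewrite -(rmorph1 (@toC R)) nrm_toC normr1. Qed.

Lemma nrm_eq0 x : (nrm x == 0) = (x == 0).
Proof. by rewrite -(inj_eq toC_inj) -normCE rmorph0 normr_eq0. Qed.

Lemma nrm_gt0 x : (0 < nrm x) = (x != 0).
Proof. by rewrite lt_def nrm_ge0 nrm_eq0 andbT. Qed.

Lemma nrmN x : nrm (- x) = nrm x.
Proof. by apply: toC_inj; rewrite -!normCE normrN. Qed.

Lemma nrmV x : nrm x^-1 = (nrm x)^-1.
Proof. by apply: toC_inj; rewrite fmorphV -!normCE normfV. Qed.

Lemma nrmX x n : nrm (x ^+ n) = nrm x ^+ n.
Proof. by apply: toC_inj; rewrite rmorphXn -!normCE normrX. Qed.

Lemma nrmD x y : nrm (x + y) <= nrm x + nrm y.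
Proof. by rewrite -toC_le rmorphD -!normCE ler_normD. Qed.

Lemma nrmB x y : nrm (x - y) <= nrm x + nrm y.
Proof. by rewrite -(nrmN y) nrmD. Qed.

Lemma nrm_distC x y : nrm (x - y) = nrm (y - x).
Proof. by rewrite -nrmN opprB. Qed.

Lemma nrm_nat n : nrm n%:R = n%:R.
Proof. by rewrite -(rmorph_nat (@toC R)) nrm_toC ger0_norm. Qed.

Lemma nrm_sum I (s : seq I) (P : pred I) (F : I -> C R) :
  nrm (\sum_(i <- s | P i) F i) <= \sum_(i <- s | P i) nrm (F i).
Proof. by rewrite -toC_le rmorph_sum -normCE ler_norm_sum. Qed.

Lemma nrm_prod I (s : seq I) (P : pred I) (F : I -> C R) :
  nrm (\prod_(i <- s | P i) F i) = \prod_(i <- s | P i) nrm (F i).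
Proof. exact: (big_morph _ nrmM nrm1). Qed.

End ComplexModulus.

Section RealBounds.
Context {R : realType}.
Implicit Types (B : R).

(** For nonnegative [x] this is summability with sum at most [B]; carrying [B] avoids computing with
    infinite real sums. *)
Definition bnd (I : choiceType) (x : I -> R) B :=
  forall A : {fset I}, \sum_(i <- A) x i <= B.

Lemma bnd_ge0 (I : choiceType) (x : I -> R) B : bnd x B -> 0 <= B.
Proof. by move=> /(_ fset0); rewrite big_seq_fset0. Qed.

Lemma bnd_weak (I : choiceType) (x : I -> R) B B' :
  bnd x B -> B <= B' -> bnd x B'.
Proof. by move=> xB BB' A; exact: le_trans BB'. Qed.

Lemma bnd_le (I : choiceType) (x y : I -> R) B :
  (forall i, x i <= y i) -> bnd y B -> bnd x B.
Proof. by move=> xy yB A; apply: le_trans (yB A); apply: ler_sum. Qed.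

Lemma bndD (I : choiceType) (x y : I -> R) B B' :
  bnd x B -> bnd y B' -> bnd (fun i => x i + y i) (B + B').
Proof. by move=> xB yB A; rewrite big_split lerD. Qed.

Lemma bndZ (I : choiceType) (x : I -> R) B b :
  0 <= b -> bnd x B -> bnd (fun i => b * x i) (b * B).
Proof. by move=> b0 xB A; rewrite -mulr_sumr ler_wpM2l. Qed.

Lemma sum_fset_sub (I : choiceType) (x : I -> R) (A A' : {fset I}) :
  (forall i, 0 <= x i) -> (A `<=` A')%fset ->
  \sum_(i <- A) x i <= \sum_(i <- A') x i.
Proof.
move=> x0 AA'.
rewrite [leRHS](big_fsetID _ (mem A)) /=.
have -> : [fset i in A' | i \in A]%fset = A.
  by apply/fsetP => i; rewrite !inE /=; have [iA|] := boolP (i \in A);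
    rewrite ?andbF // (fsubsetP AA').
by rewrite lerDl sumr_ge0.
Qed.

Lemma bnd_inj (I J : choiceType) (f : J -> I) (x : I -> R) B :
  injective f -> bnd x B -> bnd (fun j => x (f j)) B.
Proof.
move=> fi xB A; have := xB (f @` A)%fset.
by rewrite big_imfset //= => i j _ _; apply: fi.
Qed.

Lemma bnd_supp (I : choiceType) (x : I -> R) (E : {fset I}) :
  (forall i, 0 <= x i) -> (forall i, i \notin E -> x i = 0) ->
  bnd x (\sum_(i <- E) x i).
Proof.
move=> x0 xE A; rewrite (big_fsetID _ (mem E)) /=.
rewrite [X in _ + X]big1_seq ?addr0; last first.
  by move=> i; rewrite !inE => /andP[_ /andP[_ /xE]].
apply: sum_fset_sub => //; apply/fsubsetP => i.
by rewrite !inE => /andP[].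
Qed.

(** The easy half of Tonelli's theorem: a finite set of pairs lies in the product of its two
    projections. *)
Lemma bnd_pair (I J : choiceType) (x : I * J -> R) (b : I -> R) B :
  (forall p, 0 <= x p) -> (forall i, bnd (fun j => x (i, j)) (b i)) ->
  bnd b B -> bnd x B.
Proof.
move=> x0 xb bB A.
pose A1 := [fset p.1 | p in A]%fset; pose A2 := [fset p.2 | p in A]%fset.
apply: (@le_trans _ _ (\sum_(i <- A1) \sum_(j <- A2) x (i, j))); last first.
  by apply: le_trans (bB A1); apply: ler_sum => i _; apply: xb.
have -> : \sum_(i <- A1) \sum_(j <- A2) x (i, j) =
   \sum_(p <- [fset ((i, j) : I * J) | i in A1, j in A2]%fset) x p.
  rewrite big_imfset2 //=; by move=> [i j] [i' j'] _ _ /= [-> ->].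
apply: sum_fset_sub => //.
apply/fsubsetP => -[i j] pA; apply/imfset2P; exists i.
  by apply/imfsetP; exists (i, j).
by exists j => //; apply/imfsetP; exists (i, j).
Qed.

Lemma sum_fsetU (I : choiceType) (x : I -> R) (A A' : {fset I}) :
  [disjoint A & A']%fset ->
  \sum_(i <- (A `|` A')%fset) x i = \sum_(i <- A) x i + \sum_(i <- A') x i.
Proof.
move=> AA'; rewrite (big_fsetID _ (mem A)) /=; congr (_ + _).
  by apply: eq_fbigl => i; rewrite !inE /= andb_idl // => ->.
apply: eq_fbigl => i; rewrite !inE /=; have [iA|_] := boolP (i \in A); last by rewrite andbT.
by apply/esym/negbTE; apply: (fdisjointP AA').
Qed.

(** [A0] has a sum within [e] of the supremum of all finite sums, so a disjoint set cannot add more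
    than [e]. *)
Lemma bnd_tail (I : choiceType) (x : I -> R) B e :
  (forall i, 0 <= x i) -> bnd x B -> 0 < e ->
  exists A0 : {fset I}, forall A : {fset I},
    [disjoint A & A0]%fset -> \sum_(i <- A) x i <= e.
Proof.
move=> x0 xB e0.
pose E := [set t : R | exists A : {fset I}, t = \sum_(i <- A) x i].
have E0 : E !=set0 by exists 0; exists fset0; rewrite big_seq_fset0.
have Eub : has_ubound E by exists B => _ [A ->].
have hsE : has_sup E by split.
have [_ [A0 ->] A0e] := sup_adherent e0 hsE.
exists A0 => A AA0.
have : \sum_(i <- (A `|` A0)%fset) x i <= sup E.
  by apply: sup_upper_bound => //; exists (A `|` A0)%fset.
by rewrite sum_fsetU // => h; lra.
Qed.

End RealBounds.

Section Hsum.
Context {R : realType}.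
Implicit Types (B e : R).

(** Convergence of the net of finite partial sums, without any order on [I]. *)
Definition hsum (I : choiceType) (x : I -> C R) (s : C R) :=
  forall e, 0 < e -> exists A0 : {fset I}, forall A : {fset I},
    (A0 `<=` A)%fset -> nrm (\sum_(i <- A) x i - s) < e.

Lemma hsum_ext (I : choiceType) (x y : I -> C R) s :
  (forall i, x i = y i) -> hsum x s -> hsum y s.
Proof.
move=> xy xs e /xs[A0 A0P]; exists A0 => A /A0P.
by under eq_bigr do rewrite xy.
Qed.

Lemma hsum_supp (I : choiceType) (x : I -> C R) (E : {fset I}) :
  (forall i, i \notin E -> x i = 0) -> hsum x (\sum_(i <- E) x i).
Proof.
move=> xE e e0; exists E => A EA.
rewrite -(big_fset_incl (A := E) _ EA) ?subrr ?nrm0 //.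
by move=> i _; apply: xE.
Qed.

Lemma hsum0 (I : choiceType) : hsum (fun=> 0 : C R) (0 : C R) (I := I).
Proof. by have := @hsum_supp I (fun=> 0) fset0; rewrite big_seq_fset0; apply. Qed.

Lemma hsumD (I : choiceType) (x y : I -> C R) s t :
  hsum x s -> hsum y t -> hsum (fun i => x i + y i) (s + t).
Proof.
move=> xs yt e e0; have e2 : 0 < e / 2 by rewrite divr_gt0.
have [A1 h1] := xs _ e2; have [A2 h2] := yt _ e2.
exists (A1 `|` A2)%fset => A; rewrite fsubUset => /andP[/h1 l1 /h2 l2].
rewrite big_split /= opprD addrACA.
by apply: le_lt_trans (nrmD _ _) _; rewrite (splitr e) ltrD.
Qed.

Lemma hsumZ (I : choiceType) (x : I -> C R) s c :
  hsum x s -> hsum (fun i => c * x i) (c * s).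
Proof.
move=> xs e e0; have [->|c0] := eqVneq c 0.
  by exists fset0 => A _; rewrite big1 ?mul0r ?subr0 ?nrm0// => i; rewrite mul0r.
have nc : 0 < nrm c by rewrite nrm_gt0.
have [A0 h] := xs _ (divr_gt0 e0 nc).
exists A0 => A /h l; rewrite -mulr_sumr -mulrBr nrmM.
by rewrite -ltr_pdivlMl // mulrC.
Qed.

Lemma hsumN (I : choiceType) (x : I -> C R) s :
  hsum x s -> hsum (fun i => - x i) (- s).
Proof.
by move=> /(hsumZ (-1)); rewrite mulN1r; apply: hsum_ext => i; rewrite mulN1r.
Qed.

Lemma hsumB (I : choiceType) (x y : I -> C R) s t :
  hsum x s -> hsum y t -> hsum (fun i => x i - y i) (s - t).
Proof. by move=> xs /hsumN; apply: hsumD. Qed.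

Lemma hsum_bigsum (I : choiceType) (J : eqType) (r : seq J) (x : J -> I -> C R) s :
  (forall j, hsum (x j) (s j)) ->
  hsum (fun i => \sum_(j <- r) x j i) (\sum_(j <- r) s j).
Proof.
move=> xs; elim: r => [|j r IH].
  by rewrite big_nil; apply: hsum_ext (@hsum0 I) => i; rewrite big_nil.
rewrite big_cons; apply: hsum_ext (hsumD (xs j) IH) => i.
by rewrite big_cons.
Qed.

Lemma hsum_nrm_le (I : choiceType) (x : I -> C R) s B :
  hsum x s -> bnd (fun i => nrm (x i)) B -> nrm s <= B.
Proof.
move=> xs xB; apply/ler_addgt0Pr => e e0.
have [A0 /(_ A0 (fsubset_refl _)) h] := xs _ e0.
rewrite -[s](subKr (\sum_(i <- A0) x i)).
apply: le_trans (nrmB _ _) _; apply: lerD; last exact: ltW.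
exact: le_trans (nrm_sum _ _ _) (xB A0).
Qed.

Lemma hsum_uniq (I : choiceType) (x : I -> C R) s t :
  hsum x s -> hsum x t -> s = t.
Proof.
move=> xs xt; apply/eqP; rewrite -subr_eq0 -nrm_eq0 eq_le nrm_ge0 andbT.
apply: (hsum_nrm_le (hsumB xs xt)) => A.
by rewrite big1 // => i _; rewrite subrr nrm0.
Qed.

Lemma hsum_real (I : choiceType) (x : I -> R) B :
  (forall i, 0 <= x i) -> bnd x B -> exists s, hsum (fun i => toC (x i)) s.
Proof.
move=> x0 xB.
pose E := [set t : R | exists A : {fset I}, t = \sum_(i <- A) x i].
have E0 : E !=set0 by exists 0; exists fset0; rewrite big_seq_fset0.
have Eub : has_ubound E by exists B => _ [A ->].
have hsE : has_sup E by split.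
exists (toC (sup E)) => e e0.
have [_ [A0 ->] A0e] := sup_adherent e0 hsE.
exists A0 => A A0A; rewrite -toC_sum -toCB nrm_toC.
have h1 : \sum_(i <- A) x i <= sup E by apply: sup_upper_bound => //; exists A.
have h2 := sum_fset_sub x0 A0A.
by rewrite ler0_norm ?subr_le0 //; lra.
Qed.

Lemma nrm_Im (z : C R) : `|complex.Im z| <= nrm z.
Proof.
case: z => a b; rewrite /nrm /= -sqrtr_sqr ler_sqrt ?addr_ge0 ?sqr_ge0 //.
by rewrite lerDr sqr_ge0.
Qed.

(** Real and imaginary parts are each split into positive and negative parts, whose sums are
    suprema. *)
Lemma hsum_ex (I : choiceType) (x : I -> C R) B :
  bnd (fun i => nrm (x i)) B -> exists s, hsum x s.
Proof.
move=> xB.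
have key (f : C R -> R) : (forall z, `|f z| <= nrm z) ->
    exists s, hsum (fun i => toC (f (x i))) s.
  move=> fle.
  have [||s1 h1] := @hsum_real I (fun i => Num.max (f (x i)) 0) B.
  - by move=> i; rewrite le_max lexx orbT.
  - apply: bnd_le xB => i; rewrite ge_max nrm_ge0 andbT.
    exact: le_trans (ler_norm _) (fle _).
  have [||s2 h2] := @hsum_real I (fun i => Num.max (- f (x i)) 0) B.
  - by move=> i; rewrite le_max lexx orbT.
  - apply: bnd_le xB => i; rewrite ge_max nrm_ge0 andbT.
    by apply: le_trans (ler_norm _) _; rewrite normrN.
  exists (s1 - s2); apply: hsum_ext (hsumB h1 h2) => i.
  rewrite -toCB; congr toC; rewrite /Num.max.
  by case: (ltP (f _)) => ?; case: (ltP (- f _)) => ?; lra.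
have [|s1 h1] := key (@complex.Re R).
  by case=> a b; rewrite -toC_le -normCE; exact: (normc_ge_Re (a +i* b)%C).
have [s2 h2] := key _ nrm_Im.
exists (s1 + ('i%C : C R) * s2); apply: hsum_ext (hsumD h1 (hsumZ _ h2)) => i.
case: (x i) => a b; rewrite /toC /=; simpc; by [].
Qed.

(** Summation by fibres. Applied to a projection it is Fubini's theorem, applied to the addition of
    multi-indices it is the Cauchy product. *)
Lemma hsum_partition (I J : choiceType) (phi : I -> J) (x : I -> C R)
    (y : J -> C R) s B :
  bnd (fun i => nrm (x i)) B -> hsum x s ->
  (forall j, hsum (fun i => if phi i == j then x i else 0) (y j)) ->
  bnd (fun j => nrm (y j)) B /\ hsum y s.
Proof.
move=> xB xs xy.
(* A finite weighted sum of fibre sums is a single unordered sum over [I]. The weights will be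
   phases for the bound, and 1 for the convergence. *)
have part (u : J -> C R) (Bj : {fset J}) :
    hsum (fun i => if phi i \in Bj then u (phi i) * x i else 0)
         (\sum_(j <- Bj) u j * y j).
  apply: hsum_ext (hsum_bigsum (x := fun j i =>
      u j * (if phi i == j then x i else 0)) Bj (fun j => hsumZ (u j) (xy j))) => i.
  case: ifPn => [iB|iB]; last first.
    rewrite big1_seq // => j /andP[_ jB]; case: eqP => [ij|]; last by rewrite mulr0.
    by rewrite ij jB in iB.
  rewrite (big_fsetD1 (phi i)) //= eqxx big1_seq ?addr0 // => j.
  rewrite !inE => /andP[_ /andP[/negPf ji _]].
  by rewrite eq_sym ji mulr0.
split=> [Bj|e e0].
  (* The phase that turns [y j] into its modulus; it is 0 where [y j] is 0. *)
  pose u j := `|y j| / y j.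
  have uy j : u j * y j = toC (nrm (y j)).
    rewrite /u -normCE; have [->|y0] := eqVneq (y j) 0; first by rewrite normr0 mulr0.
    by rewrite divfK.
  have u1 j : nrm (u j) <= 1.
    rewrite /u nrmM nrmV normCE nrm_toC ger0_norm ?nrm_ge0 //.
    have [->|y0] := eqVneq (nrm (y j)) 0; first by rewrite mul0r.
    by rewrite divff.
  have := part u Bj; under eq_bigr do rewrite uy.
  move=> h; have := hsum_nrm_le (B := B) h.
  rewrite -toC_sum nrm_toC ger0_norm ?sumr_ge0 //; last first.
    by move=> j _; rewrite nrm_ge0.
  apply; apply: bnd_le xB => i; case: ifP => _; last by rewrite nrm0 nrm_ge0.
  by rewrite nrmM ler_piMl ?nrm_ge0.
have e2 : 0 < e / 2 by rewrite divr_gt0.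
have [A0 A0P] := bnd_tail (fun i => nrm_ge0 (x i)) xB e2.
(* When [Bj] contains the image of [A0], only terms outside [A0] are missing, and [A0P] bounds their
   total by [e / 2]. *)
exists (phi @` A0)%fset => Bj A0B; rewrite nrm_distC.
have := part (fun=> 1) Bj; under eq_bigr do rewrite mul1r.
move=> h; apply: (@le_lt_trans _ _ (e / 2)); last by lra.
apply: (hsum_nrm_le (hsumB xs h)) => A.
apply: le_trans (A0P [fset i in A | phi i \notin Bj]%fset _).
  rewrite big_fset /= [leRHS]big_mkcond /=; apply: ler_sum => i _.
  by case: ifP => iB; rewrite ?mul1r ?subrr ?nrm0 ?subr0.
apply/fdisjointP => i; rewrite !inE => /andP[_ iB].
apply: contra iB => iA0; apply: (fsubsetP A0B).
by apply/imfsetP; exists i.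
Qed.

Lemma hsum_fibres (I J : choiceType) (phi : I -> J) (x : I -> C R) s B :
  bnd (fun i => nrm (x i)) B -> hsum x s ->
  exists y : J -> C R,
   [/\ forall j, hsum (fun i => if phi i == j then x i else 0) (y j),
      bnd (fun j => nrm (y j)) B & hsum y s].
Proof.
move=> xB xs.
have ex j : exists t, hsum (fun i => if phi i == j then x i else 0) t.
  apply: (@hsum_ex _ _ B); apply: bnd_le xB => i.
  by case: ifP; rewrite ?nrm0 ?nrm_ge0.
have [y yP] := choice ex.
by exists y; have [] := hsum_partition xB xs yP.
Qed.

Lemma hsum_inj (I J : choiceType) (f : J -> I) (x : I -> C R) s :
  injective f -> (forall i, (forall j, f j != i) -> x i = 0) ->
  hsum (fun j => x (f j)) s <-> hsum x s.
Proof.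
move=> fi x0.
(* Preimages of finite sets under [f] are finite; they are listed by means of a partial inverse [g]
   of [f]. *)
have fset_preim (A : {fset I}) :
    exists A' : {fset J}, forall j, (j \in A') = (f j \in A).
  have /choice[g gP] (i : I) : exists oj : option J,
      if oj is Some j then f j = i else ~ exists j, f j = i.
    by have [[j ji]|nj] := pselect (exists j, f j = i);
      [exists (Some j)|exists None].
  exists (seq_fset tt (pmap g A)) => j; rewrite seq_fsetE mem_pmap.
  apply/mapP/idP => [[i iA gi]|fjA]; first by have := gP i; rewrite -gi => ->.
  exists (f j) => //; have := gP (f j).
  by case: (g (f j)) => [j' /fi ->//|[]]; exists j.
split=> h e e0; have [A0 A0P] := h _ e0.
  exists (f @` A0)%fset => A A0A.
  pose P := [pred i | `[< exists j, f j = i >]].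
  rewrite (big_fsetID _ P) /=.
  rewrite [X in nrm (_ + X - _)]big1_seq ?addr0; last first.
    move=> i; rewrite !inE => /andP[_ /andP[_ /asboolPn nP]].
    by apply: x0 => j; apply: contra_notN nP => /eqP; exists j.
  have [A' A'f] := fset_preim A.
  have A'E : [fset i in A | P i]%fset = (f @` A')%fset.
    apply/fsetP => i; rewrite !inE /=; apply/andP/imfsetP.
      by move=> -[iA /asboolP[j ji]]; exists j; rewrite //= A'f ji.
    by move=> -[j /=]; rewrite A'f => fjA ->; split=> //; apply/asboolP; exists j.
  rewrite A'E big_imfset /=; last by move=> ? ? _ _; exact: fi.
  apply: A0P; apply/fsubsetP => j jA0.
  have : f j \in (f @` A')%fset.
    rewrite -A'E !inE /=; apply/andP; split; last by apply/asboolP; exists j.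
    by apply: (fsubsetP A0A); apply/imfsetP; exists j.
  by case/imfsetP => j' j'A' /fi ->.
have [A' A'f] := fset_preim A0.
exists A' => A A'A.
have := A0P (A0 `|` f @` A)%fset (fsubsetUl _ _).
congr (nrm (_ - _) < _); rewrite fsetUC (big_fsetID _ (mem (f @` A)%fset)) /=.
rewrite [X in _ + X]big1_seq ?addr0; last first.
  move=> i; rewrite !inE => /andP[_ /andP[/orP[->//|iA0] niA]].
  apply: x0 => j; apply: contra niA => /eqP ji.
  by apply/imfsetP; exists j => //; apply: (fsubsetP A'A); rewrite A'f ji.
have -> : [fset i in f @` A `|` A0 | i \in f @` A]%fset = (f @` A)%fset.
  by apply/fsetP => i; rewrite !inE /= andb_idl // => ->.
by rewrite big_imfset //= => ? ? _ _; exact: fi.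
Qed.

Lemma hsum_mul (I J : choiceType) (x : I -> C R) (y : J -> C R) s t B B' :
  bnd (fun i => nrm (x i)) B -> bnd (fun i => nrm (y i)) B' ->
  hsum x s -> hsum y t ->
  bnd (fun p => nrm (x p.1 * y p.2)) (B * B') /\
  hsum (fun p : I * J => x p.1 * y p.2) (s * t).
Proof.
move=> xB yB xs yt.
have pB : bnd (fun p => nrm (x p.1 * y p.2)) (B * B').
  apply: (bnd_pair (b := fun i => nrm (x i) * B')) => [p|i|].
  - exact: nrm_ge0.
  - move=> A /=; under eq_bigr do rewrite nrmM.
    exact: (bndZ (nrm_ge0 _) yB).
  - by rewrite mulrC => A; under eq_bigr do rewrite mulrC;
      apply: (bndZ (bnd_ge0 yB) xB).
split=> //; have [u us] := hsum_ex pB.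
have := hsum_partition (phi := fst) (y := fun i => x i * t) pB us.
case=> [i|_ h]; last first.
  suff -> : s * t = u by [].
  apply: hsum_uniq h; rewrite mulrC; apply: hsum_ext (hsumZ t xs) => i.
  by rewrite mulrC.
apply/(hsum_inj (f := fun j => (i, j))); first by move=> j j' [].
  by move=> [i' j] /(_ j) /=; have [->|//] := eqVneq i' i; rewrite eqxx.
by apply: hsum_ext (hsumZ (x i) yt) => j /=; rewrite eqxx.
Qed.

End Hsum.

(** * Multi-indices and monomials *)

Section MultiIndices.
Context {d : nat}.
Implicit Types (r s t : mindex d).

Definition madd r s : mindex d := [ffun i => (r i + s i)%N].
Definition msub r s : mindex d := [ffun i => (r i - s i)%N].
Definition mzero : mindex d := [ffun => 0%N].
Definition munit (i : 'I_d) : mindex d := [ffun j => (j == i) : nat].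
Definition mle s r := [forall i, s i <= r i]%N.
Definition mbin r s := (\prod_(i < d) 'C(r i, s i))%N.
Definition mwt (l : 'I_d -> nat) r := (\sum_(i < d) l i * r i)%N.
Definition mdeg r := (\sum_(i < d) r i)%N.

(** Functions into an ordinal form a finite type, unlike [mindex]; [mbox] lists the multi-indices
    below [r] through them. *)
Definition mval N (f : {ffun 'I_d -> 'I_N}) : mindex d := [ffun i => val (f i)].

Definition mbox r : {fset mindex d} :=
  seq_fset tt [seq s <- [seq mval f |
    f <- enum {: {ffun 'I_d -> 'I_(\max_i r i).+1}}] | mle s r].

Lemma in_mbox s r : (s \in mbox r) = mle s r.
Proof.
rewrite seq_fsetE mem_filter andb_idr // => /forallP sr.
apply/mapP; exists [ffun i => inord (s i)]; first by rewrite mem_enum.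
apply/ffunP => i; rewrite !ffunE /= inordK // ltnS.
by apply: leq_trans (sr i) _; apply: leq_bigmax.
Qed.

Arguments mbox : simpl never.

Lemma maddC r s : madd r s = madd s r.
Proof. by apply/ffunP => i; rewrite !ffunE addnC. Qed.

Lemma maddK r s : msub (madd r s) s = r.
Proof. by apply/ffunP => i; rewrite !ffunE addnK. Qed.

Lemma msubK s r : mle s r -> madd s (msub r s) = r.
Proof. by move=> /forallP sr; apply/ffunP => i; rewrite !ffunE subnKC. Qed.

Lemma madd0 r : madd r mzero = r.
Proof. by apply/ffunP => i; rewrite !ffunE addn0. Qed.

Lemma madd_inj t : injective (madd^~ t).
Proof. by move=> r s /(congr1 (msub^~ t)); rewrite !maddK. Qed.

Lemma mle_addr r s : mle r (madd r s).
Proof. by apply/forallP => i; rewrite ffunE leq_addr. Qed.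

Lemma mwt_add l r s : mwt l (madd r s) = (mwt l r + mwt l s)%N.
Proof.
by rewrite -big_split /=; apply: eq_bigr => i _; rewrite ffunE mulnDr.
Qed.

Lemma mdeg_add r s : mdeg (madd r s) = (mdeg r + mdeg s)%N.
Proof. by rewrite -big_split /=; apply: eq_bigr => i _; rewrite ffunE. Qed.

Lemma mdeg_unit i : mdeg (munit i) = 1%N.
Proof.
rewrite /mdeg (bigD1 i) //= ffunE eqxx big1 // => j /negPf ji.
by rewrite ffunE ji.
Qed.

Lemma mdeg0 : mdeg mzero = 0%N.
Proof. by rewrite /mdeg big1 // => i _; rewrite ffunE. Qed.

Lemma mdeg_eq0 r : (mdeg r == 0%N) = (r == mzero).
Proof.
apply/idP/eqP => [|->]; last by rewrite mdeg0.
rewrite sum_nat_eq0 => /forallP h; apply/ffunP => i.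
by rewrite ffunE; apply/eqP; apply: h.
Qed.

Lemma mdeg_gt0 r : (0 < mdeg r)%N -> exists i s, r = madd s (munit i).
Proof.
move=> r0; have [i ri] : exists i, (0 < r i)%N.
  apply: contrapT => h; move: r0; rewrite ltnNge => /negP; apply.
  by rewrite leqn0 sum_nat_eq0; apply/forallP => i; rewrite -leqn0 leqNgt;
     apply/negP => ri; apply: h; exists i.
exists i, (msub r (munit i)); rewrite maddC msubK //.
by apply/forallP => j; rewrite ffunE; case: eqP => [->|].
Qed.

Lemma mdeg_eq1 r : mdeg r = 1%N -> exists i, r = munit i.
Proof.
move=> r1; have [|i [s rE]] := @mdeg_gt0 r; first by rewrite r1.
exists i; move: r1; rewrite rE mdeg_add mdeg_unit => /eqP.
rewrite -[1%N]add0n eqn_add2r mdeg_eq0 => /eqP ->.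
by rewrite maddC madd0.
Qed.

Lemma mbin_eq0 r s : ~~ mle s r -> mbin r s = 0%N.
Proof.
rewrite negb_forall => /existsP[i si]; move: si; rewrite -ltnNge => ri.
by rewrite /mbin (bigD1 i) //= bin_small.
Qed.

Lemma mbin_addl r s : (0 < mbin (madd r s) s)%N.
Proof. by rewrite prodn_gt0 // => i; rewrite bin_gt0 ffunE leq_addl. Qed.

Section Monomials.
Context {K : comNzRingType}.
Implicit Types (u v : 'I_d -> K).

(** The same product as [monomial], but over any commutative ring and on plain functions, so that
    real radii and complex displacements share its lemmas. *)
Definition mon u r : K := \prod_(i < d) u i ^+ r i.

Lemma mon_add u r s : mon u (madd r s) = mon u r * mon u s.
Proof. by rewrite -big_split; apply: eq_bigr => i _; rewrite ffunE exprD. Qed.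

Lemma mon0 u : mon u mzero = 1.
Proof. by rewrite /mon big1 // => i _; rewrite ffunE expr0. Qed.

Lemma mon_unit u i : mon u (munit i) = u i.
Proof.
rewrite /mon (bigD1 i) //= ffunE eqxx expr1 big1 ?mulr1 // => j /negPf ji.
by rewrite ffunE ji expr0.
Qed.

Lemma mon_mul u v r : mon (fun i => u i * v i) r = mon u r * mon v r.
Proof. by rewrite -big_split; apply: eq_bigr => i _; rewrite exprMn. Qed.

Lemma mon_cst (a : K) r : mon (fun=> a) r = a ^+ mdeg r.
Proof. by rewrite /mon prodrXr. Qed.

(** The one-variable binomial sums are padded with zero terms to a common range, so that the product
    distributes over them. *)
Lemma mon_binomial u v r :
  mon (fun i => u i + v i) r =
  \sum_(s <- mbox r) (mbin r s)%:R * mon u s * mon v (msub r s).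
Proof.
pose N := (\max_i r i).+1; have rN i : (r i < N)%N by rewrite ltnS leq_bigmax.
pose F (i : 'I_d) (k : nat) := ('C(r i, k))%:R * u i ^+ k * v i ^+ (r i - k).
have -> : mon (fun i => u i + v i) r = \prod_i \sum_(k < N) F i k.
  apply: eq_bigr => i _; rewrite addrC exprDn.
  rewrite (big_ord_widen_cond _ xpredT (fun k => (v i ^+ (r i - k) * u i ^+ k) *+ 'C(r i, k)) (rN i)).
  rewrite big_mkcond /=; apply: eq_bigr => k _; rewrite /F ltnS.
  case: ifPn => [_|]; first by rewrite -mulrA mulr_natl mulrC.
  by rewrite -ltnNge => /bin_small ->; rewrite !mul0r.
rewrite bigA_distr_bigA /=.
have iota_inj : injective (@mval N).
  move=> f g /ffunP fg; apply/ffunP => i; apply/val_inj.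
  by have := fg i; rewrite !ffunE.
transitivity (\sum_(s <- [seq mval f | f <- enum {: {ffun 'I_d -> 'I_N}}])
   (mbin r s)%:R * mon u s * mon v (msub r s)).
  rewrite big_map big_enum /=; apply: eq_bigr => f _.
  rewrite /mbin natr_prod -!big_split /=; apply: eq_bigr => i _.
  by rewrite /F !ffunE.
rewrite (bigID (mle^~ r)) /= [X in _ + X]big1 ?addr0; last first.
  by move=> s /mbin_eq0 ->; rewrite !mul0r.
rewrite -big_filter; apply: perm_big; apply: uniq_perm.
- by rewrite filter_uniq // map_inj_uniq // enum_uniq.
- exact: fset_uniq (mbox r).
by move=> s; rewrite -[RHS]/(s \in mbox r) seq_fsetE.
Qed.

End Monomials.

Section RealMonomials.
Context {R : realType}.
Implicit Types (p q : 'I_d -> R).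

Lemma mon_ge0 p r : (forall i, 0 <= p i) -> 0 <= mon p r.
Proof. by move=> p0; apply: prodr_ge0 => i _; rewrite exprn_ge0. Qed.

Lemma mon_gt0 p r : (forall i, 0 < p i) -> 0 < mon p r.
Proof. by move=> p0; apply: prodr_gt0 => i _; rewrite exprn_gt0. Qed.

Lemma mon_le p q r : (forall i, 0 <= p i <= q i) -> mon p r <= mon q r.
Proof.
move=> pq; apply: ler_prod => i _; have /andP[p0 pqi] := pq i.
by rewrite exprn_ge0 //= lerXn2r // nnegrE // (le_trans p0).
Qed.

Lemma nrm_mon (u : 'I_d -> C R) r : nrm (mon u r) = mon (fun i => nrm (u i)) r.
Proof. by rewrite /mon nrm_prod; apply: eq_bigr => i _; rewrite nrmX. Qed.

Lemma toC_mon p r : toC (mon p r) = mon (fun i => toC (p i)) r.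
Proof. by rewrite /mon toC_prod; apply: eq_bigr => i _; rewrite rmorphXn. Qed.

End RealMonomials.
End MultiIndices.
Arguments mzero {d}.

(** * Power series in several variables *)

Section PowerSeries.
Context {R : realType} {d : nat}.
Implicit Types (c : mindex d -> C R) (p q : 'I_d -> R) (u v : 'I_d -> C R).
Implicit Types (B e : R) (r s t : mindex d).

(** A weighted l^1 norm of the coefficients. It controls the series on the whole closed polydisc of
    radii [p], and is submultiplicative for [conv]. *)
Definition psb c p B := bnd (fun r => nrm (c r) * mon p r) B.

Definition conv c (c' : mindex d -> C R) : mindex d -> C R :=
  fun t => \sum_(s <- mbox t) c s * c' (msub t s).

Lemma psb_nrm c p B u : psb c p B -> (forall i, nrm (u i) <= p i) ->
  bnd (fun r => nrm (c r * mon u r)) B.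
Proof.
move=> cB up; apply: bnd_le cB => r; rewrite nrmM nrm_mon.
by apply: (ler_wpM2l (nrm_ge0 _)); apply: mon_le => i; rewrite nrm_ge0 up.
Qed.

Lemma psb_le c p q B :
  psb c p B -> (forall i, 0 <= q i <= p i) -> psb c q B.
Proof.
move=> cB qp; apply: bnd_le cB => r.
by apply: (ler_wpM2l (nrm_ge0 _)); apply: mon_le.
Qed.

Lemma psbD c c' p B B' : (forall i, 0 <= p i) -> psb c p B -> psb c' p B' ->
  psb (fun r => c r + c' r) p (B + B').
Proof.
move=> p0 cB cB'; apply: bnd_le (bndD cB cB') => r.
by rewrite -mulrDl ler_wpM2r ?nrmD // mon_ge0.
Qed.

Lemma nrm_toC_mon p r : (forall i, 0 <= p i) ->
  nrm (mon (fun i => toC (p i)) r) = mon p r.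
Proof. by move=> p0; rewrite -toC_mon nrm_toC ger0_norm // mon_ge0. Qed.

Lemma psbE c p B : (forall i, 0 <= p i) ->
  psb c p B <-> bnd (fun r => nrm (c r * mon (fun i => toC (p i)) r)) B.
Proof.
by move=> p0; split; apply: bnd_le => r; rewrite nrmM nrm_toC_mon.
Qed.

Lemma hsum_conv c c' p B B' u S T :
  (forall i, 0 <= p i) -> psb c p B -> psb c' p B' ->
  (forall i, nrm (u i) <= p i) ->
  hsum (fun r => c r * mon u r) S -> hsum (fun r => c' r * mon u r) T ->
  bnd (fun r => nrm (conv c c' r * mon u r)) (B * B') /\
  hsum (fun r => conv c c' r * mon u r) (S * T).
Proof.
move=> p0 cB cB' up hS hT.
have [b h] := hsum_mul (psb_nrm cB up) (psb_nrm cB' up) hS hT.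
apply: (hsum_partition (phi := fun x => madd x.1 x.2) b h) => t.
pose E := ((fun s : mindex d => (s, msub t s)) @` mbox t)%fset.
have -> : conv c c' t * mon u t = \sum_(x <- E)
    (if madd x.1 x.2 == t then (c x.1 * mon u x.1) * (c' x.2 * mon u x.2) else 0).
  rewrite big_imfset /=; last by move=> s s' _ _ [->].
  rewrite mulr_suml; apply: eq_big_seq => s; rewrite in_mbox => st.
  rewrite /= msubK // eqxx -[in mon u t](msubK st) mon_add; ring.
apply: hsum_supp => -[r s] /= rsE; case: eqP => // rst.
case/negP: rsE; apply/imfsetP; exists r => /=.
  by rewrite in_mbox -rst mle_addr.
by rewrite -rst maddC maddK.
Qed.

Lemma psb_hsum c p B u : psb c p B -> (forall i, nrm (u i) <= p i) ->
  exists S, hsum (fun r => c r * mon u r) S.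
Proof. by move=> cB up; apply: hsum_ex (psb_nrm cB up). Qed.

Lemma psb_conv c c' p B B' : (forall i, 0 <= p i) ->
  psb c p B -> psb c' p B' -> psb (conv c c') p (B * B').
Proof.
move=> p0 cB cB'; apply/psbE => //.
have up i : nrm (toC (p i)) <= p i by rewrite nrm_toC ger0_norm.
have [S hS] := psb_hsum cB up; have [T hT] := psb_hsum cB' up.
by have [] := hsum_conv p0 cB cB' up hS hT.
Qed.

(** Change of centre. The binomial expansion gives a double family [X] over pairs (r, s), absolutely
    summable because [q + th] is at most [p]; summing it over [r] first gives the new
    coefficients. *)
Lemma psb_reexpand c p q th B v :
  (forall i, 0 < q i) -> (forall i, nrm (v i) <= th i) ->
  (forall i, q i + th i <= p i) -> psb c p B ->
  exists c', [/\ psb c' q B,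
    forall s, hsum (fun r => (mbin r s)%:R * c r * mon v (msub r s)) (c' s) &
    forall u S, (forall i, nrm (u i) <= q i) ->
      hsum (fun r => c r * mon (fun i => u i + v i) r) S ->
      hsum (fun s => c' s * mon u s) S].
Proof.
move=> q0 vth qth cB.
have th0 i : 0 <= th i := le_trans (nrm_ge0 _) (vth i).
pose X u (x : mindex d * mindex d) : C R :=
  (mbin x.1 x.2)%:R * c x.1 * mon v (msub x.1 x.2) * mon u x.2.
have Xsum u r : hsum (fun s => X u (r, s)) (c r * mon (fun i => u i + v i) r).
  rewrite mon_binomial mulr_sumr.
  have -> : \sum_(s <- mbox r) c r * ((mbin r s)%:R * mon u s * mon v (msub r s))
     = \sum_(s <- mbox r) X u (r, s) by apply: eq_bigr => s _; rewrite /X /=; ring.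
  apply: hsum_supp => s; rewrite in_mbox /X /= => /mbin_eq0 ->.
  by rewrite !mul0r.
have Xbnd u : (forall i, nrm (u i) <= q i) -> bnd (fun x => nrm (X u x)) B.
  move=> uq; apply: (bnd_pair (b := fun r => nrm (c r) * mon p r)) cB => [x|r].
    exact: nrm_ge0.
  pose Y s : R := (mbin r s)%:R * nrm (c r) * mon th (msub r s) * mon q s.
  have Y0 s : 0 <= Y s.
    rewrite !mulr_ge0 ?mon_ge0 ?nrm_ge0 // => i; exact: ltW.
  have XY s : nrm (X u (r, s)) <= Y s.
    rewrite /X !nrmM nrm_nat /= !nrm_mon; apply: ler_pM.
    - by rewrite !mulr_ge0 ?nrm_ge0 // mon_ge0 // => i; rewrite nrm_ge0.
    - by rewrite mon_ge0 // => i; rewrite nrm_ge0.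
    - apply: ler_wpM2l; first by rewrite mulr_ge0 ?nrm_ge0.
      by apply: mon_le => i; rewrite nrm_ge0 vth.
    - by apply: mon_le => i; rewrite nrm_ge0 uq.
  apply: bnd_le XY _; apply: (@bnd_weak _ _ _ (\sum_(s <- mbox r) Y s)).
    apply: bnd_supp => // s; rewrite in_mbox => /mbin_eq0 sr.
    by rewrite /Y sr !mul0r.
  have -> : \sum_(s <- mbox r) Y s = nrm (c r) * mon (fun i => q i + th i) r.
    rewrite mon_binomial mulr_sumr; apply: eq_bigr => s _; rewrite /Y; ring.
  apply: (ler_wpM2l (nrm_ge0 _)); apply: mon_le => i.
  by rewrite addr_ge0 ?qth // ltW.
have qq i : nrm (toC (q i)) <= q i by rewrite nrm_toC ger0_norm // ltW.
have q00 i : 0 <= q i by rewrite ltW.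
(* The column of [X] at u = [q], divided by the positive number [mon q s], is the required
   family. *)
have c'ex s : exists S, hsum (fun r => (mbin r s)%:R * c r * mon v (msub r s)) S.
  have ms : mon (fun i => toC (q i)) s != 0.
    by rewrite -nrm_eq0 nrm_toC_mon // gt_eqF // mon_gt0.
  apply: (@hsum_ex _ _ _ ((mon q s)^-1 * B)) => A.
  have := bndZ (b := (mon q s)^-1) _ (bnd_inj (f := fun r => (r, s)) _ (Xbnd _ qq)).
  move=> /(_ _ _ A) h; apply: le_trans (h _ _).
  - apply: ler_sum => r _; rewrite /X /= [leRHS]mulrC.
    rewrite [nrm (_ * mon _ s)]nrmM nrm_toC_mon //.
    by rewrite mulfK // gt_eqF // mon_gt0.
  - by rewrite invr_ge0 ltW // mon_gt0.
  - by move=> ? ? [].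
have [c' c'P] := choice c'ex; exists c'.
(* The sum of [X] by rows is the old series, and by columns the new one. *)
have main u S : (forall i, nrm (u i) <= q i) ->
    hsum (fun r => c r * mon (fun i => u i + v i) r) S ->
    bnd (fun s => nrm (c' s * mon u s)) B /\ hsum (fun s => c' s * mon u s) S.
  move=> uq hS; have Xu := Xbnd _ uq; have [T hT] := hsum_ex Xu.
  have ST : S = T.
    have [] := hsum_partition (phi := fst)
      (y := fun r => c r * mon (fun i => u i + v i) r) Xu hT.
      move=> r; apply/(hsum_inj (f := fun s => (r, s))); first by move=> ? ? [].
        by move=> [r' s] /(_ s) /=; have [->|//] := eqVneq r' r; rewrite eqxx.
      by apply: hsum_ext (Xsum u r) => s /=; rewrite eqxx.
    by move=> _; apply: hsum_uniq hS.
  rewrite ST; apply: (hsum_partition (phi := snd) Xu hT) => s.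
  apply/(hsum_inj (f := fun r => (r, s))); first by move=> ? ? [].
    by move=> [r s'] /(_ r) /=; have [->|//] := eqVneq s' s; rewrite eqxx.
  rewrite mulrC; apply: hsum_ext (hsumZ (mon u s) (c'P s)) => r /=.
  by rewrite eqxx /X /= mulrC.
split=> // [|u S uq hS]; last by have [] := main u S uq hS.
apply/psbE => //.
have [|S hS] := @psb_hsum c p B (fun i => toC (q i) + v i) cB.
  by move=> i; apply: le_trans (qth i); apply: le_trans (nrmD _ _) _; apply: lerD.
by have [] := main _ S qq hS.
Qed.

(** If the terms before [n] vanish, the n-th one is minus the tail, so that x^n |Y_n| is at most
    x^(n+1) B; then x tends to 0. *)
Lemma hsum_series_eq0 (Y : nat -> C R) B :
  bnd (fun n => nrm (Y n)) B ->
  (forall x : R, 0 < x <= 1 -> hsum (fun n => toC (x ^+ n) * Y n) 0) ->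
  forall n, Y n = 0.
Proof.
move=> YB Y0; elim/ltn_ind => n IH.
apply/eqP; rewrite -nrm_eq0 eq_le nrm_ge0 andbT.
have key x : 0 < x <= 1 -> nrm (Y n) <= x * B.
  move=> x01; have /andP[x0 x1] := x01.
  have xn : 0 < x ^+ n by rewrite exprn_gt0.
  rewrite -(ler_pM2l xn) mulrA -exprSr.
  rewrite -[x ^+ n]ger0_norm ?(ltW xn) // -nrm_toC -nrmM -nrmN.
  have h : hsum (fun m => if m == n then toC (x ^+ n) * Y n else 0)
      (toC (x ^+ n) * Y n).
    have := @hsum_supp R nat (fun m => if m == n then toC (x ^+ n) * Y n else 0)
      [fset n]%fset.
    rewrite big_seq_fset1 eqxx; apply=> m; rewrite inE; by case: eqP.
  have := hsumB (Y0 x x01) h; rewrite sub0r => /hsum_nrm_le; apply.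
  apply: bnd_le (bndZ (b := x ^+ n.+1) _ YB) => [m|]; last first.
    by rewrite exprn_ge0 // ltW.
  have [->|mn] := eqVneq m n; first by rewrite subrr nrm0 mulr_ge0 ?nrm_ge0 // exprn_ge0 // ltW.
  rewrite subr0; have [mn'|nm] := ltnP m n.
    by rewrite IH // mulr0 nrm0 mulr0.
  rewrite nrmM nrm_toC ger0_norm; last by rewrite exprn_ge0 // ltW.
  apply: (ler_wpM2r (nrm_ge0 _)); apply: ler_wiXn2l => //; first exact: ltW.
  by rewrite ltn_neqAle eq_sym mn.
have B0 := bnd_ge0 YB.
apply/ler_addgt0Pr => e e0; rewrite add0r.
have Be : 0 < B + 1 by lra.
pose x := Num.min 1 (e / (B + 1)).
have x0 : 0 < x by rewrite lt_min ltr01 divr_gt0.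
apply: (le_trans (key x _)); first by rewrite x0 ge_min lexx.
apply: (@le_trans _ _ (e / (B + 1) * B)).
  by rewrite ler_wpM2r // ge_min lexx orbT.
rewrite mulrAC ler_pdivrMr // ler_wpM2l ?ltW //; lra.
Qed.

(** The variables are separated one at a time: by induction on [k], the part of the series whose
    exponents agree with [r] in the first [k] coordinates ([pre k]) still sums to 0 at every [q]. *)
Lemma psb_eq0 c p B : (forall i, 0 < p i) -> psb c p B ->
  (forall q, (forall i, 0 < q i <= p i) ->
     hsum (fun r => c r * mon (fun i => toC (q i)) r) 0) ->
  forall r, c r = 0.
Proof.
move=> p0 cB c0 r.
pose pre k s := [forall i : 'I_d, (i < k)%N ==> (s i == r i)].
have pp i : nrm (toC (p i)) <= p i by rewrite nrm_toC ger0_norm // ltW.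
have key k q : (k <= d)%N -> (forall i, 0 < q i <= p i) ->
    hsum (fun s => if pre k s then c s * mon (fun i => toC (q i)) s else 0) 0.
  elim: k q => [|k IH] q kd qp.
    apply: hsum_ext (c0 q qp) => s; case: ifPn => //.
    by rewrite /pre => /forallP; case=> i; rewrite ltn0.
  pose ik := Ordinal kd.
  pose x s := if pre k s then c s * mon (fun i => toC (q i)) s else 0.
  have qq i : nrm (toC (q i)) <= p i.
    by have /andP[q0 qp'] := qp i; rewrite nrm_toC ger0_norm // ltW.
  have xB : bnd (fun s => nrm (x s)) B.
    apply: bnd_le (psb_nrm cB qq) => s.
    by rewrite /x; case: ifP; rewrite ?nrm0 ?nrm_ge0.
  have [Y [Yfib YB Ysum]] := hsum_fibres (fun s : mindex d => s ik) xB (IH q (ltnW kd) qp).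
  have Y0 : forall n, Y n = 0.
    apply: (hsum_series_eq0 YB) => tau /andP[tau0 tau1].
    (* Scaling the single coordinate [ik] by [tau] turns the sum into a one-variable power series in
       [tau], grouped by the exponent of that coordinate. *)
    pose q' i := if i == ik then tau * q i else q i.
    have q'p i : 0 < q' i <= p i.
      rewrite /q'; have /andP[qi0 qip] := qp i; case: eqP => _; last by rewrite qi0.
      by rewrite mulr_gt0 //= (le_trans _ qip) // ler_piMl // ltW.
    have q'E s : mon (fun i => toC (q' i)) s =
        toC (tau ^+ s ik) * mon (fun i => toC (q i)) s.
      rewrite -!toC_mon -toCM; congr toC.
      rewrite /mon (bigD1 ik) //= [in RHS](bigD1 ik) //= /q' eqxx exprMn -!mulrA.
      by congr (_ * (_ * _)); apply: eq_bigr => i /negPf ->.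
    pose x' s := if pre k s then c s * mon (fun i => toC (q' i)) s else 0.
    have x'B : bnd (fun s => nrm (x' s)) B.
      have qq' i : nrm (toC (q' i)) <= p i.
        by have /andP[q0 qp'] := q'p i; rewrite nrm_toC ger0_norm // ltW.
      apply: bnd_le (psb_nrm cB qq') => s.
      by rewrite /x'; case: ifP; rewrite ?nrm0 ?nrm_ge0.
    have := @hsum_partition R (mindex d) nat (fun s => s ik) x'
      (fun n => toC (tau ^+ n) * Y n) 0 B x'B (IH q' (ltnW kd) q'p).
    case=> [n|_ h]; last exact: h.
    apply: hsum_ext (hsumZ (toC (tau ^+ n)) (Yfib n)) => s.
    case: eqP => [<-|_]; last by rewrite mulr0.
    rewrite /x /x'; case: (pre k s); last by rewrite mulr0.
    by rewrite q'E mulrCA.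
  have := Yfib (r ik); rewrite Y0; apply: hsum_ext => s.
  rewrite /x -if_and; congr (if _ then _ else _).
  apply/idP/forallP => [/andP[/eqP srk /forallP pk] i|h].
    apply/implyP; rewrite ltnS leq_eqVlt => /orP[/eqP ik'|ik']; last first.
      by have := pk i; rewrite ik'.
    have -> : i = ik by apply: val_inj.
    by rewrite srk.
  apply/andP; split; first by have := h ik; rewrite /= ltnSn.
  by apply/forallP => i; apply/implyP => ik'; have := h i; rewrite ltnS ltnW.
have pok i : 0 < p i <= p i by rewrite p0 lexx.
have := key d p (leqnn d) pok.
have := @hsum_supp R _ (fun s => if pre d s then c s * mon (fun i => toC (p i)) s else 0)
      [fset r]%fset.
rewrite big_seq_fset1 => h1 /(hsum_uniq (h1 _)) h2.
have : c r * mon (fun i => toC (p i)) r = 0.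
  rewrite -[RHS]h2; last first.
    move=> s; rewrite inE => sr; case: ifPn => // /forallP prs; case/negP: sr.
    by apply/eqP/ffunP => i; have := prs i; rewrite ltn_ord => /eqP.
  by case: ifPn => // /negP; case; apply/forallP => i; rewrite eqxx implybT.
move=> /eqP; rewrite mulf_eq0 => /orP[/eqP //|].
rewrite -nrm_eq0 nrm_toC_mon ?gt_eqF ?mon_gt0 // => i; exact: ltW.
Qed.

(* [e = mzero] yields the quotient of power series and [e = munit i] the
   Weierstrass division by a series of order one in the [i]-th variable. *)
Lemma psb_fixpoint (l : 'I_d -> nat) (e0 : mindex d) f g p B : (forall i, 0 < p i) ->
  psb f p B -> psb g p (mon p e0 / 2) ->
  (forall t, g t != 0 -> (mwt l e0 < mwt l t)%N) ->
  exists h, psb h p (2 * B / mon p e0) /\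
    forall r, h r = f (madd r e0) + conv h g (madd r e0).
Proof.
move=> p0 fB gB gl.
have p00 i : 0 <= p i by apply: ltW.
have pe : 0 < mon p e0 by apply: mon_gt0.
(* The solution is the coefficientwise limit of the iterates of [step] from 0. *)
pose step (q : mindex d -> C R) : mindex d -> C R := fun r => f (madd r e0) + conv q g (madd r e0).
pose Q n := iter n step (fun=> 0).
(* Each exponent of [g] outweighs [e0], so [step] determines the coefficient at [r] from
   coefficients of strictly smaller weight. *)
have stab n m r : (mwt l r < n)%N -> (mwt l r < m)%N -> Q n r = Q m r.
  elim: n m r => [//|n IH] [//|m] r rn rm.
  rewrite /Q /= /step; congr (_ + _); apply: eq_big_seq => s.
  rewrite in_mbox => sr; have [->|gn0] := eqVneq (g (msub (madd r e0) s)) 0.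
    by rewrite !mulr0.
  have := gl _ gn0; have := mwt_add l s (msub (madd r e0) s).
  rewrite msubK // mwt_add => h1 h2.
  have sr' : (mwt l s < mwt l r)%N by lia.
  by congr (_ * _); apply: IH; lia.
have B0 : 0 <= B := bnd_ge0 fB.
(* This bound is invariant: the convolution with [g] contributes (2B / p^e0)(p^e0 / 2) = B, so that
   f + Q g has norm at most 2B, and the shift by [e0] divides by p^e0. *)
have QB n : psb (Q n) p (2 * B / mon p e0).
  elim: n => [|n IH].
    move=> A; rewrite big1; first by rewrite divr_ge0 ?mulr_ge0 // ltW.
    by move=> r _; rewrite /Q nrm0 mul0r.
  have h : psb (fun r => f r + conv (Q n) g r) p (B + 2 * B / mon p e0 * (mon p e0 / 2)).
    by apply: psbD => //; apply: psb_conv.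
  have hi := bnd_inj (@madd_inj _ e0) h.
  have /bnd_le : forall r, nrm (Q n.+1 r) * mon p r <=
      (mon p e0)^-1 * (nrm (f (madd r e0) + conv (Q n) g (madd r e0)) * mon p (madd r e0)).
    move=> r; rewrite mon_add mulrCA (mulrC (mon p r)) mulKf ?lexx //.
    by rewrite gt_eqF.
  apply; have ie : 0 <= (mon p e0)^-1 by rewrite invr_ge0 ltW.
  apply: bnd_weak (bndZ ie hi) _.
  rewrite le_eqVlt; apply/orP; left; apply/eqP; field.
  by rewrite gt_eqF.
(* The coefficient at [r] is final from this iterate on; on a finite set of indices one iterate
   serves for all. *)
exists (fun r => Q (mwt l r).+1 r); split=> [A|r].
  pose N := (\max_(r <- A) mwt l r).+1.
  apply: le_trans (QB N A); rewrite le_eqVlt; apply/orP; left; apply/eqP.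
  apply: eq_big_seq => r rA; congr (nrm _ * _); apply: stab => //.
  by rewrite ltnS; apply: leq_bigmax_seq.
rewrite {1}/Q /= /step; congr (_ + _); apply: eq_big_seq => s.
rewrite in_mbox => sr; have [->|gn0] := eqVneq (g (msub (madd r e0) s)) 0.
  by rewrite !mulr0.
have := gl _ gn0; have := mwt_add l s (msub (madd r e0) s).
rewrite msubK // mwt_add => h1 h2.
congr (_ * _); rewrite -[LHS]/(Q (mwt l r) s) -[RHS]/(Q (mwt l s).+1 s).
by apply: stab => //; lia.
Qed.

End PowerSeries.

(** * Neighbourhoods and summability in terms of real moduli *)

Lemma toC_gt0 {R : realType} (a : R) : (0 < toC a) = (0 < a).
Proof. by rewrite -toC0 toC_lt. Qed.

Lemma gt0_toC {R : realType} (x : C R) : 0 < x -> exists2 a : R, 0 < a & x = toC a.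
Proof.
move=> x0; exists (nrm x); first by rewrite nrm_gt0 gt_eqF.
by rewrite -normCE gtr0_norm.
Qed.

Lemma nbhs_rowC {R : realType} {d : nat} (w : 'rV[C R]_d) (P : set 'rV[C R]_d) :
  nbhs w P <-> exists2 e : R, 0 < e &
    forall z : 'rV[C R]_d, (forall i, nrm (z 0 i - w 0 i) < e) -> P z.
Proof.
split.
  move=> /nbhs_ballP[x /gt0_toC[e e0 ->] h]; exists e => // z zw.
  apply: h; split=> [|i j]; first by rewrite toC_gt0.
  by rewrite (ord1 i) /ball /= normCE toC_lt nrm_distC; exact: zw.
move=> [e e0 h]; apply/nbhs_ballP; exists (toC e); first by rewrite /= toC_gt0.
move=> z [_ zw]; apply: h => i; have := zw 0 i.
by rewrite /ball /= normCE toC_lt nrm_distC.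
Qed.

Lemma nbhs_rowR {R : realType} {d : nat} (w : 'rV[R]_d) (P : set 'rV[R]_d) :
  nbhs w P <-> exists2 e : R, 0 < e &
    forall z : 'rV[R]_d, (forall i, `|z 0 i - w 0 i| < e) -> P z.
Proof.
split.
  move=> /nbhs_ballP[e e0 h]; exists e => // z zw.
  apply: h; split=> // i j.
  by rewrite (ord1 i) /ball /= distrC; exact: zw.
move=> [e e0 h]; apply/nbhs_ballP; exists e => //.
move=> z [_ zw]; apply: h => i; have := zw 0 i.
by rewrite /ball /= distrC.
Qed.

Lemma abs_summableP {R : realType} {d : nat} (x : mindex d -> C R) :
  abs_summable x <-> exists B, bnd (fun r => nrm (x r)) B.
Proof.
have E r : (`|(nrm (x r))%:E| = (nrm (x r))%:E)%E by rewrite gee0_abs // lee_fin nrm_ge0.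
rewrite /abs_summable /summable; split.
  move=> h; exists (fine (\esum_(r in [set: mindex d]) `|(nrm (x r))%:E|%E)) => A.
  have h0 : (0 <= \esum_(r in [set: mindex d]) `|(nrm (x r))%:E|)%E by exact: esum_ge0.
  rewrite -lee_fin fineK; last by rewrite ge0_fin_numE.
  apply: esum_ge; exists [set` A] => //.
  rewrite fsbig_finite; last exact: finite_fset.
  rewrite set_fsetK -sumEFin.
  by rewrite le_eqVlt; apply/orP; left; apply/eqP; apply: eq_bigr => r _; rewrite E.
move=> [B xB]; apply: (@le_lt_trans _ _ B%:E); last exact: ltry.
apply: ge_ereal_sup => _ [A [finA _] <-].
rewrite fsbig_finite; last exact: finA.
under eq_bigr do rewrite E.
rewrite sumEFin lee_fin.
exact: xB.
Qed.

Lemma partial_sumP {R : realType} {d : nat} (x : mindex d -> C R) s :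
  (summability.partial_sum x A @[A --> summability.totally] --> s) <-> hsum x s.
Proof.
have F := @filter_filter _ _ (@summability.totally_filter (mindex d)).
split.
  move=> /cvgrPdist_lt h e e0.
  have e0' : 0 < toC e by rewrite toC_gt0.
  have [A0 _ A0P] := h (toC e) e0'.
  exists A0 => A /A0P /=; rewrite normCE toC_lt nrm_distC /summability.partial_sum.
  by rewrite big_seq_fsetE.
move=> h; apply/cvgrPdist_lt => x0 /gt0_toC[e e0 ->].
have [A0 A0P] := h e e0; exists A0 => // A /A0P /=.
by rewrite normCE toC_lt nrm_distC /summability.partial_sum big_seq_fsetE.
Qed.

Lemma has_abs_sumP {R : realType} {d : nat} (x : mindex d -> C R) s :
  has_abs_sum x s <-> (exists B, bnd (fun r => nrm (x r)) B) /\ hsum x s.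
Proof. by split=> -[/abs_summableP ? /partial_sumP]. Qed.

Lemma hsum_single {R : realType} (I : choiceType) (x : I -> C R) i0 :
  hsum (fun i => if i == i0 then x i else 0) (x i0).
Proof.
have := @hsum_supp R I (fun i => if i == i0 then x i else 0) [fset i0]%fset.
by rewrite big_seq_fset1 eqxx; apply => i; rewrite inE => /negPf ->.
Qed.

(** Unlike a minimum, the inverse of 1 plus the sum of the inverses also makes sense for n = 0. *)
Lemma exists_lt_all {R : realType} (n : nat) (p : 'I_n -> R) :
  (forall i, 0 < p i) -> exists2 e, 0 < e & forall i, e <= p i.
Proof.
move=> p0; have B i : (p i)^-1 <= \sum_j (p j)^-1.
  rewrite (bigD1 i) //= lerDl sumr_ge0 // => j _.
  by rewrite invr_ge0 ltW.
have S0 : 0 <= \sum_j (p j)^-1 by apply: sumr_ge0 => j _; rewrite invr_ge0 ltW.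
exists (\sum_j (p j)^-1 + 1)^-1 => [|i]; first by rewrite invr_gt0 ltr_wpDl.
rewrite invf_ple ?posrE ?ltr_wpDl //.
by apply: le_trans (B i) _; rewrite lerDl.
Qed.

Lemma small_factor {R : realType} (B a : R) : 0 <= B -> 0 < a ->
  exists2 x, 0 < x <= 1 & x * B <= a.
Proof.
move=> B0 a0; have B1 : 0 < B + 1 by lra.
exists (Num.min 1 (a / (B + 1))).
  by rewrite ge_min lexx andbT lt_min ltr01 divr_gt0.
apply: (@le_trans _ _ (a / (B + 1) * B)).
  by rewrite ler_wpM2r // ge_min lexx orbT.
by rewrite mulrAC ler_pdivrMr // ler_wpM2l ?ltW //; lra.
Qed.

(** * Functions represented by a power series on a closed polydisc *)

Section Germs.
Context {R : realType} {d : nat}.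
Implicit Types (c : mindex d -> C R) (p q : 'I_d -> R) (f g h : 'rV[C R]_d -> C R).
Implicit Types (z w : 'rV[C R]_d) (B e : R) (r s t : mindex d).

Definition dif z w : 'I_d -> C R := fun i => z 0 i - w 0 i.

Definition near_box p z w := forall i, nrm (dif z w i) <= p i.

Definition ps c p f w := [/\ forall i, 0 < p i, exists B, psb c p B &
  forall z, near_box p z w -> hsum (fun r => c r * mon (dif z w) r) (f z)].

Lemma difxx z i : dif z z i = 0.
Proof. exact: subrr. Qed.

Lemma dif_add z w (x : 'rV[C R]_d) : (fun i => dif z x i + dif x w i) = dif z w.
Proof. by apply/funext => i; rewrite /dif addrA subrK. Qed.

Lemma near_box_refl p z : (forall i, 0 < p i) -> near_box p z z.
Proof. by move=> p0 i; rewrite difxx nrm0 ltW. Qed.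

Lemma ps_pos c p f w i : ps c p f w -> 0 < p i.
Proof. by case. Qed.

Lemma ps_shrink c p q f w : ps c p f w -> (forall i, 0 < q i <= p i) -> ps c q f w.
Proof.
move=> [p0 [B cB] h] qp; split=> [i||z zw].
- by have /andP[] := qp i.
- by exists B; apply: psb_le cB _ => i; have /andP[/ltW -> ->] := qp i.
- apply: h => i; apply: le_trans (zw i) _.
  by have /andP[] := qp i.
Qed.

Lemma ps_ext c p f g w : ps c p f w ->
  (forall z, near_box p z w -> f z = g z) -> ps c p g w.
Proof. by move=> [p0 cB h] fg; split=> // z zw; rewrite -fg //; exact: h. Qed.

Lemma psD c c' p f g w : ps c p f w -> ps c' p g w ->
  ps (fun r => c r + c' r) p (fun z => f z + g z) w.
Proof.
move=> [p0 [B cB] h] [_ [B' cB'] h']; split=> // [|z zw].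
  by exists (B + B'); apply: psbD => // i; exact: ltW.
by apply: hsum_ext (hsumD (h z zw) (h' z zw)) => r; rewrite mulrDl.
Qed.

Lemma psZ c p f w (a : C R) : ps c p f w ->
  ps (fun r => a * c r) p (fun z => a * f z) w.
Proof.
move=> [p0 [B cB] h]; split=> // [|z zw].
  exists (nrm a * B); apply: bnd_le (bndZ (nrm_ge0 a) cB) => r.
  by rewrite nrmM mulrA.
by apply: hsum_ext (hsumZ a (h z zw)) => r; rewrite mulrA.
Qed.

Lemma psM c c' p f g w : ps c p f w -> ps c' p g w ->
  ps (conv c c') p (fun z => f z * g z) w.
Proof.
move=> [p0 [B cB] h] [_ [B' cB'] h']; split=> // [|z zw].
  by exists (B * B'); apply: psb_conv => // i; exact: ltW.
have p00 i : 0 <= p i by exact: ltW.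
by have [] := hsum_conv p00 cB cB' zw (h z zw) (h' z zw).
Qed.

Lemma psb_single p r0 (a : C R) : (forall i, 0 < p i) ->
  psb (fun r => if r == r0 then a else 0) p (nrm a * mon p r0).
Proof.
move=> p0; have := @bnd_supp R _ (fun r => nrm (if r == r0 then a else 0) * mon p r)
  [fset r0]%fset.
rewrite big_seq_fset1 eqxx; apply=> r; first by rewrite mulr_ge0 ?nrm_ge0 // mon_ge0 // => i; exact: ltW.
by rewrite inE => /negPf ->; rewrite nrm0 mul0r.
Qed.

Lemma ps_mon p w r0 (a : C R) : (forall i, 0 < p i) ->
  ps (fun r => if r == r0 then a else 0) p (fun z => a * mon (dif z w) r0) w.
Proof.
move=> p0; split=> // [|z zw]; first by exists (nrm a * mon p r0); exact: psb_single.
have := @hsum_single R _ (fun r => a * mon (dif z w) r) r0.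
by apply: hsum_ext => r; case: ifP; rewrite ?mul0r.
Qed.

Lemma ps_cst p w (a : C R) : (forall i, 0 < p i) ->
  ps (fun r => if r == mzero then a else 0) p (fun=> a) w.
Proof.
move=> p0; apply: ps_ext (ps_mon w mzero a p0) _ => z _.
by rewrite mon0 mulr1.
Qed.

Lemma ps_coord p w i : (forall j, 0 < p j) ->
  ps (fun r => if r == munit i then 1 else 0) p (fun z => z 0 i - w 0 i) w.
Proof.
move=> p0; apply: ps_ext (ps_mon w (munit i) 1 p0) _ => z _.
by rewrite mon_unit mul1r.
Qed.

Lemma ps_center c p f w : ps c p f w -> f w = c mzero.
Proof.
move=> [p0 _ h]; have := h w (near_box_refl w p0); move/hsum_uniq; apply.
have := @hsum_single R _ c mzero; apply: hsum_ext => r.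
have [->|r0] := eqVneq r mzero; first by rewrite mon0 mulr1.
have : (0 < mdeg r)%N by rewrite lt0n mdeg_eq0.
move=> /mdeg_gt0[i [s ->]]; rewrite mon_add mon_unit difxx mulr0 mulr0 //.
Qed.

Lemma ps_reexpand c p q th f w w' : ps c p f w ->
  (forall i, 0 < q i) -> near_box th w' w -> (forall i, q i + th i <= p i) ->
  exists c', ps c' q f w' /\
   forall s, hsum (fun r => (mbin r s)%:R * c r * mon (dif w' w) (msub r s)) (c' s).
Proof.
move=> [p0 [B cB] h] q0 ww' qth.
have [c' [c'B c'E c'h]] := psb_reexpand q0 ww' qth cB.
exists c'; split=> //; split=> // [|z zw']; first by exists B.
apply: c'h => //; rewrite dif_add; apply: h => i.
rewrite -(dif_add z w w'); apply: le_trans (nrmD _ _) _.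
by apply: le_trans (qth i); apply: lerD.
Qed.

Lemma ps_fun c p B w : (forall i, 0 < p i) -> psb c p B -> exists f, ps c p f w.
Proof.
move=> p0 cB.
have ex z : exists S, near_box p z w -> hsum (fun r => c r * mon (dif z w) r) S.
  have [zw|nzw] := pselect (near_box p z w); last by exists 0.
  by have [S hS] := psb_hsum cB zw; exists S.
have [f fP] := choice ex; exists f; split=> //.
by exists B.
Qed.

Definition shiftR w (x : 'I_d -> R) : 'rV[C R]_d := \row_i (w 0 i + toC (x i)).

Lemma dif_shiftR w x : dif (shiftR w x) w = fun i => toC (x i).
Proof. by apply/funext => i; rewrite /dif mxE addrC addKr. Qed.

(** Agreement at real displacements with positive coordinates is enough. This is what is available
    later, where functions are known on real sets only. *)
Lemma ps_uniq c c' p p' f g w e : ps c p f w -> ps c' p' g w -> 0 < e ->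
  (forall x, (forall i, 0 < x i <= e) -> f (shiftR w x) = g (shiftR w x)) ->
  forall r, c r = c' r.
Proof.
move=> fP gP e0 fg r.
pose q i := Num.min e (Num.min (p i) (p' i)).
have q0 i : 0 < q i by rewrite !lt_min e0 (ps_pos i fP) (ps_pos i gP).
have fP' : ps c q f w by apply: ps_shrink fP _ => i; rewrite q0 !ge_min lexx orbT.
have gP' : ps c' q g w by apply: ps_shrink gP _ => i; rewrite q0 !ge_min lexx !orbT.
have /= [_ [B dB] dh] := psD fP' (psZ (-1) gP').
apply/eqP; rewrite -subr_eq0 -mulN1r; apply/eqP; apply: (psb_eq0 q0 dB) => x xq.
have := dh (shiftR w x); rewrite dif_shiftR mulN1r fg ?subrr; last first.
  by move=> i; have /andP[-> h] := xq i; rewrite (le_trans h) // ge_min lexx.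
apply=> i; rewrite dif_shiftR nrm_toC; have /andP[x0 h] := xq i.
by rewrite gtr0_norm.
Qed.

(** Shrinking the polydisc by [e] multiplies a term of degree k by e^k, and only degrees at least 2
    remain. *)
Lemma ps_linear c p f w : ps c p f w -> exists2 B, 0 <= B &
  forall e z, 0 <= e <= 1 -> near_box (fun i => e * p i) z w ->
   nrm (f z - f w - \sum_i c (munit i) * dif z w i) <= e ^+ 2 * B.
Proof.
move=> fP; have [p0 [B cB] h] := fP; exists B; first exact: bnd_ge0 cB.
move=> e z /andP[e0 e1] zw.
have zw' : near_box p z w.
  by move=> i; apply: le_trans (zw i) _; rewrite ler_piMl // ltW.
have h0 := @hsum_single R _ (fun r => c r * mon (dif z w) r) mzero.
rewrite mon0 mulr1 -(ps_center fP) in h0.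
have h1 := hsum_bigsum (index_enum 'I_d)
   (fun i => @hsum_single R _ (fun r => c r * mon (dif z w) r) (munit i)).
have -> : \sum_i c (munit i) * dif z w i =
    \sum_i c (munit i) * mon (dif z w) (munit i).
  by apply: eq_bigr => i _; rewrite mon_unit.
apply: hsum_nrm_le (hsumB (hsumB (h z zw') h0) h1) _.
apply: bnd_le (bndZ (exprn_ge0 2 e0) cB) => r.
case E : (mdeg r) => [|[|n]].
- have /eqP -> : r == mzero by rewrite -mdeg_eq0 E.
  rewrite eqxx subrr sub0r nrmN big1 ?nrm0; last first.
    move=> i _; case: eqP => // /(congr1 mdeg).
    by rewrite mdeg0 mdeg_unit.
  by rewrite mulr_ge0 ?exprn_ge0 // mulr_ge0 ?nrm_ge0 // mon_ge0 // => i; rewrite ltW.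
- have [i ->] := mdeg_eq1 E.
  have -> : (munit i == mzero) = false by rewrite -mdeg_eq0 mdeg_unit.
  rewrite subr0 (bigD1 i) //= eqxx big1 ?addr0; last first.
    move=> j ji; case: eqP => // /ffunP/(_ i); rewrite !ffunE eqxx eq_sym.
    by rewrite (negPf ji).
  by rewrite subrr nrm0 mulr_ge0 ?exprn_ge0 // mulr_ge0 ?nrm_ge0 // mon_ge0 // => j; rewrite ltW.
have -> : (r == mzero) = false by rewrite -mdeg_eq0 E.
rewrite subr0 big1 ?subr0; last first.
  by move=> i _; case: eqP => // rE; move: E; rewrite rE mdeg_unit.
rewrite nrmM mulrCA; apply: (ler_wpM2l (nrm_ge0 _)).
rewrite nrm_mon; apply: (@le_trans _ _ (mon (fun i => e * p i) r)).
  by apply: mon_le => i; rewrite nrm_ge0 zw.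
rewrite mon_mul mon_cst E; apply: ler_wpM2r.
  by apply: mon_ge0 => i; rewrite ltW.
by apply: ler_wiXn2l.
Qed.

(** Leibniz's rule for first derivatives at the centre. *)
Lemma conv_unit c c' i :
  conv c c' (munit i) = c mzero * c' (munit i) + c (munit i) * c' mzero.
Proof.
have ui : munit i != mzero by rewrite -mdeg_eq0 mdeg_unit.
rewrite /conv.
have -> : mbox (munit i) = [fset mzero; munit i]%fset.
  apply/fsetP => s; rewrite in_mbox !inE; apply/idP/orP.
    move=> /forallP si; have [s0|s1] := eqVneq (s i) 0%N; [left|right];
      apply/eqP/ffunP => j; have := si j; rewrite !ffunE; case: eqP => [->|_] /=;
      by [rewrite leqn0 => /eqP | rewrite s0 | move=> si1; apply/eqP; rewrite eqn_leq si1 lt0n].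
  by move=> [/eqP ->|/eqP ->]; apply/forallP => j; rewrite !ffunE.
rewrite big_fsetU1 /=; last by rewrite inE eq_sym.
rewrite big_seq_fset1; congr (_ * c' _ + _ * c' _); apply/ffunP => j;
  by rewrite !ffunE ?subn0 ?subnn.
Qed.

End Germs.

(** * Analytic functions *)

Section Analytic.
Context {R : realType} {d : nat}.
Implicit Types (c : mindex d -> C R) (p q : 'I_d -> R) (f g h : 'rV[C R]_d -> C R).
Implicit Types (z w : 'rV[C R]_d) (B e : R) (r s t : mindex d).

Lemma ps_min c p f w : ps c p f w -> exists2 e, 0 < e & ps c (fun=> e) f w.
Proof.
move=> fP; have [e e0 ep] := exists_lt_all (fun i => ps_pos i fP).
by exists e => //; apply: ps_shrink fP _ => i; rewrite e0 ep.
Qed.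

Lemma monomialE z w r : monomial (z - w) r = mon (dif z w) r.
Proof. by apply: eq_bigr => i _; rewrite /dif !mxE. Qed.

Lemma near_boxP w (P : set 'rV[C R]_d) :
  (\forall z \near w, P z) <->
  exists2 e, 0 < e & forall z, near_box (fun=> e) z w -> P z.
Proof.
split=> [/nbhs_rowC[e e0 h]|[e e0 h]].
  exists (e / 2) => [|z zw]; first by rewrite divr_gt0.
  by apply: h => i; apply: le_lt_trans (zw i) _; lra.
by apply/nbhs_rowC; exists e => // z zw; apply: h => i; apply: ltW; exact: zw.
Qed.

Lemma analytic_atP f w : analytic_at f w <-> exists c p, ps c p f w.
Proof.
split=> [[c /near_boxP[e e0 h]]|[c [p /ps_min[e e0 [_ [B cB] h]]]]].
  exists c, (fun=> e); split=> // [|z zw].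
    (* Summability at the corner of the polydisc is a bound for all of it. *)
    have [|[B cB] _] := iffLR (has_abs_sumP _ _) (h (shiftR w (fun=> e)) _).
      by move=> i; rewrite dif_shiftR nrm_toC ger0_norm // ltW.
    exists B; apply/psbE => [i|]; first exact: ltW.
    by apply: bnd_le cB => r; rewrite monomialE dif_shiftR.
  have [_] := iffLR (has_abs_sumP _ _) (h z zw).
  by apply: hsum_ext => r; rewrite monomialE.
exists c; apply/near_boxP; exists e => // z zw; apply/has_abs_sumP; split.
  exists B; apply: bnd_le (psb_nrm cB zw) => r.
  by rewrite monomialE.
by apply: hsum_ext (h z zw) => r; rewrite monomialE.
Qed.

Lemma ps_analytic_near c p f w : ps c p f w ->
  exists2 e, 0 < e & forall w', near_box (fun=> e) w' w -> exists c', ps c' (fun=> e) f w'.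
Proof.
move=> /ps_min[e e0 fP]; exists (e / 2) => [|w' ww']; first by rewrite divr_gt0.
have e2 : 0 < e / 2 by rewrite divr_gt0.
have [|c' [c'P _]] := ps_reexpand (q := fun=> e / 2) fP (fun=> e2) ww'.
  by move=> i; rewrite -splitr.
by exists c'.
Qed.

Lemma ps_cont c p f w : ps c p f w -> exists2 B, 0 <= B &
  forall e z, 0 <= e <= 1 -> near_box (fun i => e * p i) z w ->
   nrm (f z - f w) <= e * B.
Proof.
move=> fP; have [B B0 h] := ps_linear fP.
exists (B + \sum_i nrm (c (munit i)) * p i) => [|e z e01 zw].
  by rewrite addr_ge0 // sumr_ge0 // => i _; rewrite mulr_ge0 ?nrm_ge0 // ltW // (ps_pos i fP).
have /andP[e0 e1] := e01.
rewrite -[f z - f w](subrK (\sum_i c (munit i) * dif z w i)).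
apply: le_trans (nrmD _ _) _; rewrite mulrDr; apply: lerD.
  apply: le_trans (h e z e01 zw) _; rewrite expr2; apply: ler_wpM2r => //.
  by rewrite ler_piMl.
apply: le_trans (nrm_sum _ _ _) _; rewrite mulr_sumr; apply: ler_sum => i _.
by rewrite nrmM mulrCA; apply: (ler_wpM2l (nrm_ge0 _)).
Qed.

Lemma ps_neq0_near c p f w : ps c p f w -> f w != 0 ->
  exists2 e, 0 < e & forall z, near_box (fun=> e) z w -> f z != 0.
Proof.
move=> /ps_min[e e0 fP] fw0; have [B B0 h] := ps_cont fP.
have n0 : 0 < nrm (f w) by rewrite nrm_gt0.
have n2 : 0 < nrm (f w) / 2 by rewrite divr_gt0.
have [x /andP[x0 x1] xB] := small_factor B0 n2.
exists (x * e) => [|z zw]; first by rewrite mulr_gt0.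
have : nrm (f z - f w) <= x * B by apply: h zw; rewrite (ltW x0).
move: xB.
move=> h1 h2; apply/eqP => fz0; move: h2; rewrite fz0 sub0r nrmN; lra.
Qed.

Lemma ps_partial c p f w i : ps c p f w -> partial f i w = c (munit i).
Proof.
move=> /ps_min[e e0 fP]; have [B B0 h] := ps_linear fP.
rewrite /partial /derive; apply: cvg_lim => //.
apply/cvgrPdist_le => x /gt0_toC[x0 x00 ->].
have xe0 : 0 < x0 * e by rewrite mulr_gt0.
have [y /andP[y0 y1] yB] := small_factor B0 xe0.
have m0 : 0 < y * e by rewrite mulr_gt0.
apply/nbhs_ballP; exists (toC (y * e)); first by rewrite /= toC_gt0.
move=> t /=; rewrite /ball /= sub0r normrN normCE toC_lt => tm tn0.
have nt : 0 < nrm t by rewrite nrm_gt0.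
rewrite normCE toC_le.
set z := t *: delta_mx 0 i + w.
have zi j : dif z w j = if j == i then t else 0.
  rewrite /dif !mxE eqxx /= addrK; case: eqP => _; by rewrite ?mulr1 ?mulr0.
have te : 0 <= nrm t / e <= 1.
  apply/andP; split; first by rewrite divr_ge0 ?nrm_ge0 // ltW.
  by rewrite ler_pdivrMr // mul1r (le_trans (ltW tm)) // ler_piMl // ltW.
have := h (nrm t / e) z te.
rewrite (bigD1 i) //= zi eqxx big1 ?addr0; last first.
  by move=> j /negPf ji; rewrite zi ji mulr0.
move=> h1.
have {}h1 : nrm (f z - f w - c (munit i) * t) <= (nrm t / e) ^+ 2 * B.
  apply: h1 => j; rewrite zi divfK; last by rewrite gt_eqF.
  by case: (j == i); rewrite ?nrm0 ?nrm_ge0.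
rewrite nrm_distC -(ler_pM2l nt) -nrmM mulrBr /GRing.scale /= mulVKf //.
rewrite [t * c _]mulrC; apply: le_trans h1 _.
rewrite expr2 -mulrA.
apply: (@le_trans _ _ (nrm t / e * (x0 * e))); last first.
  by rewrite mulrA mulrAC divfK ?gt_eqF.
apply: ler_wpM2l; first by case/andP: te.
apply: le_trans yB; apply: ler_wpM2r => //.
by rewrite ler_pdivrMr // ltW.
Qed.

End Analytic.

(** * Quotients, Weierstrass division, and Taylor coefficients as functions of the centre *)

Section Division.
Context {R : realType} {d : nat}.
Implicit Types (c : mindex d -> C R) (p q : 'I_d -> R) (f g h : 'rV[C R]_d -> C R).
Implicit Types (z w : 'rV[C R]_d) (B e : R) (r s t : mindex d).

Lemma ps_val c p f g w z : ps c p f w -> ps c p g w -> near_box p z w -> f z = g z.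
Proof. by move=> [_ _ hf] [_ _ hg] zw; apply: hsum_uniq (hf z zw) (hg z zw). Qed.

Lemma analytic_common f g w : analytic_at f w -> analytic_at g w ->
  exists c c' e, [/\ 0 < e, ps c (fun=> e) f w & ps c' (fun=> e) g w].
Proof.
move=> /analytic_atP[c [p /ps_min[e e0 fP]]] /analytic_atP[c' [p' /ps_min[e' e'0 gP]]].
exists c, c', (Num.min e e'); split; first by rewrite lt_min e0.
  by apply: ps_shrink fP _ => i; rewrite lt_min e0 e'0 ge_min lexx.
by apply: ps_shrink gP _ => i; rewrite lt_min e0 e'0 ge_min lexx orbT.
Qed.

(** With a = h(w) and g = 1 - h/a, the quotient solves q = f/a + q g. As g vanishes at w, its norm
    is at most 1/2 on a polydisc shrunk by a small factor [k], and [psb_fixpoint] applies with the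
    ordinary degree as weight. *)
Lemma analytic_div f h w : analytic_at f w -> analytic_at h w -> h w != 0 ->
  analytic_at (fun z => f z / h z) w.
Proof.
move=> fw hw hw0; have [cf [ch [e [e0 fP hP]]]] := analytic_common fw hw.
pose a := h w.
have /= gP := psD (ps_cst w 1 (fun=> e0)) (psZ (- a^-1) hP).
set g := fun r => _ + _ in gP.
have g0 : g mzero = 0 by rewrite /g eqxx -(ps_center hP) mulNr mulVf // subrr.
have [_ [G gB] _] := gP.
have half : 0 < (1 / 2 : R) by rewrite divr_gt0.
have [k /andP[k0 k1] kG] := small_factor (bnd_ge0 gB) half.
pose p (i : 'I_d) := k * e.
have p0 i : 0 < p i by rewrite mulr_gt0.
have pe i : 0 < p i <= e by rewrite p0 ler_piMl // ltW.
have gB' : psb g p (mon p mzero / 2).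
  rewrite mon0; apply: bnd_weak kG; apply: bnd_le (bndZ (ltW k0) gB) => r.
  have [->|r0] := eqVneq r mzero; first by rewrite g0 nrm0 !mul0r mulr0.
  have -> : mon p r = k ^+ mdeg r * mon (fun=> e) r by rewrite -mon_cst -mon_mul.
  rewrite mulrCA; apply: ler_wpM2r.
    by rewrite mulr_ge0 ?nrm_ge0 // mon_ge0 // => i; exact: ltW.
  rewrite -[leRHS]expr1; apply: ler_wiXn2l => //; first exact: ltW.
  by rewrite lt0n mdeg_eq0.
have fP' := ps_shrink (psZ a^-1 fP) pe.
have [_ [B fB] _] := fP'.
have [|cq [qB qE]] := psb_fixpoint (l := fun=> 1%N) p0 fB gB'.
  move=> t gt0; rewrite /mwt (eq_bigr (@mzero d)) => [|i _]; last by rewrite ffunE.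
  under [X in (_ < X)%N]eq_bigr do rewrite mul1n.
  rewrite -!/(mdeg _) mdeg0 lt0n mdeg_eq0; apply: contra_neq gt0 => ->.
  exact: g0.
have [q qP] := ps_fun w p0 qB.
have := psD fP' (psM qP (ps_shrink gP pe)).
have <- : cq = fun r => a^-1 * cf r + conv cq g r.
  by apply/funext => r; rewrite qE madd0.
move=> qP'; have qz z zw := ps_val qP qP' (z := z) zw.
have [e1 e10 h0] := ps_neq0_near hP hw0.
apply/analytic_atP; exists cq, (fun=> Num.min e1 (k * e)).
apply: ps_ext (ps_shrink qP _) _ => [i|z zw].
  by rewrite lt_min e10 mulr_gt0 // ge_min lexx orbT.
have hz0 : h z != 0.
  by apply: h0 => i; apply: le_trans (zw i) _; rewrite !ge_min lexx.
have := qz z; move=> /(_ _)/eqP; rewrite mulrDr mulr1 -subr_eq0 => /(_ _)/eqP h1.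
apply: (mulIf hz0); rewrite divfK //; apply: (mulfI (invr_neq0 hw0)).
apply/eqP; rewrite -subr_eq0 -{}[X in _ == X]h1; last first.
  by move=> i; apply: le_trans (zw i) _; rewrite !ge_min lexx orbT.
by apply/eqP; rewrite /a; ring.
Qed.

Lemma mwt_gt1 i (l := fun j => if j == i then 1%N else 2%N) t :
  t != mzero -> t != munit i -> (1 < mwt l t)%N.
Proof.
move=> t0 ti; have [[j ji tj]|nj] := pselect (exists2 j, j != i & (0 < t j)%N).
  rewrite /mwt (bigD1 j) //= /l (negPf ji) ltn_addr //; exact: leq_pmulr.
have tE j : j != i -> t j = 0%N.
  by move=> ji; apply/eqP; rewrite -leqn0 leqNgt; apply/negP => tj; apply: nj; exists j.
rewrite /mwt (bigD1 i) //= /l eqxx mul1n ltn_addr // ltnNge; apply/negP.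
rewrite leq_eqVlt ltnS leqn0 => /orP[]/eqP tti.
  case/eqP: ti; apply/ffunP => j; rewrite ffunE.
  by have [->//|ji] := eqVneq j i; exact: tE.
case/eqP: t0; apply/ffunP => j; rewrite ffunE.
by have [->//|ji] := eqVneq j i; exact: tE.
Qed.

(* Weighting the [i]-th variable less than the others makes [z_i - h / a] small
   compared with [z_i], which is what [psb_fixpoint] needs. *)
Lemma weierstrass_division i f h w :
  analytic_at f w -> analytic_at h w -> h w = 0 -> partial h i w != 0 ->
  exists q r : 'rV[C R]_d -> C R, [/\ analytic_at q w, analytic_at r w & exists2 e, 0 < e &
    (forall z, near_box (fun=> e) z w -> f z = q z * h z + r z) /\
    (forall z z', near_box (fun=> e) z w -> near_box (fun=> e) z' w ->
       (forall j, j != i -> z 0 j = z' 0 j) -> r z = r z')].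
Proof.
move=> fw hw hw0 hi; have [cf [ch [e [e0 fP hP]]]] := analytic_common fw hw.
rewrite (ps_partial i hP) in hi; set a := ch (munit i) in hi.
have uz : munit i != mzero by rewrite -mdeg_eq0 mdeg_unit.
have /= gP := psD (ps_coord w i (fun=> e0)) (psZ (- a^-1) hP).
set g := fun r => _ + _ in gP.
have g0 : g mzero = 0.
  by rewrite /g eq_sym (negPf uz) -(ps_center hP) hw0 mulr0 addr0.
have g1 : g (munit i) = 0 by rewrite /g eqxx mulNr mulVf // subrr.
have [_ [G gB] _] := gP.
have half : 0 < e / 2 by rewrite divr_gt0.
have [k /andP[k0 k1] kG] := small_factor (bnd_ge0 gB) half.
pose l (j : 'I_d) := if j == i then 1%N else 2%N.
(* On these radii a term of weight m gains k^m. The series [g] of z_i - h/a starts at weight 2, so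
   its norm is at most k^2 G, to be compared with half of the i-th radius k e; hence the choice k G
   <= e / 2. *)
pose p (j : 'I_d) := k ^+ l j * e.
have p0 j : 0 < p j by rewrite mulr_gt0 // exprn_gt0.
have pe j : 0 < p j <= e.
  by rewrite p0 ler_piMl ?(ltW e0) // exprn_ile1 // ltW.
have monp r : mon p r = k ^+ mwt l r * mon (fun=> e) r.
  rewrite mon_mul; congr (_ * _); rewrite /mon /mwt -prodrXr.
  by apply: eq_bigr => j _; rewrite exprM.
have gl t : g t != 0 -> (mwt l (munit i) < mwt l t)%N.
  move=> gt0; have -> : mwt l (munit i) = 1%N.
    rewrite /mwt (bigD1 i) //= ffunE eqxx /l eqxx big1 // => j /negPf ji.
    by rewrite ffunE ji muln0.
  by apply: mwt_gt1; apply: contra_neq gt0 => ->.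
have gB' : psb g p (mon p (munit i) / 2).
  have -> : mon p (munit i) / 2 = k * (e / 2).
    by rewrite mon_unit /p /l eqxx expr1 mulrA.
  apply: bnd_weak (_ : bnd _ (k * (k * G))) _; last by rewrite ler_wpM2l // ltW.
  apply: bnd_le (bndZ (ltW k0) (bndZ (ltW k0) gB)) => r.
  have [->|gr0] := eqVneq (g r) 0; first by rewrite nrm0 !mul0r !mulr0.
  have r2 : (1 < mwt l r)%N.
    apply: mwt_gt1; apply: contra_neq gr0 => ->; [exact: g0|exact: g1].
  rewrite monp mulrCA [leRHS]mulrA; apply: ler_wpM2r.
    by rewrite mulr_ge0 ?nrm_ge0 // mon_ge0 // => j; exact: ltW.
  by rewrite -expr2; apply: ler_wiXn2l => //; exact: ltW.
have [_ [B fB] _] := ps_shrink fP pe.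
have [cq [qB qE]] := psb_fixpoint p0 fB gB' gl.
have [q qP] := ps_fun w p0 qB.
have /= kP := psD (ps_shrink fP pe) (psM qP (ps_shrink gP pe)).
set kk := fun r => cf r + _ in kP.
(* [kk] is the series of f + q g. The fixed point equation says that its part divisible by z_i - w_i
   is (z_i - w_i) q; the rest is the remainder. As g = (z_i - w_i) - h/a, this leaves f = (q/a) h +
   r. *)
pose cr r := if r i == 0%N then kk r else 0.
have [_ [BK kB] _] := kP.
have [|r rP] := @ps_fun _ _ cr p BK w p0.
  apply: bnd_le kB => s; rewrite /cr; case: ifP => // _.
  by rewrite nrm0 mul0r mulr_ge0 ?nrm_ge0 // mon_ge0 // => j; exact: ltW.
have /= sP := psD (psM (ps_coord w i p0) qP) rP.
have kE : kk = fun s => conv (fun r => if r == munit i then 1 else 0) cq s + cr s.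
  apply/funext => s; rewrite /cr /conv.
  have [si|si] := eqVneq (s i) 0%N.
    rewrite big1_seq ?add0r // => t; rewrite in_mbox => /andP[_ /forallP ts].
    case: eqP => [tE|_]; last by rewrite mul0r.
    by have := ts i; rewrite tE ffunE eqxx si.
  have us : mle (munit i) s.
    by apply/forallP => j; rewrite ffunE; case: eqP => // ->; rewrite lt0n.
  rewrite addr0 (big_fsetD1 (munit i)) ?in_mbox //= eqxx mul1r big1_seq ?addr0.
    by rewrite qE maddC msubK.
  by move=> t; rewrite !inE => /andP[_ /andP[/negPf -> _]]; rewrite mul0r.
rewrite -kE in sP.
have [e1 e10 ep] := exists_lt_all p0.
have zp z : near_box (fun=> e1) z w -> near_box p z w.
  by move=> zw j; apply: le_trans (zw j) _.
exists (fun z => a^-1 * q z), r; split.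
- by apply/analytic_atP; do 2 eexists; exact: psZ qP.
- by apply/analytic_atP; exists cr, p.
exists e1 => //; split=> [z /zp zw|z z' /zp zw /zp zw' zz'].
  have := ps_val kP sP zw => E.
  apply/eqP; rewrite -subr_eq0; apply/eqP.
  have -> : f z - (a^-1 * q z * h z + r z) =
     (f z + q z * (z 0 i - w 0 i + - a^-1 * h z)) - ((z 0 i - w 0 i) * q z + r z) by ring.
  by rewrite E subrr.
have [_ _ rh] := rP.
apply: hsum_uniq (rh z zw) _; apply: hsum_ext (rh z' zw') => s.
rewrite /cr; case: eqP => [si|]; last by rewrite !mul0r.
congr (_ * _); apply: eq_bigr => j _; have [->|ji] := eqVneq j i.
  by rewrite si !expr0.
by rewrite /dif zz'.
Qed.

Lemma analytic_near f w : analytic_at f w ->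
  exists2 e, 0 < e & forall w', near_box (fun=> e) w' w -> analytic_at f w'.
Proof.
move=> /analytic_atP[c [p /ps_analytic_near[e e0 h]]]; exists e => // w' /h[c' c'P].
by apply/analytic_atP; exists c', (fun=> e).
Qed.

(** A choice of coefficients at every centre, zero where there is no expansion, makes derivatives
    functions of the point. *)
Definition tcoef f w : mindex d -> C R := xget (fun=> 0) [set c | exists p, ps c p f w].

Lemma tcoefP f w : analytic_at f w -> exists2 e, 0 < e & ps (tcoef f w) (fun=> e) f w.
Proof.
move=> /analytic_atP[c [p cP]].
have [q /ps_min] : [set c | exists p, ps c p f w] (tcoef f w).
  by apply: (@xgetPex _ (fun=> 0) [set c | exists p, ps c p f w]); exists c, p.
by [].
Qed.

Lemma tcoefE c p f w : ps c p f w -> tcoef f w = c.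
Proof.
move=> cP; have [|e e0 tP] := @tcoefP f w; first by apply/analytic_atP; exists c, p.
by apply/funext => r; apply: ps_uniq tP cP e0 _ r.
Qed.

Lemma mbin_mon_le r s p q : (forall i, 0 <= p i) -> (forall i, 0 <= q i) ->
  (mbin r s)%:R * mon p s * mon q (msub r s) <= mon (fun i => p i + q i) r.
Proof.
move=> p0 q0; rewrite mon_binomial.
have [sr|/mbin_eq0 ->] := boolP (mle s r); last first.
  by rewrite !mul0r sumr_ge0 // => t _; rewrite !mulr_ge0 ?mon_ge0.
rewrite (big_fsetD1 s) ?in_mbox //= lerDl.
by rewrite sumr_ge0 // => t _; rewrite !mulr_ge0 ?mon_ge0.
Qed.

(** The s-th derivative divided by s! is analytic: [ps_reexpand] gives its value at each nearby
    centre as a series in the displacement. *)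
Lemma tcoef_ps c p f w s : ps c p f w -> exists q,
  ps (fun r => (mbin (madd r s) s)%:R * c (madd r s)) q (fun z => tcoef f z s) w.
Proof.
move=> /ps_min[e e0 fP]; have [p0 [B cB] h] := fP.
pose q (j : 'I_d) := e / 2; have q0 (j : 'I_d) : 0 < q j by rewrite divr_gt0.
have q00 j : 0 <= q j by rewrite ltW.
have ms : 0 < mon q s by apply: mon_gt0.
exists q; split=> // [|z zw].
  exists ((mon q s)^-1 * B).
  have imq : 0 <= (mon q s)^-1 by rewrite invr_ge0 ltW.
  apply: bnd_le (bndZ imq (bnd_inj (@madd_inj _ s) cB)) => r.
  rewrite -(ler_pM2l ms) mulVKf ?gt_eqF // nrmM nrm_nat.
  have := @mbin_mon_le (madd r s) s q q q00 q00; rewrite maddK.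
  have -> : (fun j => q j + q j) = (fun=> e) by apply/funext => j; rewrite -splitr.
  move=> /(ler_wpM2l (nrm_ge0 (c (madd r s)))); apply: le_trans.
  by rewrite le_eqVlt; apply/orP; left; apply/eqP; ring.
have [|c' [c'P c'E]] := ps_reexpand fP q0 zw.
  by move=> j; rewrite -splitr.
rewrite (tcoefE c'P).
have hi := @hsum_inj R _ _ (fun r => madd r s)
  (fun r => (mbin r s)%:R * c r * mon (dif z w) (msub r s)) (c' s) (@madd_inj _ s).
apply: hsum_ext (iffRL (hi _) (c'E s)) => [r|r rs]; first by rewrite maddK.
have [sr|/mbin_eq0 ->] := boolP (mle s r); last by rewrite !mul0r.
by have := rs (msub r s); rewrite maddC msubK // eqxx.
Qed.

End Division.

(** * The domain of convergence *)

Section IdentityTheorem.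
Context {R : realType} {d : nat}.
Implicit Types (f g h : 'rV[C R]_d -> C R) (z w : 'rV[C R]_d) (B e t : R).

Lemma nrm_scaler (a : C R) z i : nrm ((a *: z) 0 i) = nrm a * nrm (z 0 i).
Proof. by rewrite mxE nrmM. Qed.

(** Continuation along the segment from 0 to [w]: the supremum of the times up to which [f] vanishes
    locally can be passed, unless it is 1. *)
Lemma analytic_segment0 f w :
  (forall t, 0 <= t <= 1 -> analytic_at f (toC t *: w)) ->
  (\forall z \near (0 : 'rV[C R]_d), f z = 0) -> f w = 0.
Proof.
move=> fan /near_boxP[e0 e00 f0].
pose Z t := exists2 e, 0 < e & forall z, near_box (fun=> e) z (toC t *: w) -> f z = 0.
pose E := [set t : R | 0 <= t <= 1 /\ forall s, 0 <= s <= t -> Z s].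
have Z0 : E 0.
  split=> [|s s0]; first by rewrite lexx ler01.
  exists e0 => // z zw; apply: f0; move: zw.
  have -> : s = 0 by apply/le_anti; case/andP: s0 => -> ->.
  rewrite toC0 scale0r; exact.
have Eub : has_ubound E by exists 1 => t [/andP[]].
have hE : has_sup E by split; [exists 0|].
pose S := sup E.
have S01 : 0 <= S <= 1.
  rewrite (sup_upper_bound hE Z0) /= ; apply: ge_sup; first by exists 0.
  by move=> t [/andP[]].
have [c [p /ps_min[e e1 fP]]] := iffLR (analytic_atP _ _) (fan S S01).
pose M := \sum_i nrm (w 0 i).
have M0 : 0 <= M by apply: sumr_ge0 => i _; exact: nrm_ge0.
have wM i : nrm (w 0 i) <= M.
  by rewrite /M (bigD1 i) //= lerDl sumr_ge0 // => j _; exact: nrm_ge0.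
(* With dl M <= e / 8, times at most 2 dl apart give points at most e / 4 apart. *)
have e8 : 0 < e / 8 by rewrite divr_gt0.
have [dl /andP[dl0 dl1] dlM] := small_factor M0 e8.
have segw s s' : `|s - s'| <= 2 * dl ->
    near_box (fun=> e / 4) (toC s *: w) (toC s' *: w).
  move=> ss i; rewrite /dif !mxE -mulrBl -toCB nrmM nrm_toC.
  apply: (@le_trans _ _ (2 * dl * M)); last by lra.
  by apply: ler_pM => //; exact: nrm_ge0.
have [s0 [s001 s0Z] s0S] := sup_adherent dl0 hE.
have s0leS : s0 <= S by apply: sup_upper_bound.
have q0 : 0 < e / 2 by rewrite divr_gt0.
(* The series at the supremum is recentred at a time [s0] just before it, where [f] vanishes
   locally. Its coefficients are then 0, and [f] vanishes on a polydisc whose size does not depend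
   on [s0]. *)
have [|||c' [c'P _]] := ps_reexpand (w' := toC s0 *: w) (q := fun=> e / 2)
    (th := fun=> e / 4) fP => //.
- by apply: segw; rewrite ler0_norm ?subr_le0 // opprB /S; lra.
- by move=> i; lra.
have [e2 e20 f20] : Z s0 by apply: s0Z; case/andP: s001 => -> _ /=.
have c'0 : c' = fun r => if r == mzero then 0 else 0.
  apply/funext => r; apply: (ps_uniq c'P (ps_cst (toC s0 *: w) 0 (fun=> q0)) e20 _ r).
  move=> x xe; apply: f20 => i; rewrite dif_shiftR nrm_toC.
  by have /andP[x0 h] := xe i; rewrite gtr0_norm.
have fz0 z : near_box (fun=> e / 2) z (toC s0 *: w) -> f z = 0.
  have zP : ps c' (fun=> e / 2) (fun=> 0) (toC s0 *: w).
    by rewrite c'0; exact: ps_cst.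
  by move=> zw; rewrite (ps_val c'P zP zw).
have Znear s : `|s - S| <= dl -> Z s.
  move=> sS; exists (e / 4) => [|z zw]; first by rewrite divr_gt0.
  apply: fz0 => i; rewrite -(dif_add z (toC s0 *: w) (toC s *: w)).
  apply: le_trans (nrmD _ _) _; have -> : e / 2 = e / 4 + e / 4 by lra.
  apply: lerD (zw i) (segw _ _ _ i).
  rewrite -(subrKA S); apply: le_trans (ler_normD _ _) _.
  have : `|S - s0| <= dl by rewrite ger0_norm ?subr_ge0 // /S; lra.
  lra.
have ES' : E (Num.min 1 (S + dl)).
  split; first by rewrite ge_min lexx le_min ler01 andbT /=; case/andP: S01 => ? _; rewrite addr_ge0 // ltW.
  move=> s /andP[s0' ss]; have [sS|Ss] := leP s s0.
    by apply: s0Z; rewrite s0' sS.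
  apply: Znear; move: ss; rewrite le_min => /andP[_ ss].
  rewrite ler_norml; apply/andP; split; last by lra.
  by move: s0S; rewrite -/S; lra.
have := sup_upper_bound hE ES'; rewrite -/S ge_min => /orP[h|h]; last by exfalso; lra.
have [_ /(_ 1)] := ES'; case=> [|e3 e30].
  by rewrite ler01 le_min lexx /=; case/andP: S01; lra.
rewrite toC1 scale1r; apply; exact: near_box_refl.
Qed.

Lemma analyticM f g w : analytic_at f w -> analytic_at g w ->
  analytic_at (fun z => f z * g z) w.
Proof.
move=> fw gw; have [c [c' [e [e0 fP gP]]]] := analytic_common fw gw.
by apply/analytic_atP; exists (conv c c'), (fun=> e); exact: psM.
Qed.

Lemma analyticB f g w : analytic_at f w -> analytic_at g w ->
  analytic_at (fun z => f z - g z) w.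
Proof.
move=> fw gw; have [c [c' [e [e0 fP gP]]]] := analytic_common fw gw.
apply/analytic_atP; exists (fun r => c r + -1 * c' r), (fun=> e).
by apply: ps_ext (psD fP (psZ (-1) gP)) _ => z _; rewrite mulN1r.
Qed.

Lemma analytic_cst (a : C R) w : analytic_at (fun=> a) w.
Proof.
by apply/analytic_atP; eexists; exists (fun=> 1); exact: ps_cst.
Qed.

End IdentityTheorem.

(** * The sum of the series and the quotient G / H *)

Section ConvergenceDomain.
Context {R : realType} {d : nat}.
Variable a : mindex d -> R.
Hypothesis a_ge0 : forall r, 0 <= a r.
Implicit Types (z w : 'rV[C R]_d) (p q x : 'I_d -> R) (r s : mindex d).

Definition asum p := exists B, bnd (fun r => a r * mon p r) B.

Local Notation D := (convergence_domain a).

Lemma series_termE z r : series_term a z r = toC (a r) * mon (dif z 0) r.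
Proof. by rewrite /series_term -[z in LHS]subr0 monomialE. Qed.

Lemma summable_asum z :
  abs_summable (series_term a z) <-> asum (fun i => nrm (z 0 i)).
Proof.
have E r : nrm (series_term a z r) = a r * mon (fun i => nrm (z 0 i)) r.
  rewrite series_termE nrmM nrm_toC ger0_norm // nrm_mon; congr (_ * _).
  by apply: eq_bigr => i _; rewrite /dif mxE subr0.
split=> [/abs_summableP|] [B h]; [|apply/abs_summableP]; exists B;
  by apply: bnd_le h => r; rewrite E.
Qed.

Lemma asum_le p q : (forall i, 0 <= q i <= p i) -> asum p -> asum q.
Proof.
move=> qp [B h]; exists B; apply: bnd_le h => r.
by apply: ler_wpM2l => //; apply: mon_le.
Qed.

Lemma convergence_domainP z :
  D z <-> exists p, (forall i, nrm (z 0 i) < p i) /\ asum p.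
Proof.
split.
  move=> /nbhs_rowC[e e0 h].
  have e2 : 0 < e / 2 by rewrite divr_gt0.
  (* Every modulus is increased by e / 2 along the ray through the coordinate; a zero coordinate,
     which has no ray, moves along the positive axis. *)
  pose z' : 'rV[C R]_d := \row_i (if z 0 i == 0 then toC (e / 2) else
     z 0 i * toC (1 + e / 2 / nrm (z 0 i))).
  exists (fun i => nrm (z 0 i) + e / 2); split=> [i|]; first by rewrite ltrDl.
  have -> : (fun i => nrm (z 0 i) + e / 2) = (fun i => nrm (z' 0 i)).
    apply/funext => i; rewrite mxE; have [->|zi] := eqVneq.
      by rewrite nrm0 add0r nrm_toC ger0_norm // ltW.
    have ni : 0 < nrm (z 0 i) by rewrite nrm_gt0.
    rewrite nrmM nrm_toC ger0_norm ?mulrDr ?mulr1; last by rewrite addr_ge0 // divr_ge0 // ltW.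
    by rewrite [_ * (_ / _)]mulrC divfK // gt_eqF.
  apply/summable_asum/h => i; rewrite mxE; have [->|zi] := eqVneq.
    by rewrite subr0 nrm_toC ger0_norm ?ltW //; lra.
  have ni : 0 < nrm (z 0 i) by rewrite nrm_gt0.
  rewrite toCD toC1 mulrDr mulr1 addrC addKr nrmM nrm_toC ger0_norm.
    by rewrite mulrC divfK ?gt_eqF //; lra.
  by rewrite divr_ge0 // ltW.
move=> [p [zp ap]].
have zp0 i : 0 < p i - nrm (z 0 i) by rewrite subr_gt0.
have [e e0 ep] := exists_lt_all zp0.
apply/nbhs_rowC; exists e => // z' z'z; apply/summable_asum.
apply: asum_le ap => i; rewrite nrm_ge0 /=.
rewrite -[z' 0 i](subrK (z 0 i)); apply: le_trans (nrmD _ _) _.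
by have := ltW (z'z i); have := ep i; lra.
Qed.

Lemma convergence_domain_le z w : D w -> (forall i, nrm (z 0 i) <= nrm (w 0 i)) -> D z.
Proof.
move=> /convergence_domainP[p [wp ap]] zw; apply/convergence_domainP.
by exists p; split=> // i; apply: le_lt_trans (wp i).
Qed.

Lemma convergence_domain_open : open D.
Proof. exact: open_interior. Qed.

Definition series_sum z : C R := xget 0 [set s | hsum (series_term a z) s].

Lemma series_sumE z (s : C R) : hsum (series_term a z) s -> series_sum z = s.
Proof.
move=> h; apply: hsum_uniq (h).
exact: (@xgetPex _ 0 [set s | hsum (series_term a z) s] (ex_intro _ s h)).
Qed.

Lemma series_sum_ps0 p : (forall i, 0 < p i) -> asum p ->
  ps (fun r => toC (a r)) p series_sum 0.
Proof.
move=> p0 [B aB]; have cB : psb (fun r => toC (a r)) p B.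
  by apply: bnd_le aB => r; rewrite nrm_toC ger0_norm.
split=> // [|z zp]; first by exists B.
have [S hS] := psb_hsum cB zp.
rewrite (series_sumE (s := S)) //.
by apply: hsum_ext hS => r; rewrite series_termE.
Qed.

(** The explicit form of the coefficients is kept because [pringsheim] uses that their terms are
    nonnegative at positive points. *)
Lemma series_sum_ps w : D w -> exists c q, ps c q series_sum w /\
  forall s, hsum (fun r => (mbin r s)%:R * toC (a r) * mon (dif w 0) (msub r s)) (c s).
Proof.
move=> /convergence_domainP[p [wp ap]].
have p0 i : 0 < p i by apply: le_lt_trans (nrm_ge0 _) (wp i).
have q0 i : 0 < p i - nrm (w 0 i) by rewrite subr_gt0.
have [||c h] := ps_reexpand (th := fun i => nrm (w 0 i)) (w' := w) (series_sum_ps0 p0 ap) q0.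
- by move=> i; rewrite /dif mxE subr0.
- by move=> i; rewrite subrK.
by exists c, (fun i => p i - nrm (w 0 i)).
Qed.

Lemma series_sum_analytic w : D w -> analytic_at series_sum w.
Proof.
by move=> /series_sum_ps[c [q [h _]]]; apply/analytic_atP; exists c, q.
Qed.

Lemma hsum_real_bnd (I : choiceType) (y : I -> R) S :
  (forall i, 0 <= y i) -> hsum (fun i => toC (y i)) S -> bnd y (nrm S).
Proof.
move=> y0 h A; apply/ler_addgt0Pr => e e0; have [A0 A0P] := h e e0.
apply: le_trans (sum_fset_sub y0 (fsubsetUl A A0)) _.
have := A0P _ (fsubsetUr A A0); rewrite -toC_sum => h1.
rewrite -[X in X <= _]ger0_norm ?sumr_ge0 // -nrm_toC.
rewrite -[toC _](subrK S); apply: le_trans (nrmD _ _) _.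
by rewrite addrC lerD2l ltW.
Qed.

Section Quotient.
Variables (U : set 'rV[C R]_d) (G H : 'rV[C R]_d -> C R).
Hypotheses (D_sub_U : closure D `<=` U) (G_analytic : analytic_on U G)
  (H_analytic : analytic_on U H) (H0 : H 0 != 0)
  (F_eq : \forall z \near (0 : 'rV[C R]_d),
        has_abs_sum (series_term a z) (G z / H z))
  (GH_coprime : forall w, U w -> germ_coprime w G H).

Let DU w : D w -> U w.
Proof. by move=> Dw; apply: D_sub_U; apply: subset_closure. Qed.

Lemma convergence_domain0 : D 0.
Proof. by rewrite /convergence_domain /=; apply: filterS F_eq => z []. Qed.

(** The domain contains the segment from 0 to each of its points, since only moduli matter; the
    equation holds near 0. *)
Lemma series_sum_mul w : D w -> series_sum w * H w = G w.
Proof.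
move=> Dw; apply/eqP; rewrite -subr_eq0; apply/eqP.
apply: (analytic_segment0 (f := fun z => series_sum z * H z - G z)) => [t /andP[t0 t1]|].
  have Dt : D (toC t *: w).
    apply: convergence_domain_le Dw _ => i; rewrite nrm_scaler nrm_toC ger0_norm //.
    by rewrite ler_piMl ?nrm_ge0.
  apply: analyticB; last by apply: G_analytic; exact: DU.
  apply: analyticM; first exact: series_sum_analytic.
  by apply: H_analytic; exact: DU.
have [c [p HP]] := iffLR (analytic_atP _ _) (H_analytic (DU convergence_domain0)).
have [e e0 Hn] := ps_neq0_near HP H0.
have : \forall z \near (0 : 'rV[C R]_d), H z != 0 by apply/near_boxP; exists e.
apply: filterS2 F_eq => z /has_abs_sumP[_ hs] Hz.
by rewrite (series_sumE hs) divfK // subrr.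
Qed.

(** [H] divides itself and, by the equation F H = G, also [G]; a common divisor is a unit. *)
Lemma denominator_neq0 w : D w -> H w != 0.
Proof.
move=> Dw; have Uw := DU Dw; apply: (GH_coprime Uw) (H_analytic Uw) _ _.
  exists series_sum; first exact: series_sum_analytic.
  apply: filterS (convergence_domain_open Dw) => z Dz.
  by rewrite series_sum_mul.
exists (fun=> 1); first exact: analytic_cst.
by apply/near_boxP; exists 1 => // z _; rewrite mul1r.
Qed.

(* Pringsheim: since the coefficients are nonnegative, the Taylor series of the
   sum at a positive point of the domain of radius > th rearranges into the
   original series at the shifted point. *)
Lemma pringsheim (x : 'I_d -> R) : (forall i, 0 < x i) ->
  (forall y, (forall i, 0 < y i < x i) -> D (\row_i toC (y i))) ->
  U (\row_i toC (x i)) -> ~ D (\row_i toC (x i)) -> H (\row_i toC (x i)) = 0.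
Proof.
set w := \row_i toC (x i) => x0 xD Uw nD; apply: contrapT => /eqP Hw.
apply: nD.
have := analytic_div (G_analytic Uw) (H_analytic Uw) Hw.
move=> /analytic_atP[cF [p0 /ps_min[e0 e00 FP0]]].
have [e1 e10 ex] := exists_lt_all x0.
pose e := Num.min e0 e1; have e_0 : 0 < e by rewrite lt_min e00.
have FP : ps cF (fun=> e) (fun z => G z / H z) w.
  by apply: ps_shrink FP0 _ => i; rewrite e_0 ge_min lexx.
have xe i : e <= x i by rewrite ge_min ex orbT.
(* As th + sg = e, the expansion of G / H at [w] recentres at x - th with radius [sg]; as th < sg,
   that polydisc has x in its interior. *)
pose th := e / 3; pose sg := e * 2 / 3.
have th0 : 0 < th by rewrite divr_gt0.
have sg0 : 0 < sg by rewrite divr_gt0 // mulr_gt0.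
have thsg : th < sg by rewrite /th /sg; lra.
pose y i := x i - th.
have y0 i : 0 < y i by have := xe i; rewrite /y /th; lra.
pose w' : 'rV[C R]_d := \row_i toC (y i).
have Dw' : D w' by apply: xD => i; rewrite y0 /y; lra.
have [c [q [cP cE]]] := series_sum_ps Dw'.
have w'w : near_box (fun=> th) w' w.
  move=> i; rewrite /dif !mxE -toCB nrm_toC /y addrAC subrr add0r normrN.
  by rewrite gtr0_norm.
have [|c1 [c1P _]] := ps_reexpand FP (fun=> sg0) w'w.
  by move=> i; rewrite /th /sg; lra.
(* Near [w'], which lies in the domain, G / H is the sum of the series, so the coefficients found
   from both sides coincide. *)
have c1c : c1 = c.
  have /near_boxP[e2 e20 De2] : \forall z \near w', D z by exact: convergence_domain_open Dw'.
  apply/funext => r; apply: (ps_uniq c1P cP e20 _ r) => u ue.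
  have Du : D (shiftR w' u).
    apply: De2 => i; rewrite dif_shiftR nrm_toC; have /andP[u0 ?] := ue i.
    by rewrite gtr0_norm.
  apply: (mulIf (denominator_neq0 Du)); rewrite divfK ?denominator_neq0 //.
  by rewrite series_sum_mul.
move: c1P; rewrite c1c => -[_ [B cB] _].
pose X (sr : mindex d * mindex d) : R :=
  (mbin sr.2 sr.1)%:R * a sr.2 * mon y (msub sr.2 sr.1) * mon (fun=> sg) sr.1.
have y00 i : 0 <= y i by exact: ltW.
have sg00 (i : 'I_d) : 0 <= sg by exact: ltW.
have X0 sr : 0 <= X sr by rewrite !mulr_ge0 ?mon_ge0.
have difw' : dif w' 0 = fun i => toC (y i) by apply/funext => i; rewrite /dif !mxE subr0.
(* For fixed s the terms are nonnegative reals with sum [c s], and the sum over s is bounded by the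
   expansion of G / H with radius [sg]. *)
have XB : bnd X B.
  apply: (bnd_pair X0 (b := fun s => nrm (c s) * mon (fun=> sg) s)) cB => s.
  have := cE s; rewrite difw' => h.
  have : hsum (fun r => toC ((mbin r s)%:R * a r * mon y (msub r s))) (c s).
    by apply: hsum_ext h => r; rewrite -toC_mon !toCM rmorph_nat.
  move/hsum_real_bnd => h1; rewrite mulrC.
  have := bndZ (mon_ge0 s sg00) (h1 _).
  rewrite /X /=; move=> h2; have {}h2 := h2 (fun r => _).
  apply: bnd_le (h2 _) => [r|r]; first by rewrite mulrC.
  by rewrite !mulr_ge0 ?mon_ge0.
apply/convergence_domainP; exists (fun i => sg + y i); split.
  by move=> i; rewrite mxE nrm_toC gtr0_norm // /y addrCA ltrDl subr_gt0.
exists B.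
have XB' : bnd (fun sr => nrm (toC (X sr))) B.
  by apply: bnd_le XB => sr; rewrite nrm_toC ger0_norm.
have [S hS] := hsum_ex XB'.
have [|+ _] := hsum_partition (phi := snd)
   (y := fun r => toC (a r * mon (fun i => sg + y i) r)) XB' hS.
  move=> r; apply/(hsum_inj (f := fun s => (s, r))); first by move=> ? ? [].
    by move=> [s r'] /(_ s) /=; have [->|//] := eqVneq r' r; rewrite eqxx.
  rewrite mon_binomial mulr_sumr toC_sum.
  have -> : \sum_(s <- mbox r) toC (a r * ((mbin r s)%:R * mon (fun=> sg) s * mon y (msub r s)))
     = \sum_(s <- mbox r) toC (X (s, r)).
    by apply: eq_bigr => s _; rewrite /X /=; congr toC; ring.
  apply: (@hsum_ext _ _ (fun s => toC (X (s, r)))) => [s|]; first by rewrite /= eqxx.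
  apply: hsum_supp => s; rewrite in_mbox /X /= => /mbin_eq0 ->.
  by rewrite !mul0r toC0.
apply: bnd_le => r; rewrite nrm_toC ger0_norm // mulr_ge0 // mon_ge0 // => i.
by rewrite addr_ge0 // (sg00 i).
Qed.

End Quotient.
End ConvergenceDomain.

(** * Boundaries of convex lower sets *)

(** The upper bound comes from e^h (1 - h) <= e^h e^(-h) = 1. *)
Lemma expR_taylor1 {R : realType} (h : R) : `|h| <= 1 / 2 ->
  0 <= expR h - 1 - h <= 2 * h ^+ 2.
Proof.
move=> /ler_normlP[h1 h2].
have e1 := expR_ge1Dx h; have e2 := expR_ge1Dx (- h).
apply/andP; split; first by lra.
have h3 : 0 < 1 - h by lra.
have : expR h * (1 - h) <= 1.
  apply: (@le_trans _ _ (expR h * expR (- h))); last by rewrite -expRD subrr expR0.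
  by rewrite ler_wpM2l // expR_ge0.
move=> h4; have h5 : expR h - 1 - h <= h ^+ 2 / (1 - h).
  by rewrite ler_pdivlMr //; rewrite expr2; lra.
apply: le_trans h5 _; rewrite ler_pdivrMr // mulrAC.
by rewrite ler_peMl ?sqr_ge0 //; lra.
Qed.

Section LowerSets.
Context {R : realType} {d : nat}.
Implicit Types (x y u q : 'rV[R]_d) (s t e : R).
Variable A : set 'rV[R]_d.
Hypothesis A_open : open A.
Hypothesis A_lower : forall x y, A x -> (forall i, y 0 i <= x 0 i) -> A y.

Lemma lower_ball x : A x -> exists2 e, 0 < e & forall y, (forall i, y 0 i <= x 0 i + e) -> A y.
Proof.
move=> Ax; have /nbhs_rowR[e e0 h] : nbhs x A by exact: A_open.
exists (e / 2) => [|y yx]; first by rewrite divr_gt0.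
apply: (@A_lower (x + const_mx (e / 2))) => [|i]; last by rewrite !mxE.
apply: h => i; rewrite !mxE addrAC subrr add0r ger0_norm; lra.
Qed.

Lemma boundaryP x : boundary A x <-> ~ A x /\ forall e, 0 < e -> A (x + const_mx (- e)).
Proof.
have iA : A° = A by apply/interior_id.
rewrite /boundary iA; split=> [[clx nAx]|[nAx h]]; split=> //.
  move=> e e0; have : nbhs x [set z : 'rV[R]_d | forall i, `|z 0 i - x 0 i| < e] by apply/nbhs_rowR; exists e.
  move=> /clx[a [Aa ax]]; apply: A_lower Aa _ => i; rewrite !mxE.
  by have := ax i; rewrite ltr_norml => /andP[h _]; lra.
move=> P /nbhs_rowR[e e0 hP]; exists (x + const_mx (- (e / 2))); split; first by apply: h; rewrite divr_gt0.
by apply: hP => i; rewrite !mxE addrAC subrr add0r normrN gtr0_norm; lra.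
Qed.

Lemma boundary_lt x y : boundary A x -> (forall i, y 0 i < x 0 i) -> A y.
Proof.
move=> /boundaryP[_ h] yx.
have [e e0 ey] := @exists_lt_all R d (fun i => x 0 i - y 0 i)
   (fun i => eq_ind_r is_true (yx i) (subr_gt0 _ _)).
by apply: A_lower (h e e0) _ => i; have := ey i; rewrite !mxE; lra.
Qed.

Hypotheses (A_nonempty : A !=set0) (A_proper : exists x, ~ A x).

(** Existence of the graph function over the direction (1, ..., 1): [s] is the supremum of the
    shifts that stay in [A]. *)
Lemma boundary_shift x : exists s, boundary A (x + const_mx s).
Proof.
have [a Aa] := A_nonempty; have [b nAb] := A_proper.
pose E := [set s | A (x + const_mx s)].
pose M (z : 'rV[R]_d) := \sum_i `|z 0 i - x 0 i|.
have Mz (z : 'rV[R]_d) i : `|z 0 i - x 0 i| <= M z.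
  by rewrite /M (bigD1 i) //= lerDl sumr_ge0.
have Ea : E (- M a).
  apply: A_lower Aa _ => i; rewrite !mxE.
  by have := Mz a i; rewrite ler_norml => /andP[h _]; lra.
have Eub : has_ubound E.
  exists (M b) => s Es; rewrite leNgt; apply/negP => Ms; apply: nAb.
  apply: A_lower Es _ => i; rewrite !mxE.
  by have := Mz b i; rewrite ler_norml => /andP[_ h]; lra.
have hE : has_sup E by split=> //; exists (- M a).
exists (sup E); apply/boundaryP; split=> [/lower_ball[e e0 h]|e e0].
  have : E (sup E + e).
    by apply: h => i; rewrite !mxE addrA.
  by move=> /(sup_upper_bound hE); lra.
have [s Es sS] := sup_adherent e0 hE.
by apply: A_lower Es _ => i; rewrite !mxE -addrA lerD2l ltW.
Qed.

(** If |s| exceeded every |u_i|, one of the two boundary points would be strictly below the other in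
    all coordinates, hence in [A]. *)
Lemma boundary_lipschitz x u s e : boundary A x ->
  boundary A (x + u + const_mx s) -> (forall i, `|u 0 i| <= e) -> `|s| <= e.
Proof.
move=> xb yb ue; rewrite leNgt; apply/negP => es.
have us i : `|u 0 i| < `|s| by apply: le_lt_trans es.
have [xn _] := iffLR (boundaryP _) xb; have [yn _] := iffLR (boundaryP _) yb.
have [s0|s0] := leP 0 s.
  apply: xn; apply: boundary_lt yb _ => i; rewrite !mxE.
  by have := us i; rewrite (ger0_norm s0) ltr_norml => /andP[h _]; lra.
apply: yn; apply: boundary_lt xb _ => i; rewrite !mxE.
by have := us i; rewrite (ltr0_norm s0) ltr_norml => /andP[_ h]; lra.
Qed.

(** An intermediate value argument on lines parallel to the i-th axis. *)
Lemma boundary_section i y e t : 0 < t ->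
  (forall u, (forall j, `|u 0 j| <= e) -> A (y + u + (- t) *: delta_mx 0 i)) ->
  (forall u, (forall j, `|u 0 j| <= e) -> ~ A (y + u + t *: delta_mx 0 i)) ->
  forall u, (forall j, `|u 0 j| <= e) ->
    exists2 s, `|s| <= t & boundary A (y + u + s *: delta_mx 0 i).
Proof.
move=> t0 h1 h2 u ue.
pose pt s : 'rV[R]_d := y + u + s *: delta_mx 0 i.
have pt_le s s' : s <= s' -> forall j, pt s 0 j <= pt s' 0 j.
  by move=> ss j; rewrite !mxE lerD2l; case: (_ && _); rewrite ?mulr1 ?mulr0.
pose E := [set s | A (pt s)].
have Et : E (- t) by exact: h1.
have Elt s : E s -> s < t.
  move=> Es; rewrite ltNge; apply/negP => ts; apply: (h2 u ue).
  by apply: A_lower Es _; exact: pt_le.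
have Eub : has_ubound E by exists t => s /Elt/ltW.
have hE : has_sup E by split=> //; exists (- t).
exists (sup E).
  rewrite ler_norml (sup_upper_bound hE Et) /=.
  by apply: ge_sup => [|s /Elt/ltW //]; exists (- t).
apply/boundaryP; split=> [/lower_ball[e' e'0 h]|e' e'0].
  have : E (sup E + e').
    apply: h => j; rewrite !mxE -!addrA !lerD2l mulrDl lerD2l.
    by case: (_ && _); rewrite ?mulr1 ?mulr0 // ltW.
  by move=> /(sup_upper_bound hE); lra.
have [s Es sS] := sup_adherent e'0 hE.
apply: A_lower Es _ => j; rewrite !mxE -!addrA !lerD2l.
case: (_ && _); rewrite ?mulr1 ?mulr0; first exact: ltW.
by rewrite add0r oppr_le0 ltW.
Qed.

Definition normal_at q y := forall x, A x -> dot q x <= dot q y.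

Lemma dotDr q x y : dot q (x + y) = dot q x + dot q y.
Proof. by rewrite /dot -big_split; apply: eq_bigr => i _; rewrite mxE mulrDr. Qed.

Lemma dotZr q t y : dot q (t *: y) = t * dot q y.
Proof. by rewrite /dot mulr_sumr; apply: eq_bigr => i _; rewrite mxE mulrCA. Qed.

Lemma dotBr q x y : dot q (x - y) = dot q x - dot q y.
Proof. by rewrite dotDr -scaleN1r dotZr mulN1r. Qed.

Lemma dotC q x : dot q x = dot x q.
Proof. by apply: eq_bigr => i _; rewrite mulrC. Qed.

Lemma dotBl q x y : dot (x - y) q = dot x q - dot y q.
Proof. by rewrite ![dot _ q]dotC dotBr. Qed.

Lemma dotZl q t y : dot (t *: y) q = t * dot y q.
Proof. by rewrite ![dot _ q]dotC dotZr. Qed.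

Lemma dot_sub_scale x y t : dot (x - t *: y) (x - t *: y) =
  dot x x - 2 * t * dot y x + t * (t * dot y y).
Proof. rewrite dotBr dotZr !dotBl !dotZl [dot x y]dotC; ring. Qed.

Lemma dot_const q t : dot q (const_mx t) = (\sum_i q 0 i) * t.
Proof. by rewrite /dot mulr_suml; apply: eq_bigr => i _; rewrite mxE. Qed.

Lemma dot_delta q i : dot q (delta_mx 0 i) = q 0 i.
Proof.
rewrite /dot (bigD1 i) //= mxE !eqxx mulr1 big1 ?addr0 // => j /negPf ji.
by rewrite mxE ji andbF mulr0.
Qed.

Lemma normal_boundary q y x : normal_at q y -> boundary A x -> dot q x <= dot q y.
Proof.
move=> qy /boundaryP[_ h].
have e_le e : 0 < e -> dot q x - (\sum_i q 0 i) * e <= dot q y.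
  by move=> e0; have := qy _ (h e e0); rewrite dotDr dot_const mulrN.
apply/ler_addgt0Pr => e e0.
have [t /andP[t0 t1] tS] := small_factor (normr_ge0 (\sum_i q 0 i)) e0.
have := e_le t t0; have : (\sum_i q 0 i) * t <= e.
  by apply: le_trans tS; rewrite mulrC ler_wpM2l ?ler_norm // ltW.
lra.
Qed.

(** Going down the i-th axis stays in [A], and would increase [dot q] without bound if the i-th
    coordinate of [q] were negative. *)
Lemma normal_ge0 q y : boundary A y -> normal_at q y -> forall i, 0 <= q 0 i.
Proof.
move=> /boundaryP[_ h] qy i; rewrite leNgt; apply/negP => qi.
have Aa := h 1 ltr01; set a := y + _ in Aa.
pose t := (dot q y - dot q a + 1) / - q 0 i.
have t0 : 0 <= t.
  by rewrite divr_ge0 // ?oppr_ge0 ?(ltW qi) //; have := qy _ Aa; lra.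
have : A (a - t *: delta_mx 0 i).
  apply: A_lower Aa _ => j; rewrite !mxE gerDl oppr_le0.
  by case: (_ && _); rewrite ?mulr1 ?mulr0.
move=> /qy; rewrite dotBr dotZr dot_delta /t invrN mulrN mulNr divfK.
  by lra.
by rewrite lt_eqF.
Qed.

End LowerSets.

Lemma le0_small {R : realType} (a B t0 : R) : 0 <= B -> 0 < t0 ->
  (forall t, 0 < t <= t0 -> a <= t * B) -> a <= 0.
Proof.
move=> B0 t00 h; apply/ler_addgt0Pr => e e0; rewrite add0r.
have [x /andP[x0 x1] xB] := small_factor B0 e0.
have m0 : 0 < Num.min x t0 by rewrite lt_min x0.
apply: le_trans (h (Num.min x t0) _) _; first by rewrite m0 ge_min lexx orbT.
by apply: le_trans xB; rewrite ler_wpM2r // ge_min lexx.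
Qed.

(** * Normals from analytic functions vanishing on the boundary *)

Section Tangent.
Context {R : realType} {d : nat}.
Implicit Types (x y u h q : 'rV[R]_d) (s t e B : R) (K : 'rV[C R]_d -> C R)
  (c : mindex d -> C R).

Definition cexp y : 'rV[C R]_d := \row_i toC (expR (y 0 i)).

Lemma Im0_real (z : C R) : complex.Im z = 0 -> z = toC (complex.Re z).
Proof. by case: z => a b /= ->. Qed.

Lemma row_le_sum u i : `|u 0 i| <= \sum_j `|u 0 j|.
Proof. by rewrite (bigD1 i) //= lerDl sumr_ge0. Qed.

Lemma cexp_dif y : exists2 W, 1 <= W & forall h e, 0 <= e <= 1 / 2 ->
  (forall i, `|h 0 i| <= e) -> forall i,
  nrm (dif (cexp (y + h)) (cexp y) i) <= W * e /\
  nrm (dif (cexp (y + h)) (cexp y) i - toC (expR (y 0 i) * h 0 i)) <= W * e ^+ 2.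
Proof.
pose W := 1 + 2 * \sum_i expR (y 0 i).
have S0 : 0 <= \sum_i expR (y 0 i) by apply: sumr_ge0 => i _; exact: expR_ge0.
exists W => [|h e /andP[e0 e1] he i]; first by rewrite /W; lra.
have yW : 2 * expR (y 0 i) <= W.
  have : expR (y 0 i) <= \sum_i expR (y 0 i).
    by rewrite (bigD1 i) //= lerDl sumr_ge0 // => j _; exact: expR_ge0.
  by rewrite /W; lra.
have h12 : `|h 0 i| <= 1 / 2 by apply: le_trans (he i) _.
have /andP[t1 t2] := expR_taylor1 h12.
have hh : h 0 i ^+ 2 <= e ^+ 2.
  by rewrite -real_normK ?num_real // lerXn2r ?nnegrE.
have Ey : 0 <= expR (y 0 i) := expR_ge0 _.
rewrite /dif !mxE expRD -!toCB !nrm_toC.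
have -> : expR (y 0 i) * expR (h 0 i) - expR (y 0 i) =
  expR (y 0 i) * (expR (h 0 i) - 1) by ring.
rewrite -mulrBr !normrM !(ger0_norm Ey).
have b2 : `|expR (h 0 i) - 1 - h 0 i| <= 2 * e ^+ 2.
  by rewrite ger0_norm //; lra.
have ee : e ^+ 2 <= e / 2 by rewrite expr2 ler_wpM2l //; lra.
have b1 : `|expR (h 0 i) - 1| <= 2 * e.
  rewrite -[expR _ - 1](subrK (h 0 i)); apply: le_trans (ler_normD _ _) _.
  have := he i; lra.
split.
  apply: le_trans (ler_wpM2l Ey b1) _; rewrite mulrA [_ * 2]mulrC.
  by rewrite ler_wpM2r.
apply: le_trans (ler_wpM2l Ey b2) _; rewrite mulrA [_ * 2]mulrC.
by rewrite ler_wpM2r ?sqr_ge0.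
Qed.

Lemma cexp_near y e : 0 < e -> exists2 b, 0 < b & forall h,
  (forall i, `|h 0 i| <= b) -> near_box (fun=> e) (cexp (y + h)) (cexp y).
Proof.
move=> e0; have [W W1 hW] := cexp_dif y.
have W0 : 0 <= W by lra.
have [b /andP[b0 b1] bW] := small_factor W0 e0.
exists (b / 2) => [|h hb i]; first by rewrite divr_gt0.
have [|| + _] := hW h (b / 2) _ _ i => //; first by lra.
by move/le_trans; apply; apply: le_trans bW; rewrite mulrC ler_wpM2r //; lra.
Qed.

(** In the remainder, (W / r)^2 B comes from the expansion of [K], and S W from that of the
    exponentials. *)
Lemma cexp_taylor c p K y : ps c p K (cexp y) ->
  exists B b, [/\ 0 <= B, 0 < b & forall h e, 0 <= e <= b ->
    (forall i, `|h 0 i| <= e) ->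
    nrm (K (cexp (y + h)) - K (cexp y) -
      \sum_i c (munit i) * toC (expR (y 0 i) * h 0 i)) <= B * e ^+ 2].
Proof.
move=> /ps_min[r r0 KP]; have [B B0 hB] := ps_linear KP.
have [W W1 hW] := cexp_dif y; have W0 : 0 <= W by lra.
have [b /andP[b0 b1] bW] := small_factor W0 r0.
pose S := \sum_i nrm (c (munit i)).
have S0 : 0 <= S by apply: sumr_ge0 => i _; exact: nrm_ge0.
exists ((W / r) ^+ 2 * B + S * W), (b / 2); split.
- by rewrite addr_ge0 // mulr_ge0 // sqr_ge0.
- by rewrite divr_gt0.
move=> h e /andP[e0 eb] he.
have e12 : 0 <= e <= 1 / 2 by rewrite e0 /=; lra.
have hWe := hW h e e12 he.
have er1 : 0 <= W / r * e <= 1.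
  rewrite !mulr_ge0 ?invr_ge0 ?(ltW r0) //= mulrAC ler_pdivrMr // mul1r.
  by apply: le_trans bW; rewrite mulrC ler_wpM2r //; lra.
have := hB (W / r * e) (cexp (y + h)) er1 _ => /(_ _)/le_trans h1.
set z := cexp (y + h) in h1 hWe *; set w := cexp y in h1 hWe *.
have -> : K z - K w - \sum_i c (munit i) * toC (expR (y 0 i) * h 0 i) =
  (K z - K w - \sum_i c (munit i) * dif z w i) +
  \sum_i c (munit i) * (dif z w i - toC (expR (y 0 i) * h 0 i)).
  rewrite -[RHS]addrA; congr (_ + _); rewrite -sumrN -sumrN -big_split /=.
  by apply: eq_bigr => i _; ring.
apply: le_trans (nrmD _ _) _; rewrite mulrDl; apply: lerD.
  apply: h1; first by move=> i; have [] := hWe i; rewrite mulrAC divfK ?gt_eqF.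
  by rewrite exprMn mulrAC.
apply: le_trans (nrm_sum _ _ _) _; rewrite /S -mulrA mulr_suml; apply: ler_sum => i _.
by rewrite nrmM ler_wpM2l ?nrm_ge0 //; have [] := hWe i.
Qed.

Variable A : set 'rV[R]_d.
Hypothesis A_open : open A.
Hypothesis A_lower : forall x y, A x -> (forall i, y 0 i <= x 0 i) -> A y.
Hypotheses (A_nonempty : A !=set0) (A_proper : exists x, ~ A x).
Hypothesis A_convex : forall x y t, 0 <= t <= 1 -> A x -> A y ->
  A (t *: x + (1 - t) *: y).

Variables (c : mindex d -> C R) (p : 'I_d -> R) (K : 'rV[C R]_d -> C R) (y : 'rV[R]_d).
Hypotheses (y_bd : boundary A y) (K_ps : ps c p K (cexp y)).
Hypothesis K_zero : exists2 e, 0 < e & forall x, boundary A x ->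
  (forall i, `|x 0 i - y 0 i| <= e) -> K (cexp x) = 0.

(** The logarithmic gradient w_i dK/dw_i at w = exp y, whose class is dir(w) when K = H. *)
Let n i : C R := c (munit i) * toC (expR (y 0 i)).
Let N := \sum_i n i.

(** [K] vanishes at both points, so only the linear term at t u + s (1, ..., 1) and the remainder
    are left; the Lipschitz bound |s| <= |t| M makes the remainder O(t^2). *)
Lemma tangent_bound u : exists B t0, [/\ 0 <= B, 0 < t0 &
  forall t s, `|t| <= t0 -> boundary A (y + t *: u + const_mx s) ->
   nrm (toC t * (\sum_i n i * toC (u 0 i)) + toC s * N) <= B * t ^+ 2].
Proof.
have [e e0 Ke] := K_zero; have [B [b [B0 b0 hB]]] := cexp_taylor K_ps.
have Ky : K (cexp y) = 0 by apply: Ke => // i; rewrite subrr normr0 ltW.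
pose M := 1 + \sum_i `|u 0 i|.
have uM i : `|u 0 i| <= M by apply: le_trans (row_le_sum u i) _; rewrite lerDr.
have M0 : 0 < M by rewrite ltr_wpDr // sumr_ge0.
have m0 : 0 < Num.min e b by rewrite lt_min e0.
have M20 : 0 <= 2 * M by lra.
have [t0 /andP[t00 t01] t0M] := small_factor M20 m0.
exists (B * (2 * M) ^+ 2), t0; split=> //; first by rewrite mulr_ge0 ?sqr_ge0.
move=> t s tt bd.
have sM : `|s| <= `|t| * M.
  apply: boundary_lipschitz y_bd bd _ => // i.
  by rewrite mxE normrM ler_wpM2l.
pose h := t *: u + const_mx s.
have hE : y + t *: u + const_mx s = y + h by rewrite addrA.
have hM i : `|h 0 i| <= 2 * M * `|t|.
  rewrite !mxE; apply: le_trans (ler_normD _ _) _; rewrite normrM.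
  have : `|t| * `|u 0 i| <= `|t| * M by rewrite ler_wpM2l.
  lra.
have tmin : 2 * M * `|t| <= Num.min e b.
  by apply: le_trans t0M; rewrite mulrC ler_wpM2r.
move: tmin; rewrite le_min => /andP[te tb].
have Kh : K (cexp (y + h)) = 0.
  apply: Ke; first by rewrite -hE.
  by move=> i; rewrite mxE addrAC subrr add0r; apply: le_trans (hM i) te.
have := hB h (2 * M * `|t|) _ hM; rewrite tb mulr_ge0 ?normr_ge0 //= => /(_ isT).
rewrite Kh Ky subrr sub0r nrmN => /le_trans h1.
have -> : toC t * (\sum_i n i * toC (u 0 i)) + toC s * N =
   \sum_i c (munit i) * toC (expR (y 0 i) * h 0 i).
  rewrite /N !mulr_sumr -big_split /=; apply: eq_bigr => i _.
  by rewrite !mxE /n !(toCM, toCD); ring.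
by apply: h1; rewrite exprMn mulrA real_normK ?num_real.
Qed.

Hypothesis n_neq0 : exists i, c (munit i) != 0.

(** If [N] were 0, the shift s would drop out of [tangent_bound]; in the direction of the i-th axis,
    dividing by t would give n_i = 0. *)
Lemma tangent_sum_neq0 : N != 0.
Proof.
have [i ci] := n_neq0; apply/eqP => N0.
have ni : n i != 0.
  by rewrite mulf_neq0 // -nrm_eq0 nrm_toC normr_eq0 gt_eqF // expR_gt0.
have [B [t0 [B0 t00 hB]]] := tangent_bound (delta_mx 0 i).
suff : nrm (n i) <= 0 by rewrite leNgt nrm_gt0 ni.
apply: (le0_small B0 t00) => t /andP[t1 t2].
have [s bd] := boundary_shift A_open A_lower A_nonempty A_proper (y + t *: delta_mx 0 i).
have := hB t s _ bd; rewrite N0 mulr0 addr0 (bigD1 i) //= mxE !eqxx toC1 mulr1.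
rewrite big1 ?addr0; last first.
  by move=> j /negPf ji; rewrite mxE ji andbF toC0 mulr0.
rewrite nrmM nrm_toC gtr0_norm // => /(_ t2).
move=> h1; rewrite -(ler_pM2l t1); apply: le_trans h1 _.
by rewrite expr2 mulrC -mulrA.
Qed.

(** Dividing [tangent_bound] by t N leaves n_i / N + s / t = O(t) with s / t real, so the imaginary
    part of n_i / N is 0. *)
Lemma tangent_real : exists q, [/\ forall i, n i = N * toC (q 0 i),
  \sum_i q 0 i = 1 &
  forall u, exists B t0, [/\ 0 <= B, 0 < t0 & forall t s, `|t| <= t0 ->
    boundary A (y + t *: u + const_mx s) -> `|t * dot q u + s| <= B * t ^+ 2]].
Proof.
have N0 := tangent_sum_neq0; have nN : 0 < nrm N by rewrite nrm_gt0.
have real_i i : complex.Im (n i / N) = 0.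
  have [B [t0 [B0 t00 hB]]] := tangent_bound (delta_mx 0 i).
  apply/eqP; rewrite -normr_eq0 eq_le normr_ge0 andbT.
  have BN : 0 <= B / nrm N by rewrite divr_ge0 // ltW.
  apply: (le0_small BN t00) => t /andP[t1 t2].
  have [s bd] := boundary_shift A_open A_lower A_nonempty A_proper (y + t *: delta_mx 0 i).
  have := hB t s _ bd; rewrite (bigD1 i) //= mxE !eqxx toC1 mulr1.
  rewrite big1 ?addr0; last first.
    by move=> j /negPf ji; rewrite mxE ji andbF toC0 mulr0.
  have tC : toC t != 0 by rewrite -toC0 (inj_eq (@toC_inj R)) gt_eqF.
  have -> : toC t * n i + toC s * N = toC t * N * (n i / N + toC (s / t)).
    have sE : toC s = toC t * toC (s / t) by rewrite -toCM mulrC divfK // gt_eqF.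
    rewrite mulrDr -[toC t * N * (n i / N)]mulrA [N * (n i / N)]mulrCA divff // mulr1.
    by congr (_ + _); rewrite sE mulrAC.
  rewrite !nrmM nrm_toC gtr0_norm // => /(_ t2) h1.
  have -> : complex.Im (n i / N) = complex.Im (n i / N + toC (s / t)).
    by case: (n i / N) => a' b' /=; rewrite addr0.
  apply: le_trans (nrm_Im _) _.
  rewrite mulrA ler_pdivlMr // -(ler_pM2l t1) mulrCA mulrC.
  by apply: le_trans h1 _; rewrite expr2 mulrC mulrA.
pose q : 'rV[R]_d := \row_i complex.Re (n i / N).
have qE i : n i = N * toC (q 0 i).
  by rewrite mxE -(Im0_real (real_i i)) mulrC divfK.
exists q; split=> //.
  apply: toC_inj; rewrite toC1; apply: (mulfI N0); rewrite mulr1 toC_sum mulr_sumr.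
  by apply: eq_bigr => i _; rewrite -qE.
move=> u; have [B [t0 [B0 t00 hB]]] := tangent_bound u.
exists (B / nrm N), t0; split=> //; first by rewrite divr_ge0 // ltW.
move=> t s tt bd; have := hB t s tt bd.
have -> : toC t * (\sum_i n i * toC (u 0 i)) + toC s * N = N * toC (t * dot q u + s).
  rewrite toCD toCM /dot toC_sum mulrDr [toC s * N]mulrC; congr (_ + _).
  rewrite mulrCA; congr (_ * _); rewrite mulr_sumr; apply: eq_bigr => i _.
  by rewrite qE toCM mulrA.
by rewrite nrmM nrm_toC mulrC mulrAC ler_pdivlMr.
Qed.

(** Towards a point of [A] the boundary lies above the segment by convexity, so s >= 0 and t (q, x -
    y) <= B t^2. *)
Lemma tangent_normal q : (forall u, exists B t0, [/\ 0 <= B, 0 < t0 &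
    forall t s, `|t| <= t0 ->
    boundary A (y + t *: u + const_mx s) -> `|t * dot q u + s| <= B * t ^+ 2]) ->
  normal_at A q y.
Proof.
move=> hq x Ax; rewrite -subr_le0 -dotBr.
have [B [t0 [B0 t00 hB]]] := hq (x - y).
have m0 : 0 < Num.min t0 1 by rewrite lt_min t00 /=.
apply: (le0_small B0 m0) => t; rewrite le_min => /andP[t1 /andP[t2 t3]].
have [s bd] := boundary_shift A_open A_lower A_nonempty A_proper (y + t *: (x - y)).
have := hB t s _ bd; rewrite gtr0_norm // => /(_ t2).
(* For s < 0 the point y + s (1, ..., 1) is in [A], and its combination with [x] lies above the
   supposed boundary point, which would then be in [A]. *)
have s0 : 0 <= s.
  rewrite leNgt; apply/negP => sn.
  have [yn ye] := iffLR (boundaryP A_open A_lower _) y_bd.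
  have [nb _] := iffLR (boundaryP A_open A_lower _) bd; apply: nb.
  have s0 : 0 < - s by lra.
  have t01 : 0 <= t <= 1 by rewrite ltW.
  apply: A_lower (A_convex t01 Ax (ye _ s0)) _ => i; rewrite !mxE.
  have : 0 <= t * (- s) by rewrite mulr_ge0 // ltW.
  lra.
rewrite ler_norml => /andP[_ h1].
rewrite -(ler_pM2l t1); apply: (@le_trans _ _ (t * dot q (x - y) + s)); first by lra.
by apply: le_trans h1 _; rewrite expr2; rewrite le_eqVlt; apply/orP; left; apply/eqP; ring.
Qed.

End Tangent.

(** * Density of smooth points *)

Section SmoothPoints.
Context {R : realType} {d : nat}.
Implicit Types (x y u q : 'rV[R]_d) (s t e B : R) (f g h K : 'rV[C R]_d -> C R)
  (w z : 'rV[C R]_d).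

Lemma tcoefM f g w : analytic_at f w -> analytic_at g w ->
  tcoef (fun z => f z * g z) w = conv (tcoef f w) (tcoef g w).
Proof.
move=> fw gw; have [c [c' [e [e0 fP gP]]]] := analytic_common fw gw.
by rewrite (tcoefE (psM fP gP)) (tcoefE fP) (tcoefE gP).
Qed.

Lemma tcoef_near f g w : analytic_at f w -> analytic_at g w ->
  (exists2 e, 0 < e & forall z, near_box (fun=> e) z w -> f z = g z) ->
  tcoef f w = tcoef g w.
Proof.
move=> fw gw [e e0 fg]; have [e1 _ fP] := tcoefP fw; have [e2 _ gP] := tcoefP gw.
apply/funext => r; apply: (ps_uniq fP gP e0 _ r) => x xe; apply: fg => i.
by rewrite dif_shiftR nrm_toC; have /andP[x0 ?] := xe i; rewrite gtr0_norm.
Qed.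

Lemma tcoef0 f w : analytic_at f w -> tcoef f w mzero = f w.
Proof. by move=> /tcoefP[e _ /ps_center]. Qed.

Lemma near_box_sub e z w w' : near_box (fun=> e / 2) z w' ->
  near_box (fun=> e / 2) w' w -> near_box (fun=> e) z w.
Proof.
move=> zw' w'w i; rewrite -(dif_add z w w') (splitr e).
by apply: le_trans (nrmD _ _) _; apply: lerD; [exact: zw'|exact: w'w].
Qed.

Variable A : set 'rV[R]_d.
Hypothesis A_open : open A.
Hypothesis A_lower : forall x y, A x -> (forall i, y 0 i <= x 0 i) -> A y.
Hypotheses (A_nonempty : A !=set0) (A_proper : exists x, ~ A x).
Hypothesis A_convex : forall x y t, 0 <= t <= 1 -> A x -> A y ->
  A (t *: x + (1 - t) *: y).

Definition vanishes_near f y := exists2 e, 0 < e & forall x, boundary A x ->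
  (forall i, `|x 0 i - y 0 i| <= e) -> f (cexp x) = 0.

Lemma vanishes_at f y : boundary A y -> vanishes_near f y -> f (cexp y) = 0.
Proof. by move=> yb [e e0]; apply=> // i; rewrite subrr normr0 ltW. Qed.

(* [boundary A] projects onto a neighbourhood in the coordinates other than [i],
   so the remainder of the Weierstrass division vanishes. *)
Lemma vanishing_divides i f h y : boundary A y -> analytic_at f (cexp y) ->
  analytic_at h (cexp y) -> vanishes_near f y -> vanishes_near h y ->
  partial h i (cexp y) != 0 ->
  exists2 q, analytic_at q (cexp y) & exists2 e, 0 < e &
    forall z, near_box (fun=> e) z (cexp y) -> f z = q z * h z.
Proof.
move=> yb fw hw fv hv hi; set w := cexp y in fw hw hi *.
have [eh0 eh00 hP] := tcoefP hw.
rewrite (ps_partial i hP) in hi.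
have hn : exists j, tcoef h w (munit j) != 0 by exists i.
have [q [qn q1 qt]] := tangent_real A_open A_lower A_nonempty A_proper yb hP hv hn.
have qnorm := tangent_normal A_open A_lower A_nonempty A_proper A_convex yb qt.
have qi : 0 < q 0 i.
  rewrite lt_def (normal_ge0 A_open A_lower yb qnorm) andbT.
  apply: contra_neq hi => qi0; have := qn i; rewrite qi0 toC0 mulr0 => /eqP.
  rewrite mulf_eq0 => /orP[/eqP //|].
  by rewrite -nrm_eq0 nrm_toC normr_eq0 gt_eqF // expR_gt0.
have hw0 : h w = 0 by exact: vanishes_at yb hv.
have hi' : partial h i w != 0 by rewrite (ps_partial i hP).
have [Q [r [Qan ran [e1 e10 [fE rE]]]]] := weierstrass_division fw hw hw0 hi'.
exists Q => //.
have [er er0 rP] := tcoefP ran.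
suff [e2 e20 r0] : exists2 e2, 0 < e2 & forall x : 'I_d -> R,
    (forall i, 0 < x i <= e2) -> r (shiftR w x) = 0.
  have rc : tcoef r w = fun k : mindex d => if k == mzero then 0 else 0.
    apply/funext => k; apply: (ps_uniq rP (ps_cst w 0 (fun=> er0)) e20 _ k).
    exact: r0.
  have m0 : 0 < Num.min e1 er by rewrite lt_min e10.
  exists (Num.min e1 er) => // z zw; rewrite fE.
    rewrite rc in rP; rewrite (ps_val rP (ps_cst w 0 (fun=> er0))) ?addr0 //.
    by move=> j; apply: le_trans (zw j) _; rewrite ge_min lexx orbT.
  by move=> j; apply: le_trans (zw j) _; rewrite ge_min lexx.
have [ef ef0 fv'] := fv; have [eh eh1 hv'] := hv.
have [b1 b10 nb] := cexp_near y e10.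
pose b := Num.min b1 (Num.min ef eh).
have b0 : 0 < b by rewrite !lt_min b10 ef0 eh1.
have [B [t0 [B0 t00 qB]]] := qt (delta_mx 0 i).
have q2 : 0 < q 0 i / 2 by rewrite divr_gt0.
have [t1 /andP[t10 _] t1B] := small_factor B0 q2.
(* Small enough for the quadratic error B t^2 to be at most half of the linear term t q_i. The
   boundary then passes below y + t e_i and above y - t e_i by at least t q_i / 2 along (1, ..., 1),
   and crosses all nearby lines parallel to the i-th axis. *)
pose t := Num.min t1 (Num.min t0 (b / 2)).
have t_gt0 : 0 < t by rewrite !lt_min t10 t00 divr_gt0.
have tt0 : t <= t0 by rewrite !ge_min lexx !orbT.
have tb : t <= b / 2 by rewrite !ge_min lexx !orbT.
have tB : t * B <= q 0 i / 2.
  by apply: le_trans t1B; rewrite ler_wpM2r // ge_min lexx.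
have tq : t * (t * B) <= t * (q 0 i / 2) by rewrite ler_wpM2l // ltW.
have [sp bp] := boundary_shift A_open A_lower A_nonempty A_proper (y + t *: delta_mx 0 i).
have [sm bm] := boundary_shift A_open A_lower A_nonempty A_proper (y + (- t) *: delta_mx 0 i).
have tq0 : 0 < t * q 0 i by rewrite mulr_gt0.
have sp1 : sp <= - (t * q 0 i / 2).
  have := qB t sp _ bp; rewrite gtr0_norm // dot_delta => /(_ tt0).
  by rewrite ler_norml expr2 => /andP[_]; lra.
have sm1 : t * q 0 i / 2 <= sm.
  have := qB (- t) sm _ bm; rewrite normrN gtr0_norm // dot_delta => /(_ tt0).
  by rewrite ler_norml sqrrN expr2 => /andP[+ _]; lra.
pose dl := Num.min (t * q 0 i / 4) (b / 2).
have dl0 : 0 < dl by rewrite lt_min !divr_gt0.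
have dltq : dl <= t * q 0 i / 4 by rewrite ge_min lexx.
have dlb : dl <= b / 2 by rewrite ge_min lexx orbT.
have sec : forall u, (forall j, `|u 0 j| <= dl) ->
    exists2 s, `|s| <= t & boundary A (y + u + s *: delta_mx 0 i).
  apply: boundary_section => // u ul.
    apply: (boundary_lt A_open A_lower bm) => j; rewrite !mxE.
    by have := ul j; rewrite ler_norml => /andP[_ ?]; lra.
  have [nb' _] := iffLR (boundaryP A_open A_lower _) bp => Au; apply: nb'.
  apply: A_lower Au _ => j; rewrite !mxE.
  by have := ul j; rewrite ler_norml => /andP[? _]; lra.
have dly j : 0 < dl * expR (y 0 j) by rewrite mulr_gt0 // expR_gt0.
have [e2 e20 e2y] := exists_lt_all dly.
exists (Num.min e2 e1) => [|x xe']; first by rewrite lt_min e20.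
have xe1 j : 0 < x j <= e1.
  by have /andP[-> h1] := xe' j; rewrite (le_trans h1) // ge_min lexx orbT.
have xe j : 0 < x j <= e2.
  by have /andP[-> h1] := xe' j; rewrite (le_trans h1) // ge_min lexx.
(* Chosen so that exp (y + u) agrees with w + x outside the i-th coordinate, on which the remainder
   does not depend. *)
pose u : 'rV[R]_d := \row_j (if j == i then 0 else ln (1 + x j / expR (y 0 j))).
have xy0 j : 0 < x j / expR (y 0 j).
  by have /andP[x0 _] := xe j; rewrite divr_gt0 // expR_gt0.
have udl j : `|u 0 j| <= dl.
  rewrite mxE; case: eqP => _; first by rewrite normr0 ltW.
  rewrite ger0_norm; last by rewrite ln_ge0 // lerDl ltW.
  apply: le_trans (_ : x j / expR (y 0 j) <= _).
    by apply: le_ln1Dx; apply: lt_trans (xy0 j); rewrite ltrN10.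
  rewrite ler_pdivrMr ?expR_gt0 //; have /andP[_ h1] := xe j.
  exact: le_trans h1 (e2y j).
have [s st bd] := sec u udl.
pose hh := u + s *: delta_mx 0 i.
have hhE : y + u + s *: delta_mx 0 i = y + hh by rewrite /hh addrA.
have hhb j : `|hh 0 j| <= b.
  rewrite !mxE; apply: le_trans (ler_normD _ _) _; have := udl j; rewrite mxE => h1.
  have : `|s * ((0 == 0 :> 'I_1) && (j == i))%:R| <= t.
    by case: (_ && _); rewrite ?mulr1 ?mulr0 // normr0 ltW.
  lra.
have yE j : (y + hh) 0 j - y 0 j = hh 0 j by rewrite mxE addrAC subrr add0r.
rewrite hhE in bd.
have fz : f (cexp (y + hh)) = 0.
  by apply: fv' => // j; rewrite yE (le_trans (hhb j)) // !ge_min lexx !orbT.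
have hz : h (cexp (y + hh)) = 0.
  by apply: hv' => // j; rewrite yE (le_trans (hhb j)) // !ge_min lexx !orbT.
have nbz : near_box (fun=> e1) (cexp (y + hh)) w.
  by apply: nb => j; rewrite (le_trans (hhb j)) // !ge_min lexx.
have := fE _ nbz; rewrite fz hz mulr0 add0r => /esym <-.
apply: rE => // [j|j ji].
  rewrite dif_shiftR nrm_toC; have /andP[x0 h1] := xe1 j.
  by rewrite gtr0_norm.
rewrite !mxE (negPf ji) andbF mulr0 addr0 expRD -toCD; congr toC.
rewrite lnK; last by rewrite posrE addr_gt0.
by rewrite mulrDr mulr1 [expR _ * (_ / _)]mulrC divfK // gt_eqF // expR_gt0.
Qed.

Variable H : 'rV[C R]_d -> C R.
Hypotheses (H_analytic : forall y, boundary A y -> analytic_at H (cexp y))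
  (H_zero : forall y, boundary A y -> H (cexp y) = 0)
  (H_sqfree : forall y, boundary A y -> germ_squarefree (cexp y) H)
  (H_neq0 : forall y, A y -> H (cexp y) != 0).

(* At a nonzero Taylor coefficient of least degree along the boundary near [y0],
   a derivative [h] of [H] one order lower vanishes on the boundary but has a
   nonzero gradient; if all gradients of [H] vanished, [h ^+ 2] would divide [H]. *)
Lemma smooth_points_dense y0 e : boundary A y0 -> 0 < e ->
  exists y, [/\ boundary A y, forall i, `|y 0 i - y0 0 i| < e &
    exists i, tcoef H (cexp y) (munit i) != 0].
Proof.
move=> y0b e0; apply: contrapT => bad.
have {}bad y i : boundary A y -> (forall j, `|y 0 j - y0 0 j| < e) ->
    tcoef H (cexp y) (munit i) = 0.
  move=> yb ye; apply/eqP; apply: contrapT => /negP ci; apply: bad.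
  by exists y; split=> //; exists i.
pose P n := `[< exists y al, [/\ boundary A y, forall j, `|y 0 j - y0 0 j| < e,
   mdeg al = n & tcoef H (cexp y) al != 0] >].
(* Otherwise all Taylor coefficients at [y0] vanish and [H] is 0 nearby, although it is nonzero at
   points of [A] arbitrarily close. *)
have exP : exists n, P n.
  apply: contrapT => nP.
  have c0 : tcoef H (cexp y0) = fun k : mindex d => if k == mzero then 0 else 0.
    apply/funext => k; rewrite if_same; apply/eqP; apply: contrapT => /negP ck.
    apply: nP; exists (mdeg k); apply/asboolP; exists y0, k; split=> // j.
    by rewrite subrr normr0.
  have [r r0 HP] := tcoefP (H_analytic y0b).
  have [b b0 nb] := cexp_near y0 r0.
  have [_ hA] := iffLR (boundaryP A_open A_lower _) y0b.
  have := H_neq0 (hA b b0); rewrite c0 in HP.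
  rewrite (ps_val HP (ps_cst _ 0 (fun=> r0))) ?eqxx //.
  by apply: nb => i; rewrite mxE normrN gtr0_norm.
case: (ex_minnP exP) => n /asboolP[y [al [yb ye aln aln0]]] nmin.
have n0 : (0 < n)%N.
  rewrite lt0n -aln mdeg_eq0; apply: contra_neq aln0 => ->.
  by rewrite tcoef0; [exact: H_zero | exact: H_analytic].
rewrite -aln in n0; have [i [be alE]] := mdeg_gt0 n0.
have ben : (mdeg be < n)%N by rewrite -aln alE mdeg_add mdeg_unit addn1.
have [eta eta0 etae] : exists2 eta, 0 < eta & forall x,
    (forall j, `|x 0 j - y 0 j| <= eta) -> forall j, `|x 0 j - y0 0 j| < e.
  have ye' j : 0 < e - `|y 0 j - y0 0 j| by rewrite subr_gt0.
  have [eta eta0 h] := exists_lt_all ye'; exists (eta / 2) => [|x xy j].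
    by rewrite divr_gt0.
  rewrite -[x 0 j](subrK (y 0 j)) -addrA; apply: le_lt_trans (ler_normD _ _) _.
  by have := xy j; have := h j; lra.
set w := cexp y in aln0.
have [eh eh0 HP] := tcoefP (H_analytic yb).
pose h z := tcoef H z be.
have [p hP] := tcoef_ps be HP; rewrite -/w -/h in hP.
have han : analytic_at h w by apply/analytic_atP; do 2 eexists; exact: hP.
(* A nonzero value would be a nonzero coefficient of degree below the least one [n]. *)
have hv : vanishes_near h y.
  exists eta => // x xb xe; apply/eqP; apply: contrapT => /negP hx.
  have := nmin (mdeg be); rewrite leqNgt ben => /(_ _)/negP; apply => //.
  apply/asboolP; exists x, be; split=> //; exact: etae.
have hi : partial h i w != 0.
  rewrite (ps_partial i hP) maddC -alE mulf_neq0 // pnatr_eq0 -lt0n.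
  by rewrite alE maddC mbin_addl.
have Hv : vanishes_near H y by exists eta => // x xb _; exact: H_zero.
have [q qan [e1 e10 Hq]] := vanishing_divides yb (H_analytic yb) han Hv hv hi.
(* On the boundary [h] is 0, so Leibniz's rule reduces the i-th derivative of H = q h to q times
   that of h. The former vanishes by assumption, the latter is nonzero near [y] by continuity. *)
have qv : vanishes_near q y.
  have [p' hiP] := tcoef_ps (munit i) hP.
  have hiw : tcoef h w (munit i) != 0 by rewrite (tcoefE hP) -(ps_partial i hP).
  have [e3 e30 hi3] := ps_neq0_near hiP hiw.
  have [e4 e40 q4] := analytic_near qan.
  have [e5 e50 h5] := analytic_near han.
  pose r := Num.min (e1 / 2) (Num.min e3 (Num.min e4 e5)).
  have r0 : 0 < r by rewrite !lt_min divr_gt0 // e30 e40.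
  have [b b0 nb] := cexp_near y r0.
  have [ev ev0 hv'] := hv.
  have m0 : 0 < Num.min (Num.min b ev) eta by rewrite !lt_min b0 ev0.
  exists (Num.min (Num.min b ev) eta) => // x xb xm.
  have xy : x = y + (x - y) by rewrite addrC subrK.
  have xw : near_box (fun=> r) (cexp x) w.
    rewrite xy; apply: nb => j; rewrite mxE [(- y) 0 j]mxE.
    by apply: le_trans (xm j) _; rewrite !ge_min lexx.
  have xin r' : r <= r' -> near_box (fun=> r') (cexp x) w.
    by move=> rr' j; apply: le_trans (xw j) _.
  have qx : analytic_at q (cexp x) by apply/q4/xin; rewrite !ge_min lexx !orbT.
  have hx : analytic_at h (cexp x) by apply/h5/xin; rewrite !ge_min lexx !orbT.
  have e12 : 0 < e1 / 2 by rewrite divr_gt0.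
  have HE : tcoef H (cexp x) = conv (tcoef q (cexp x)) (tcoef h (cexp x)).
    rewrite -tcoefM //; apply: tcoef_near.
    - exact: H_analytic.
    - exact: analyticM.
    - exists (e1 / 2) => // z zx; apply: Hq; apply: near_box_sub zx _.
      by apply: xin; rewrite ge_min lexx.
  have := bad x i xb (etae x _); rewrite HE conv_unit.
  rewrite (tcoef0 hx) hv' // => [|j]; last first.
    by apply: le_trans (xm j) _; rewrite !ge_min lexx !orbT.
  rewrite mulr0 addr0 (tcoef0 qx) => h0.
  have /eqP : q (cexp x) * tcoef h (cexp x) (munit i) = 0.
    by apply: h0 => j; apply: le_trans (xm j) _; rewrite !ge_min lexx !orbT.
  rewrite mulf_eq0 => /orP[/eqP //|]; rewrite (negPf (hi3 _ _)) //.
  by apply: xin; rewrite !ge_min lexx !orbT.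
have [q2 q2an [e2 e20 qq]] := vanishing_divides yb qan han qv hv hi.
suff : h (cexp y) != 0 by rewrite (vanishes_at yb hv) eqxx.
apply: (H_sqfree yb han).
exists q2 => //; apply/near_boxP; exists (Num.min e1 e2) => [|z zw].
  by rewrite lt_min e10.
rewrite Hq => [|j]; last by apply: le_trans (zw j) _; rewrite ge_min lexx.
rewrite qq => [|j]; last by apply: le_trans (zw j) _; rewrite ge_min lexx orbT.
by rewrite expr2 mulrA.
Qed.

End SmoothPoints.

(** * Convex hulls of compact sets of normals *)

Section ConvexHull.
Context {R : realType} {d : nat}.
Implicit Types (u v q b : 'rV[R]_d) (t : R).
Variable L : set 'rV[R]_d.
Hypothesis L_sum1 : forall q, L q -> \sum_i q 0 i = 1.

Definition combo n v := exists (u : 'I_n -> 'rV[R]_d) (c : 'I_n -> R),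
  [/\ forall k, L (u k), forall k, 0 <= c k & v = \sum_(k < n) c k *: u k].

(** Convex combinations of k + 1 points of [L], built by iterated joins so that each stage is a
    continuous image of a product of compact sets. *)
Fixpoint simplex k : set 'rV[R]_d :=
  if k is k'.+1 then
    (fun x : (R * 'rV[R]_d) * 'rV[R]_d => x.1.1 *: x.1.2 + (1 - x.1.1) *: x.2) @`
      ((`[0, 1]%classic `*` L) `*` simplex k')
  else L.

Definition tot v := \sum_i v 0 i.

Lemma totD u v : tot (u + v) = tot u + tot v.
Proof. by rewrite /tot -big_split; apply: eq_bigr => i _; rewrite mxE. Qed.

Lemma totZ t v : tot (t *: v) = t * tot v.
Proof. by rewrite /tot mulr_sumr; apply: eq_bigr => i _; rewrite mxE. Qed.

Lemma tot_sum n (c : 'I_n -> R) (u : 'I_n -> 'rV[R]_d) : (forall k, L (u k)) ->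
  tot (\sum_(k < n) c k *: u k) = \sum_(k < n) c k.
Proof.
move=> Lu; rewrite /tot; under eq_bigr do rewrite summxE.
rewrite exchange_big /=; apply: eq_bigr => k _.
by under eq_bigr do rewrite mxE; rewrite -mulr_sumr L_sum1 // mulr1.
Qed.

Lemma simplex_tot k v : simplex k v -> tot v = 1.
Proof.
elim: k v => [|k IH] v; first exact: L_sum1.
move=> [[[t q] b] /= [[_ Lq] kb] <-].
by rewrite totD !totZ (IH _ kb) /tot L_sum1 //; ring.
Qed.

Lemma simplex_nonempty k : L !=set0 -> simplex k !=set0.
Proof.
move=> [q Lq]; elim: k => [|k [b kb]]; first by exists q.
exists (0 *: q + (1 - 0) *: b), ((0, q), b) => //=.
by split=> //; split=> //=; rewrite in_itv /= lexx ler01.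
Qed.

Lemma combo_cons n t q v : L q -> 0 <= t -> combo n v -> combo n.+1 (t *: q + v).
Proof.
move=> Lq t0 [u [c [Lu c0 ->]]].
exists (fun k => if unlift ord0 k is Some j then u j else q).
exists (fun k => if unlift ord0 k is Some j then c j else t).
split=> [k|k|].
- by case: (unlift ord0 k).
- by case: (unlift ord0 k).
- rewrite big_ord_recl unlift_none; congr (_ + _).
  by apply: eq_bigr => k _; rewrite liftK.
Qed.

Lemma comboZ n t v : 0 <= t -> combo n v -> combo n (t *: v).
Proof.
move=> t0 [u [c [Lu c0 ->]]]; exists u, (fun k => t * c k); split=> // [k|].
  by rewrite mulr_ge0.
by rewrite scaler_sumr; apply: eq_bigr => k _; rewrite scalerA.
Qed.

Lemma simplex_combo k v : simplex k v -> combo k.+1 v.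
Proof.
elim: k v => [|k IH] v.
  move=> Lv; exists (fun=> v), (fun=> 1); split=> //.
  by rewrite big_ord1 scale1r.
move=> [[[t q] b] /= [[t01 Lq] kb] <-].
move: t01; rewrite /= in_itv /= => /andP[t0 t1].
by apply: combo_cons => //; apply: comboZ; [rewrite subr_ge0|exact: IH].
Qed.

Lemma combo_simplex k v : combo k.+1 v -> tot v = 1 -> simplex k v.
Proof.
elim: k v => [|k IH] v [u [c [Lu c0 vE]]] v1.
  have := v1; rewrite vE tot_sum // big_ord1 => c1.
  by rewrite /= big_ord1 c1 scale1r.
have := v1; rewrite vE tot_sum // big_ord_recl => c1.
have s0 : 0 <= \sum_(j < k.+1) c (lift ord0 j) by apply: sumr_ge0.
have t1 : c ord0 <= 1 by lra.
have t01 : `[0, 1]%classic (c ord0) by rewrite /= in_itv /= c0.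
rewrite [X in simplex _ X]big_ord_recl /=.
(* The other coefficients then vanish, and any point of the smaller simplex may be joined with
   weight 0. *)
have [ce1|cn1] := eqVneq (c ord0) 1.
  have [b kb] : simplex k !=set0 by apply: simplex_nonempty; exists (u ord0).
  exists ((c ord0, u ord0), b) => //=; rewrite ce1 subrr scale0r addr0.
  rewrite big1 ?addr0 // => j _.
  have : \sum_(j < k.+1) c (lift ord0 j) = 0 by lra.
  by move/psumr_eq0P => -> //; rewrite ?scale0r.
have d0 : 0 < 1 - c ord0 by rewrite subr_gt0 lt_neqAle cn1.
pose b := (1 - c ord0)^-1 *: \sum_(j < k.+1) c (lift ord0 j) *: u (lift ord0 j).
exists ((c ord0, u ord0), b) => /=; last by rewrite scalerA divff ?gt_eqF // scale1r.
split=> //; apply: IH.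
  apply: comboZ; first by rewrite invr_ge0 ltW.
  by exists (fun j => u (lift ord0 j)), (fun j => c (lift ord0 j)).
rewrite totZ tot_sum //; have -> : \sum_(j < k.+1) c (lift ord0 j) = 1 - c ord0 by lra.
by rewrite mulVf // gt_eqF.
Qed.

(** Carathéodory's theorem for cones: n + 1 vectors are linearly dependent, and a multiple of the
    dependence removes one of them. *)
Lemma caratheodory n v : (d <= n)%N -> combo n.+1 v -> combo n v.
Proof.
move=> dn [u [c [Lu c0 vE]]].
pose M : 'M[R]_(n.+1, d) := \matrix_(k, i) u k 0 i.
have [l [l0 lM]] : exists l : 'I_n.+1 -> R, (exists k, l k != 0) /\ \sum_k l k *: u k = 0.
  have kM : kermx M != 0.
    rewrite -mxrank_eq0 mxrank_ker subn_eq0 -ltnNge.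
    by apply: leq_ltn_trans (rank_leq_col M) _; rewrite ltnS.
  have [i [j ij]] : exists i j, kermx M i j != 0.
    apply: contrapT => nex; case/eqP: kM; apply/matrixP => i j; rewrite [RHS]mxE.
    by apply/eqP; apply: contrapT => /negP h; apply: nex; exists i, j.
  exists (fun k => kermx M i k); split; first by exists j.
  apply/rowP => a; have := congr1 (fun N : 'M[R]_(n.+1, d) => N i a) (mulmx_ker M).
  rewrite mxE [RHS]mxE => h; rewrite summxE [RHS]mxE -[RHS]h.
  by apply: eq_bigr => k _; rewrite mxE [M k a]mxE.
wlog [k1 k1P] : l l0 lM / exists k, 0 < l k.
  move=> H; have [k lk] := l0; have [lk0|lk0|lk0] := ltgtP (l k) 0.
  - apply: (H (fun k => - l k)); last by exists k; rewrite oppr_gt0.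
      by exists k; rewrite oppr_eq0.
    by under eq_bigr do rewrite scaleNr; rewrite sumrN lM oppr0.
  - by apply: (H l) => //; exists k.
  - by rewrite lk0 eqxx in lk.
(* The smallest ratio over the positive [l k] is the largest multiple that keeps all coefficients
   nonnegative, and it cancels the k-th one. *)
have [k kP kmin] := @arg_minP _ _ 'I_n.+1 k1 (fun k => 0 < l k) (fun k => c k / l k) k1P.
pose r := c k / l k.
have c'0 j : 0 <= c j - r * l j.
  have r0 : 0 <= r by rewrite divr_ge0 // ltW.
  have [lj|lj] := ltP 0 (l j).
    by rewrite subr_ge0 -ler_pdivlMr //; exact: kmin.
  have : r * l j <= 0 by rewrite mulr_ge0_le0.
  by have := c0 j; lra.
exists (fun j => u (lift k j)), (fun j => c (lift k j) - r * l (lift k j)); split=> //.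
have -> : v = \sum_(j < n.+1) (c j - r * l j) *: u j.
  under eq_bigr do rewrite scalerBl -scalerA.
  by rewrite sumrB -scaler_sumr lM scaler0 subr0.
by rewrite (@bigD1_ord _ _ _ n.+1 k) //= /r divfK ?gt_eqF // subrr scale0r add0r.
Qed.

Hypothesis L_compact : compact L.

Lemma simplex_compact k : compact (simplex k).
Proof.
elim: k => [|k IH] //=; apply: continuous_compact; last first.
  by apply: compact_setX => //; apply: compact_setX => //; exact: segment_compact.
apply: continuous_subspaceT => x.
apply: cvgD.
  apply: cvgZ; first by apply: cvg_comp; [exact: cvg_fst|exact: cvg_fst].
  by apply: cvg_comp; [exact: cvg_fst|exact: cvg_snd].
apply: cvgZ; last exact: cvg_snd.
apply: cvgB; first exact: cvg_cst.
by apply: cvg_comp; [exact: cvg_fst|exact: cvg_fst].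
Qed.

Lemma dot_continuous (v : 'rV[R]_d) : continuous (fun b : 'rV[R]_d => dot (v - b) (v - b)).
Proof.
apply: continuous_big => [|i _ b]; first exact: add_continuous.
have h : (fun b : 'rV[R]_d => (v - b) 0 i) b' @[b' --> b] --> (v - b) 0 i.
  rewrite mxE [(- b) 0 i]mxE.
  have -> : (fun b : 'rV[R]_d => (v - b) 0 i) = (fun b : 'rV[R]_d => v 0 i - b 0 i).
    by apply/funext => b'; rewrite !mxE.
  apply: cvgB; [exact: nbhs_filter| |exact: coord_continuous].
  exact: (@cvg_cst R (v 0 i) _ _ (nbhs_filter b)).
by apply: cvgM; [exact: nbhs_filter|exact: h|exact: h].
Qed.

(* The point of the hull closest to [v] is [v] itself. *)
Lemma hull_of_support v : tot v = 1 -> (0 < d)%N ->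
  (forall u, exists2 q, L q & dot v u <= dot q u) -> combo d v.
Proof.
move=> v1 d0 hv; have dE : d = d.-1.+1 by rewrite prednK.
have L0 : L !=set0 by have [q Lq _] := hv 0; exists q.
have cf : {within simplex d.-1, continuous (fun b => dot (v - b) (v - b))}.
  by apply: continuous_subspaceT; exact: dot_continuous.
have [b bX bmin] := compact_EVT_min (simplex_nonempty d.-1 L0) (@simplex_compact d.-1) cf.
rewrite inE in bX.
have bC := simplex_combo bX; rewrite -dE in bC.
have [<-//|bv] := eqVneq b v; exfalso.
have [q Lq hq] := hv (v - b).
have E0 : 0 < dot (v - b) (v - b).
  rewrite lt_def sumr_ge0 ?andbT => [|i _]; last by rewrite -expr2 sqr_ge0.
  apply: contra_neq bv => /psumr_eq0P h; apply/rowP => i; apply/eqP.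
  rewrite eq_sym -subr_eq0 -sqrf_eq0 expr2.
  by have := h _ i; rewrite !mxE => -> // j _; rewrite -expr2 sqr_ge0.
have D0 : 0 <= dot (q - b) (q - b).
  by apply: sumr_ge0 => i _; rewrite -expr2 sqr_ge0.
have [t /andP[t0 t1] tD] := small_factor D0 E0.
pose bt := t *: q + (1 - t) *: b.
have btX : simplex d.-1.+1 bt.
  by exists ((t, q), b) => //; split=> //; split=> //=; rewrite in_itv /= ltW.
have b1 := simplex_tot bX.
(* A step from [b] towards [q] uses one point too many; Carathéodory brings it back into the set on
   which [b] is the closest point to [v]. *)
have btC : simplex d.-1 bt.
  apply: combo_simplex; last by rewrite totD !totZ b1 /tot L_sum1 //; ring.
  by apply: caratheodory; [rewrite prednK|exact: simplex_combo btX].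
have := bmin bt; rewrite inE => /(_ btC).
have -> : v - bt = (v - b) - t *: (q - b).
  by rewrite /bt scalerBl scale1r scalerBr; apply/rowP => i; rewrite !mxE; ring.
set x := v - b in hq E0 tD *; set y := q - b in D0 tD *.
rewrite dot_sub_scale.
have xy : dot x x <= dot y x.
  by rewrite {1}/x /y !dotBl lerD2r.
have : t * (t * dot y y) <= t * dot x x by rewrite ler_wpM2l // ltW.
have : t * dot x x <= t * dot y x by rewrite ler_wpM2l // ltW.
have : 0 < t * dot x x by rewrite mulr_gt0.
lra.
Qed.

End ConvexHull.

(** * Normals at arbitrary boundary points from limits of good ones *)

Section LimitNormals.
Context {R : realType} {d : nat}.
Implicit Types (x y u v q : 'rV[R]_d) (s t e : R).
Variable A : set 'rV[R]_d.
Hypothesis A_open : open A.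
Hypothesis A_lower : forall x y, A x -> (forall i, y 0 i <= x 0 i) -> A y.
Hypotheses (A_nonempty : A !=set0) (A_proper : exists x, ~ A x).

(** To be instantiated by smooth boundary points with their normals of sum 1. *)
Variable good : 'rV[R]_d -> 'rV[R]_d -> Prop.
Hypothesis good_normal : forall y q, good y q ->
  [/\ boundary A y, tot q = 1, nonneg q & normal_at A q y].
Hypothesis good_dense : forall y e, boundary A y -> 0 < e ->
  exists y' q, good y' q /\ forall i, `|y' 0 i - y 0 i| < e.

Definition limit_normals x : set 'rV[R]_d := [set q | forall e, 0 < e ->
  exists y q', [/\ good y q', forall i, `|y 0 i - x 0 i| < e &
    forall i, `|q' 0 i - q 0 i| < e]].

Lemma limit_normals_nonneg x q : limit_normals x q -> nonneg q.
Proof.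
move=> Lq i; apply/ler_addgt0Pr => e e0.
have [y [q' [/good_normal[_ _ q'0 _] _ q'q]]] := Lq e e0.
by have := q'q i; have := q'0 i; rewrite ltr_norml => ? /andP[_ ?]; lra.
Qed.

Lemma limit_normals_sum1 x q : limit_normals x q -> tot q = 1.
Proof.
move=> Lq; apply/eqP; rewrite -subr_eq0 -normr_eq0 eq_le normr_ge0 andbT.
apply: (@le0_small _ _ d%:R 1) => // t /andP[t0 _].
have [y [q' [/good_normal[_ q'1 _ _] _ q'q]]] := Lq t t0.
rewrite -[X in `|_ - X|]q'1.
rewrite /tot -sumrB; apply: le_trans (ler_norm_sum _ _ _) _.
apply: (@le_trans _ _ (\sum_(i < d) t)).
  by apply: ler_sum => i _; rewrite distrC ltW.
by rewrite sumr_const card_ord mulr_natr.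
Qed.

Lemma limit_normals_compact x : compact (limit_normals x).
Proof.
apply: (@subclosed_compact _ _ [set q : 'rV[R]_d | forall i, `[0, 1]%classic (q 0 i)]).
- move=> q clq e e0; have e2 : 0 < e / 2 by rewrite divr_gt0.
  have /clq[q1 [Lq1 q1q]] : nbhs q [set z : 'rV[R]_d | forall i, `|z 0 i - q 0 i| < e / 2].
    by apply/nbhs_rowR; exists (e / 2).
  have [y [q' [gy yx q'q1]]] := Lq1 _ e2.
  exists y, q'; split=> // i; first by apply: lt_le_trans (yx i) _; lra.
  rewrite (splitr e) -(subrKA (q1 0 i)); apply: le_lt_trans (ler_normD _ _) _.
  by apply: ltrD; [exact: q'q1|exact: q1q].
- by apply: (@rV_compact R d (fun=> `[0, 1]%classic)) => i; exact: segment_compact.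
- move=> q Lq i /=; rewrite in_itv /= (limit_normals_nonneg Lq) /=.
  rewrite -(limit_normals_sum1 Lq) /tot (bigD1 i) //= lerDl sumr_ge0 // => j _.
  exact: limit_normals_nonneg Lq j.
Qed.

(* [y] is taken close to [x + t u] up to a multiple of [(1, ..., 1)], which all
   normals of total 1 pair with alike; then [dot (q - v) (y - x) >= 0]. *)
Lemma approx_support x v u e : boundary A x -> nonneg v -> tot v = 1 ->
  normal_at A v x -> 0 < e ->
  exists y q, [/\ good y q, forall i, `|y 0 i - x 0 i| < e & dot v u <= dot q u + e].
Proof.
move=> xb v0 v1 vx e0.
pose M := 1 + \sum_i `|u 0 i|.
have uM i : `|u 0 i| <= M by apply: le_trans (row_le_sum u i) _; rewrite lerDr.
have M0 : 0 < M by rewrite ltr_wpDr // sumr_ge0 //.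
pose t := e / (4 * M).
have t0 : 0 < t by rewrite divr_gt0 // mulr_gt0.
have tM : t * M = e / 4 by rewrite /t invfM mulrA divfK // gt_eqF.
have [s bd] := boundary_shift A_open A_lower A_nonempty A_proper (x + t *: u).
have sM : `|s| <= t * M.
  apply: (boundary_lipschitz A_open A_lower xb bd) => i.
  by rewrite mxE normrM (gtr0_norm t0) ler_wpM2l // ltW.
(* The shifts t u, s (1, ..., 1) and the approximation each contribute e / 4 to the distance from
   [x]. The pairings with [r] add an error of at most 2 e' <= t e, which becomes [e] after division
   by t. *)
pose e' := Num.min (e / 4) (t * e / 2).
have e'0 : 0 < e' by rewrite lt_min !divr_gt0 // mulr_gt0.
have e'4 : e' <= e / 4 by rewrite ge_min lexx.
have e't : e' <= t * e / 2 by rewrite ge_min lexx orbT.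
have [y [q [gy yx]]] := good_dense bd e'0.
have [yb q1 q0 qy] := good_normal gy.
exists y, q; split=> // [i|].
  have := yx i; rewrite !mxE => h.
  have : `|t * u 0 i| <= e / 4 by rewrite -tM normrM (gtr0_norm t0) ler_wpM2l // ltW.
  move: h sM; rewrite tM !ltr_norml !ler_norml.
  by move=> /andP[? ?] /andP[? ?] /andP[? ?]; apply/andP; split; lra.
have h1 := normal_boundary A_open A_lower vx yb.
have h2 := normal_boundary A_open A_lower qy xb.
pose r := y - (x + t *: u + const_mx s).
have yE : y = x + t *: u + const_mx s + r by rewrite /r addrC subrK.
have hr p : nonneg p -> tot p = 1 -> `|dot p r| <= e'.
  move=> p0 p1; apply: le_trans (ler_norm_sum _ _ _) _.
  rewrite -[leRHS]mul1r -p1 /tot mulr_suml; apply: ler_sum => i _.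
  rewrite normrM (ger0_norm (p0 i)) ler_wpM2l //; apply: ltW.
  by have := yx i; rewrite /r !mxE.
have dE p : tot p = 1 -> dot p y = dot p x + t * dot p u + s + dot p r.
  by move=> p1; rewrite yE !dotDr dotZr dot_const -/(tot p) p1 mul1r.
move: h1 h2; rewrite !dE //.
have := hr v v0 v1; have := hr q q0 q1; rewrite !ler_norml.
move=> /andP[? ?] /andP[? ?] ? ?.
rewrite -(ler_pM2l t0) mulrDr; lra.
Qed.

(** The normals from [approx_support] lie in the unit cube; [q] is a cluster point of them as the
    tolerance tends to 0. *)
Lemma support_limit x v u : boundary A x -> nonneg v -> tot v = 1 ->
  normal_at A v x -> exists2 q, limit_normals x q & dot v u <= dot q u.
Proof.
move=> xb v0 v1 vx.
pose T e : set 'rV[R]_d := [set q | exists y, [/\ good y q,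
  forall i, `|y 0 i - x 0 i| < e & dot v u <= dot q u + e]].
pose F := filter_from [set e : R | 0 < e] T.
have T0 e : 0 < e -> T e !=set0.
  by move=> e0; have [y [q h]] := approx_support u xb v0 v1 vx e0; exists q, y.
have Tle e e' : e <= e' -> T e `<=` T e'.
  move=> ee q [y [gy yx h]]; exists y; split=> // [i|]; first exact: lt_le_trans ee.
  by apply: le_trans h _; rewrite lerD2l.
have FF : ProperFilter F.
  apply: filter_from_proper; last by move=> e; exact: T0.
  apply: filter_from_filter; first by exists 1; rewrite /= ltr01.
  move=> e e' e0 e'0; exists (Num.min e e'); first by rewrite /= lt_min e0.
  by move=> q Tq; split; apply: Tle Tq; rewrite ge_min lexx ?orbT.
have Kc := @rV_compact R d (fun=> `[0, 1]%classic) (fun=> @segment_compact R 0 1).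
have FK : F [set q : 'rV[R]_d | forall i, `[0, 1]%classic (q 0 i)].
  exists 1 => //= q [y [/good_normal[_ q1 q0 _] _ _]] i.
  rewrite /= in_itv /= q0 /= -q1 /tot (bigD1 i) //= lerDl sumr_ge0 //.
have [q [_ clq]] := Kc F FF FK.
have near_q e : 0 < e -> exists q', T e q' /\ forall i, `|q' 0 i - q 0 i| < e.
  move=> e0; have [] := clq (T e) [set z : 'rV[R]_d | forall i, `|z 0 i - q 0 i| < e].
  - by exists e.
  - by apply/nbhs_rowR; exists e.
  - by move=> q' [? ?]; exists q'.
exists q => [e e0|].
  by have [q' [[y [gy yx _]] q'q]] := near_q e e0; exists y, q'.
apply/ler_addgt0Pr => e e0.
pose M := 1 + \sum_i `|u 0 i|.
have M0 : 0 < M by rewrite ltr_wpDr // sumr_ge0 //.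
have eM : 0 < e / M by rewrite divr_gt0.
have [q' [[y [_ _ h]] q'q]] := near_q _ eM.
apply: le_trans h _; rewrite -lerBlDl.
have : dot q' u - dot q u <= e / M * \sum_i `|u 0 i|.
  rewrite -dotBl mulr_sumr; apply: ler_sum => i _.
  apply: le_trans (ler_norm _) _; rewrite normrM ler_wpM2r // !mxE.
  exact: ltW.
have : e / M + e / M * \sum_i `|u 0 i| = e.
  by rewrite -{1}[e / M]mulr1 -mulrDr divfK // gt_eqF.
lra.
Qed.

Lemma normal_in_hull x v : boundary A x -> nonneg v -> tot v = 1 ->
  normal_at A v x -> combo (limit_normals x) d v.
Proof.
move=> xb v0 v1 vx; apply: hull_of_support => //.
- exact: limit_normals_sum1.
- exact: limit_normals_compact.
- rewrite lt0n; apply/eqP => d0; move: v1; rewrite /tot big1 => [/eqP|i _].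
    by rewrite eq_sym oner_eq0.
  by have : (i < 0)%N by rewrite -[X in (_ < X)%N]d0.
- by move=> u; exact: support_limit.
Qed.

End LimitNormals.

(** * The logarithmic domain *)

(** The graph lies above its tangent at the intermediate point [c]; two tangent inequalities are
    averaged. *)
Lemma expR_convex {R : realType} (t a b : R) : 0 <= t <= 1 ->
  expR (t * a + (1 - t) * b) <= t * expR a + (1 - t) * expR b.
Proof.
move=> /andP[t0 t1]; set c := t * a + (1 - t) * b.
have tangent x : expR c * (1 + (x - c)) <= expR x.
  have -> : expR x = expR c * expR (x - c) by rewrite -expRD addrC subrK.
  by apply: ler_wpM2l; [exact: expR_ge0|exact: expR_ge1Dx].
have ha := ler_wpM2l t0 (tangent a).
have t1' : 0 <= 1 - t by lra.
have hb := ler_wpM2l t1' (tangent b).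
apply: le_trans (lerD ha hb); rewrite le_eqVlt; apply/orP; left; apply/eqP.
rewrite /c; ring.
Qed.

Section LogDomain.
Context {R : realType} {d : nat}.
Variable a : mindex d -> R.
Hypothesis a_ge0 : forall r, 0 <= a r.
Hypothesis D0 : convergence_domain a 0.
Implicit Types (x y v q : 'rV[R]_d) (t e : R).

Local Notation D := (convergence_domain a).
Local Notation A := (log_domain D).

Lemma log_domain_lower x y : A x -> (forall i, y 0 i <= x 0 i) -> A y.
Proof.
move=> Ax yx; apply: (convergence_domain_le a_ge0 Ax) => i.
by rewrite !mxE !nrm_toC !ger0_norm ?expR_ge0 // ler_expR.
Qed.

Lemma log_domain_open : open A.
Proof.
rewrite openE => x Ax; apply/nbhs_rowR.
have /near_boxP[e e0 De] : \forall z \near cexp x, D z.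
  exact: (convergence_domain_open Ax).
have [b b0 nb] := cexp_near x e0.
exists b; first exact: b0.
move=> y yx; have -> : y = x + (y - x) by rewrite addrC subrK.
by apply/De/nb => i; rewrite !mxE ltW.
Qed.

Lemma log_domainP x : A x <-> exists2 u : 'rV[R]_d,
  (forall i, x 0 i < u 0 i) & asum a (fun i => expR (u 0 i)).
Proof.
split.
  move=> /(convergence_domainP a_ge0)[p [xp ap]].
  have p0 i : 0 < p i by apply: le_lt_trans (nrm_ge0 _) (xp i).
  exists (\row_i ln (p i)) => [i|].
    have := xp i; rewrite !mxE nrm_toC ger0_norm ?expR_ge0 // => h.
    by rewrite -ltr_expR lnK // posrE.
  have -> // : (fun i => expR ((\row_i ln (p i)) 0 i)) = p.
  by apply/funext => i; rewrite mxE lnK // posrE.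
move=> [u xu au]; apply/(convergence_domainP a_ge0).
exists (fun i => expR (u 0 i)); split=> // i.
by rewrite mxE nrm_toC ger0_norm ?expR_ge0 // ltr_expR.
Qed.

Lemma mon_expR x r : mon (fun i => expR (x 0 i)) r = expR (\sum_i x 0 i * (r i)%:R).
Proof.
by rewrite expR_sum; apply: eq_bigr => i _; rewrite expRM_natr.
Qed.

(** In logarithmic coordinates each term is a nonnegative multiple of the exponential of a linear
    form, hence convex. *)
Lemma log_domain_convex x y t : 0 <= t <= 1 -> A x -> A y -> A (t *: x + (1 - t) *: y).
Proof.
move=> t01 /log_domainP[u xu [B uB]] /log_domainP[v yv [B' vB]].
have /andP[t0 t1] := t01; have t1' : 0 <= 1 - t by rewrite subr_ge0.
apply/log_domainP; exists (t *: u + (1 - t) *: v) => [i|].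
  rewrite !mxE; have [->|tn0] := eqVneq t 0; first by rewrite subr0 !mul0r !mul1r !add0r.
  apply: ltr_leD; first by rewrite ltr_pM2l // lt_def tn0.
  by rewrite ler_wpM2l // ltW.
exists (t * B + (1 - t) * B').
apply: bnd_le (bndD (bndZ t0 uB) (bndZ t1' vB)) => r.
rewrite [t * (a r * _)]mulrCA [(1 - t) * (a r * _)]mulrCA -mulrDr ler_wpM2l // !mon_expR.
have -> : \sum_i (t *: u + (1 - t) *: v) 0 i * (r i)%:R =
    t * (\sum_i u 0 i * (r i)%:R) + (1 - t) * (\sum_i v 0 i * (r i)%:R).
  rewrite !mulr_sumr -big_split /=; apply: eq_bigr => i _.
  by rewrite !mxE mulrDl !mulrA.
exact: expR_convex.
Qed.

Lemma log_domain_nonempty : A !=set0.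
Proof.
have [p [p0 ap]] := iffLR (convergence_domainP a_ge0 0) D0.
have {}p0 i : 0 < p i by have := p0 i; rewrite mxE nrm0.
exists (\row_i (ln (p i) - 1)); apply/log_domainP; exists (\row_i ln (p i)).
  by move=> i; rewrite !mxE; lra.
have -> // : (fun i => expR ((\row_i ln (p i)) 0 i)) = p.
by apply/funext => i; rewrite mxE lnK // posrE.
Qed.

Lemma nrm_lt_domain y (z : 'rV[C R]_d) : boundary A y ->
  (forall i, nrm (z 0 i) < expR (y 0 i)) -> D z.
Proof.
move=> yb zy.
(* The midpoint is positive even where the modulus is 0, so its logarithm is meaningful. *)
pose x : 'rV[R]_d := \row_i ln ((nrm (z 0 i) + expR (y 0 i)) / 2).
have m0 i : 0 < (nrm (z 0 i) + expR (y 0 i)) / 2.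
  by rewrite divr_gt0 // ltr_wpDl ?nrm_ge0 // expR_gt0.
have Ax : A x.
  apply: (boundary_lt log_domain_open log_domain_lower yb) => i.
  by rewrite mxE -ltr_expR lnK ?posrE //; have := zy i; lra.
apply: (convergence_domain_le a_ge0 Ax) => i.
rewrite !mxE nrm_toC ger0_norm ?expR_ge0 // lnK ?posrE //.
by have := zy i; lra.
Qed.

Lemma boundary_cexp y : boundary A y -> boundary D (cexp y).
Proof.
move=> yb; have [nAy ye] := iffLR (boundaryP log_domain_open log_domain_lower y) yb.
split; last by have /interior_id -> := @convergence_domain_open R d a.
move=> W /near_boxP[e e0 We]; have [b b0 nb] := cexp_near y e0.
exists (cexp (y + const_mx (- b))); split; first exact: ye.
by apply/We/nb => i; rewrite mxE normrN gtr0_norm.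
Qed.

End LogDomain.

(** * Neighbourhoods in projective space through representatives *)

Section Projective.
Context {R : realType} {d : nat}.
Implicit Types (u v q : 'rV[R]_d) (P : set (RP R d)).

Definition nonzero_of u (u0 : u != 0) : nonzero R d := exist _ u (mem_set u0).

Definition proj_class u (u0 : u != 0) : RP R d := (\pi_(RP R d) (nonzero_of u0))%qT.

Lemma homog_proj_class u (u0 : u != 0) : homog u (proj_class u0).
Proof. by exists (nonzero_of u0). Qed.

Lemma nbhs_proj_class u (u0 : u != 0) P : nbhs (proj_class u0) P ->
  exists2 e : R, 0 < e & forall v (v0 : v != 0), (forall i, `|v 0 i - u 0 i| < e) ->
    P (proj_class v0).
Proof.
move=> /(@pi_continuous _ {eq_quot (@collinear_equiv R d)}%qT (nonzero_of u0)).
rewrite /nbhs /= => -[B [[X oX XB] Bu BP]].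
have Xu : nbhs u X.
  by apply: open_nbhs_nbhs; split=> //; move: Bu; rewrite -XB.
have [e e0 h] := iffLR (nbhs_rowR _ _) Xu.
exists e => // v v0 vu; apply: BP; rewrite -XB; exact: h.
Qed.

Lemma tot_neq0 u : tot u != 0 -> u != 0.
Proof.
apply: contra_neq => ->; rewrite /tot big1 // => i _; exact: mxE.
Qed.

End Projective.

(* In the order of C, [0 < z 0 i] says that the coordinate is real and positive. *)
Theorem mainTheorem2 (R : realType) (d : nat) (a : mindex d -> R)
    (U : set 'rV[C R]_d) (G H : 'rV[C R]_d -> C R)
    (D := convergence_domain a) (V := zero_set U H)
    (a_ge0 : forall r, 0 <= a r)
    (U_open : open U) (D_sub_U : closure D `<=` U)
    (G_analytic : analytic_on U G) (H_analytic : analytic_on U H)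
    (H0 : H 0 != 0)
    (F_eq : \forall z \near (0 : 'rV[C R]_d),
        has_abs_sum (series_term a z) (G z / H z))
    (GH_coprime : forall w, U w -> germ_coprime w G H)
    (H_squarefree : forall w, U w -> germ_squarefree w H)
    (V_nonempty : V !=set0)
    (logD_strict : strictly_convex (log_domain D))
    (p : RP R d) :
  (normal_directions (log_domain D))° p ->
  exists z : 'rV[C R]_d,
    [/\ minimal_point V z, forall i, 0 < z 0 i & Kcone H V D z p].
Proof.
move=> /interior_subset[v [vp [y0 y0b vy]]].
pose A := log_domain D.
have D0 : D 0 by exact: convergence_domain0 F_eq.
have A_open : open A by exact: log_domain_open.
have A_lower (x y : 'rV[R]_d) : A x -> (forall i, y 0 i <= x 0 i) -> A y by exact: log_domain_lower.
have A_nonempty : A !=set0 by exact: log_domain_nonempty.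
have A_convex x y t : 0 <= t <= 1 -> A x -> A y -> A (t *: x + (1 - t) *: y).
  by exact: log_domain_convex.
have A_proper : exists x, ~ A x.
  by exists y0; have [] := iffLR (boundaryP A_open A_lower _) y0b.
have bdD y : boundary A y -> boundary D (cexp y) by exact: boundary_cexp.
have bdU y : boundary A y -> U (cexp y) by move=> /bdD[cl _]; exact: D_sub_U.
have Han y : boundary A y -> analytic_at H (cexp y).
  by move=> /bdU; exact: H_analytic.
have Hsf y : boundary A y -> germ_squarefree (cexp y) H.
  by move=> /bdU; exact: H_squarefree.
have Hz y : boundary A y -> H (cexp y) = 0.
  move=> yb; apply: (pringsheim a_ge0 D_sub_U G_analytic H_analytic H0 F_eq GH_coprime).
  - by move=> i; exact: expR_gt0.
  - move=> x xy; apply: (nrm_lt_domain a_ge0 yb) => i.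
    by rewrite mxE nrm_toC; have /andP[x0 ?] := xy i; rewrite gtr0_norm.
  - exact: bdU.
  - by have [] := iffLR (boundaryP A_open A_lower _) yb.
have Hn y : A y -> H (cexp y) != 0.
  exact: (denominator_neq0 a_ge0 D_sub_U G_analytic H_analytic H0 F_eq GH_coprime).
(* The last two clauses make exp y a smooth point of [V] and the class of [q] its direction dir(exp
   y). *)
pose good y q := [/\ boundary A y, tot q = 1, nonneg q & normal_at A q y] /\
  (exists i, tcoef H (cexp y) (munit i) != 0) /\
  exists2 N, N != 0 & forall i,
    tcoef H (cexp y) (munit i) * toC (expR (y 0 i)) = N * toC (q 0 i).
have good_normal y q : good y q ->
    [/\ boundary A y, tot q = 1, nonneg q & normal_at A q y] by case.
have good_dense y e : boundary A y -> 0 < e ->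
    exists y' q, good y' q /\ forall i, `|y' 0 i - y 0 i| < e.
  move=> yb e0.
  have [y' [y'b y'y y'n]] := smooth_points_dense A_open A_lower A_nonempty
    A_proper A_convex Han Hz Hsf Hn yb e0.
  have [r _ HP] := tcoefP (Han y' y'b).
  have Hv : vanishes_near A H y' by exists 1 => // x xb _; exact: Hz.
  have [q [qE q1 qt]] := tangent_real A_open A_lower A_nonempty A_proper y'b HP Hv y'n.
  have qn := tangent_normal A_open A_lower A_nonempty A_proper A_convex y'b qt.
  exists y', q; split=> //; split; first by split=> //; exact: normal_ge0 qn.
  split=> //; exists (\sum_i tcoef H (cexp y') (munit i) * toC (expR (y' 0 i))) => //.
  exact: (tangent_sum_neq0 A_open A_lower A_nonempty A_proper y'b HP Hv).
pose z := cexp y0; exists z; split.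
- split; first by split; [exact: bdU|exact: Hz].
    by move=> i; rewrite mxE -nrm_eq0 nrm_toC normr_eq0 gt_eqF // expR_gt0.
  move=> [z' [_ z'0] z'z].
  suff /(denominator_neq0 a_ge0 D_sub_U G_analytic H_analytic H0 F_eq GH_coprime) :
    D z' by rewrite z'0 eqxx.
  apply: (nrm_lt_domain a_ge0 y0b) => i.
  by have := z'z i; rewrite !normCE toC_lt mxE nrm_toC ger0_norm ?expR_ge0.
- by move=> i; rewrite mxE toC_gt0 expR_gt0.
have vn : nonneg v by exact: normal_ge0 vy.
have v0 : 0 < tot v.
  rewrite lt_def sumr_ge0 ?andbT => [|i _]; last exact: vn.
  have [u uv _] := vp; have /= u0 := set_valP u.
  apply: contra_neq u0 => /psumr_eq0P tv0.
  by rewrite -[val u]/(set_val u) uv; apply/rowP => i; rewrite mxE tv0.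
(* The hull lemma needs total 1; the factor [tot v] is absorbed afterwards into the coefficients by
   [comboZ]. *)
pose v1 := (tot v)^-1 *: v.
have vE : v = tot v *: v1 by rewrite scalerA divff ?gt_eqF // scale1r.
have v1n : nonneg v1.
  by move=> i; rewrite mxE mulr_ge0 ?invr_ge0 ?(ltW v0) //; exact: vn.
have v11 : tot v1 = 1 by rewrite totZ mulVf // gt_eqF.
have v1y : normal_at A v1 y0.
  move=> x Ax; rewrite !dotZl ler_wpM2l ?invr_ge0 ?(ltW v0) //; exact: vy.
have := normal_in_hull A_open A_lower A_nonempty A_proper good_normal good_dense
  y0b v1n v11 v1y.
move=> /(comboZ (ltW v0)); rewrite -vE => -[u [c [uL c0 vE']]].
exists v; split=> //; exists d, u, c; split=> // k; split.
  exact: (limit_normals_nonneg good_normal (uL k)).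
have uk0 : u k != 0.
  by apply: tot_neq0; rewrite (limit_normals_sum1 good_normal (uL k)) oner_neq0.
exists (proj_class uk0); last exact: homog_proj_class.
move=> W P /near_boxP[e e0 We] /nbhs_proj_class[e' e'0 Pe].
have [b b0 nb] := cexp_near y0 e0.
have m0 : 0 < Num.min b e' by rewrite lt_min b0.
(* One tolerance serves twice: below [b] it puts exp y in [W], below [e'] it puts the class of [q]
   in [P]. *)
have [y [q [[[yb q1 _ _] [[i yi] [N N0 NE]]] yy0 quk]]] := uL k _ m0.
have q0 : q != 0 by apply: tot_neq0; rewrite q1 oner_neq0.
have [r _ HP] := tcoefP (Han y yb).
exists (cexp y), (proj_class q0); split.
- have -> : y = y0 + (y - y0) by rewrite addrC subrK.
  apply/We/nb => j; rewrite !mxE; apply: ltW; apply: lt_le_trans (yy0 j) _.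
  by rewrite ge_min lexx.
- split; first by split; [exact: bdU|exact: Hz].
  exists H; split; first exact: Han.
    by exists i; rewrite (ps_partial i HP).
  have /near_boxP[e2 e20 Ue] : \forall w \near cexp y, U w by exact: U_open (bdU y yb).
  by apply/near_boxP; exists e2 => // w /Ue Uw; split=> [[]|].
- exact: bdD.
- exists q; split; first exact: homog_proj_class.
  exists N^-1; first by rewrite invr_eq0.
  move=> j; apply: (mulfI N0); rewrite mulVKf // -NE (ps_partial j HP) mxE.
  by rewrite mulrC.
- apply: Pe => j; apply: lt_le_trans (quk j) _.
  by rewrite ge_min lexx orbT.
Qed.
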